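(* Let $0<\alpha<2$ and let $G$ be a non-elementary Gromov hyperbolic group acting properly discontinuously and cocompactly by isometries on a Gromov-hyperbolic space $X$. Let $\mu^{BMS}$ be the Bowen–Margulis–Sullivan measure on $(\partial_GX\times\partial_GX)\setminus\Delta$, where $\Delta$ is the diagonal, and let $\phi_g(x,y)=(g^{-1}x,g^{-1}y)$ be the diagonal $G$-action. Then for every measurable $B\subset(\partial_GX\times\partial_GX)\setminus\Delta$ with $\mu^{BMS}(B)<\infty$ and every sequence $F_n\uparrow G$ of finite subsets, $$\frac1{|F_n|}\sum_{g\in F_n}\mu^{BMS}\big(B\cap\phi_g(B)\big)\to0\quad\text{as }n\to\infty.$$ Hence the associated $G$-indexed stationary $S\alpha S$ random field is ergodic.
   Context: $X$ is a proper geodesic Gromov-hyperbolic metric space (e.g. a Cayley graph of $G$ for a finite generating set), $\partial_GX$ its Gromov boundary, $o\in X$ a basepoint, $\langle x,y\rangle_o$ the Gromov product extended to $\partial_GX$ (well defined up to bounded error). The Busemann function is $\beta_\xi(y,x)=\limsup_{z\to\xi}(d(x,z)-d(y,z))$. The Patterson–Sullivan measure $\mu=\mu_o$ belongs to the quasiconformal density $(\mu_x)_{x\in X}$ on $\partial_GX$ given by Patterson's construction: it is $G$-equivariant, consists of finite positive Borel measures, and satisfies $\frac1Ce^{-v\beta_\xi(y,x)}\le\frac{d\mu_x}{d\mu_y}(\xi)\le Ce^{-v\beta_\xi(y,x)}$ for some $C\ge1$, where $v$ is its dimension (the critical exponent of $\sum_{g}e^{-s\,d(o,g.o)}$, equal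 to the Hausdorff dimension of $\mu$). The Bowen–Margulis–Sullivan measure $\mu^{BMS}$ is a $G$-invariant Radon measure on $(\partial_GX\times\partial_GX)\setminus\Delta$ in the measure class of $\mu\times\mu$, of the form $d\mu^{BMS}(x,y)=e^{F(x,y)}\,d\mu(x)\,d\mu(y)$ with $F$ measurable and $F(x,y)=2v\langle x,y\rangle_o+O(1)$ (such a measure exists by work of Furman and Bader–Furman). $F_n\uparrow G$ means $F_n$ is increasing with union $G$. For the action $\phi_g(x)=g^{-1}.x$ of $G$ on $(S,\mu^{BMS})$, $S=(\partial_GX\times\partial_GX)\setminus\Delta$, an associated $S\alpha S$ random field is a stationary field $\{Y_g\}_{g\in G}$ such that for some family of measurable $c_g:S\to\{\pm1\}$ with $c_{g_1g_2}(x)=c_{g_1}(x)c_{g_2}(\phi_{g_1}(x))$ a.e., and some real $f\in L^\alpha(S,\mu^{BMS})$, with $f_g=c_g\,\big(\frac{d(\mu^{BMS}\circ\phi_g)}{d\mu^{BMS}}\big)^{1/\alpha}(f\circ\phi_g)$ and $\bigcup_g\{f_g\neq0\}=S$ modulo null sets, one has $\mathbb E\exp\big(i\sum_ja_jY_{g_j}\big)=\exp\big(-\int_S|\sum_ja_jf_{g_j}|^\alpha d\mu^{BMS}\big)$ for all finite real linear combinations. The ergodicity statement is for every such field. Stationary means left-stationary ($\{Y_{hg}\}_g\overset d=\{Y_g\}_g$ for all $h\in G$); ergodic means every left-translation-invariant measurable subset of $\mathbb R^G$ has probability $0$ or $1$ under the law of $\{Y_g\}$. *)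

(* Defs.v *)
From HB Require Import structures.
From mathcomp Require Import all_boot all_order all_algebra finmap.
From mathcomp Require Import all_classical all_reals all_analysis.

Set Implicit Arguments.
Unset Strict Implicit.
Unset Printing Implicit Defensive.

Import Order.TTheory GRing.Theory Num.Theory.
Import numFieldNormedType.Exports.

Local Open Scope classical_set_scope.
Local Open Scope ring_scope.

Definition gromov_product (R : realType) (T : Type) (d : T -> T -> R)
    (o x y : T) : R :=
  (d x o + d y o - d x y) / 2.

Definition gromov_hyperbolic (R : realType) (T : Type) (d : T -> T -> R) :=
  exists delta : R, forall o x y z : T,
    Num.min (gromov_product d o x y) (gromov_product d o y z) - delta
      <= gromov_product d o x z.

Definition proper_space (R : realType) (X : metricType R) :=
  forall (x : X) (r : R), compact [set y : X | mdist x y <= r].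

Definition geodesic_space (R : realType) (X : metricType R) :=
  forall x y : X, exists gamma : R -> X,
    [/\ gamma 0 = x, gamma (mdist x y) = y &
        forall s t : R, 0 <= s <= mdist x y -> 0 <= t <= mdist x y ->
          mdist (gamma s) (gamma t) = `|s - t|].

Definition words (G : groupType) (S : {fset G}) (g : G) : set (seq G) :=
  [set s | (forall x, x \in s -> x \in S \/ (x^-1)%g \in S)
           /\ (\prod_(x <- s) x)%g = g].

Definition generates (G : groupType) (S : {fset G}) :=
  forall g : G, words S g !=set0.

Definition word_dist (R : realType) (G : groupType) (S : {fset G})
    (g h : G) : R :=
  inf [set (size s)%:R | s in words S (g^-1 * h)%g].

Definition hyperbolic_group (R : realType) (G : groupType) :=
  exists S : {fset G}, generates S /\ gromov_hyperbolic (@word_dist R G S).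

(* A cyclic subgroup of finite index; finite groups are covered by [a = 1]. *)
Definition elementary (G : groupType) :=
  exists (a : G) (T : {fset G}), forall g : G,
    exists (n : nat) (t : G),
      t \in T /\ (g = (a ^+ n * t)%g \/ g = (a ^- n * t)%g).

Definition isometric_action (R : realType) (G : groupType) (X : metricType R)
    (act : G -> X -> X) :=
  [/\ forall x, act 1%g x = x,
      forall g h x, act (g * h)%g x = act g (act h x) &
      forall g x y, mdist (act g x) (act g y) = mdist x y].

Definition properly_discontinuous (R : realType) (G : groupType)
    (X : metricType R) (act : G -> X -> X) :=
  forall K : set X, compact K ->
    finite_set [set g : G | (act g @` K) `&` K !=set0].

Definition cocompact (R : realType) (G : groupType) (X : metricType R)
    (act : G -> X -> X) :=
  exists2 K : set X, compact K & \bigcup_g (act g @` K) = setT.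

Section boundary.
Context {R : realType} {X : metricType R} (o : X).
Local Notation "<| x , y |>" := (gromov_product (@mdist R X) o x y).

Definition gromov_seq (x : nat -> X) :=
  <|x ij.1, x ij.2|> @[ij --> (\oo, \oo)] --> +oo.

Definition gromov_equiv (x y : nat -> X) :=
  <|x ij.1, y ij.2|> @[ij --> (\oo, \oo)] --> +oo.

Definition gromov_class (x : nat -> X) : set (nat -> X) :=
  [set y | gromov_seq y /\ gromov_equiv x y].

(* Measurable types are pointed, so a junk point [set0] is adjoined exactly
   when there is no Gromov sequence at all; see [gboundaryP] below. *)
Definition is_gboundary (xi : set (nat -> X)) :=
  (exists2 x, gromov_seq x & xi = gromov_class x)
  \/ ((forall x, ~ gromov_seq x) /\ xi = set0).

Record gboundary := GBoundary {
  gseqs : set (nat -> X);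
  gseqsP : is_gboundary gseqs }.

Lemma gboundaryP (x : nat -> X) (xi : gboundary) : gromov_seq x ->
  exists2 y, gromov_seq y & gseqs xi = gromov_class y.
Proof. by move=> xP; case: xi => s /= [//|[/(_ x)]]. Qed.

Lemma gboundary_inhabited : {xi : set (nat -> X) | is_gboundary xi}.
Proof.
apply: cid; have [[x xP]|noseq] := pselect (exists x, gromov_seq x).
  by exists (gromov_class x); left; exists x.
by exists set0; right; split=> // x xP; apply: noseq; exists x.
Qed.

HB.instance Definition _ := gen_eqMixin gboundary.
HB.instance Definition _ := gen_choiceMixin gboundary.
HB.instance Definition _ :=
  isPointed.Build gboundary (GBoundary (svalP gboundary_inhabited)).

(* The Gromov product extended to the boundary as the supremum of the lower
   limits over representing sequences; on a hyperbolic space the other usual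
   extensions differ from it by a bounded error. *)
Definition bd_product (xi eta : gboundary) : \bar R :=
  ereal_sup [set limf_einf (fun ij : nat * nat => <|xy.1 ij.1, xy.2 ij.2|>%:E)
                           (filter_prod \oo \oo)
            | xy in gseqs xi `*` gseqs eta].

Definition bdX_product (xi : gboundary) (z : X) : \bar R :=
  ereal_sup [set limf_einf (fun i : nat => <|x i, z|>%:E) \oo
            | x in gseqs xi].

Definition gboundary_open : set_system gboundary :=
  [set U | forall xi, U xi ->
     exists r : R, [set eta | (r%:E < bd_product xi eta)%E] `<=` U].

Lemma gboundary_openT : gboundary_open setT.
Proof. by move=> xi _; exists 0. Qed.

Lemma gboundary_openI : setI_closed gboundary_open.
Proof.
move=> U V Uo Vo xi [/Uo[r rU] /Vo[s sV]]; exists (Num.max r s) => eta /= lt.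
by split; [apply: rU|apply: sV]; apply: le_lt_trans lt;
  rewrite lee_fin le_max lexx ?orbT.
Qed.

Lemma gboundary_open_bigU (I : Type) (f : I -> set gboundary) :
  (forall i, gboundary_open (f i)) -> gboundary_open (\bigcup_i f i).
Proof.
move=> fo xi [i _ /(fo i)[r rf]]; exists r.
by move=> eta /rf ?; exists i.
Qed.

HB.instance Definition _ := isOpenTopological.Build gboundary
  gboundary_openT gboundary_openI gboundary_open_bigU.

Definition gboundary_display : measure_display.
Proof. by constructor. Qed.

Let borel : set_system gboundary := <<s [set U : set gboundary | open U] >>.

Let borel0 : borel set0.
Proof. exact: sigma_algebra0. Qed.

Let borelC A : borel A -> borel (~` A).
Proof. by move=> ?; rewrite -setTD; exact: sigma_algebraCD. Qed.

Let borel_bigcup (F : (set gboundary)^nat) :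
  (forall i, borel (F i)) -> borel (\bigcup_i F i).
Proof. exact: sigma_algebra_bigcup. Qed.

HB.instance Definition _ := isMeasurable.Build gboundary_display gboundary
  borel0 borelC borel_bigcup.

(* The filter on [X] of the neighbourhoods of a boundary point. *)
Definition to_bd (xi : gboundary) : set_system X :=
  [set V | exists r : R, [set z | (r%:E < bdX_product xi z)%E] `<=` V].

Definition busemann (xi : gboundary) (y x : X) : R :=
  fine (limf_esup (fun z => (mdist x z - mdist y z)%:E) (to_bd xi)).

Definition bd_pairs : set (gboundary * gboundary) := [set z | z.1 <> z.2].

Section action.
Context {G : groupType} (act : G -> X -> X).

(* The class of the image sequence; it is unique for an isometric action on a
   hyperbolic space. *)
Definition bd_act (g : G) (xi : gboundary) : gboundary :=
  get [set eta | exists2 x, gseqs xi x & gseqs eta (act g \o x)].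

Definition bd_phi (g : G) (z : gboundary * gboundary) : gboundary * gboundary :=
  (bd_act g^-1%g z.1, bd_act g^-1%g z.2).

End action.
End boundary.
Arguments bd_pairs {R X} o.

Section measures.
Context {R : realType} {G : groupType} {X : metricType R}.
Context (act : G -> X -> X) (o : X).
Local Notation bd := (gboundary o).
Local Notation S := (bd_pairs o).

Definition critical_exponent : R :=
  inf [set s : R |
    (\esum_(g in [set: G]) (expR (- s * mdist o (act g o)))%:E < +oo)%E].

Definition equivariant (mu : X -> {finite_measure set bd -> \bar R}) :=
  forall g x (A : set bd), measurable A ->
    mu (act g x) A = mu x (bd_act act g @^-1` A).

Definition quasiconformal (v : R)
    (mu : X -> {finite_measure set bd -> \bar R}) :=
  exists2 C : R, 1 <= C & forall x y : X,
    mu x `<< mu y /\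
    {ae mu y, forall xi : bd,
      ((C^-1 * expR (- v * busemann xi y x))%:E
        <= Radon_Nikodym (charge_of_finite_measure (mu x)) (mu y) xi)%E /\
      (Radon_Nikodym (charge_of_finite_measure (mu x)) (mu y) xi
        <= (C * expR (- v * busemann xi y x))%:E)%E}.

Definition patterson_sullivan (mu : X -> {finite_measure set bd -> \bar R}) :=
  [/\ forall x, (0 < mu x setT)%E, equivariant mu
    & quasiconformal critical_exponent mu].

(* Measures on [S] are represented by measures on the square of the boundary
   that do not charge the diagonal. *)
Definition radon_off_diagonal (m : {measure set (bd * bd) -> \bar R}) :=
  [/\ m (~` S) = 0%E,
      forall K : set (bd * bd), compact K -> K `<=` S -> (m K < +oo)%E &
      forall A : set (bd * bd), measurable A -> A `<=` S ->
        m A = ereal_sup [set m K | K in [set K | compact K /\ K `<=` A]]].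

Definition bowen_margulis_sullivan (mu : X -> {finite_measure set bd -> \bar R})
    (m : {measure set (bd * bd) -> \bar R}) :=
  [/\ radon_off_diagonal m,
      forall g (A : set (bd * bd)), measurable A -> A `<=` S ->
        m (bd_phi act g @^-1` A `&` S) = m A,
      forall A : set (bd * bd), measurable A -> A `<=` S ->
        (m A = 0%E <-> (mu o \x mu o)%E A = 0%E) &
      exists F : bd * bd -> R,
        [/\ measurable_fun S F,
            exists M : R, forall z, S z ->
              `|F z - 2 * critical_exponent * fine (bd_product z.1 z.2)| <= M &
            forall A : set (bd * bd), measurable A -> A `<=` S ->
              m A = (\int[(mu o \x mu o)%E]_(z in A) (expR (F z))%:E)%E]].

End measures.

Section fields.
Context {R : realType} {G : groupType}.

Definition cylinder_algebra : set_system (G -> R) :=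
  <<s [set A | exists (g : G) (B : set R),
                 measurable B /\ A = (fun y => y g) @^-1` B] >>.

Definition left_shift (h : G) (y : G -> R) : G -> R := fun g => y (h * g)%g.

Context {d : measure_display} {Omega : measurableType d}.
Context (P : probability Omega R) (Y : G -> {RV P >-> R}).

Definition field_law (A : set (G -> R)) : \bar R :=
  P [set w | A (fun g => Y g w)].

Definition stationary_field :=
  forall (h : G) (A : set (G -> R)), cylinder_algebra A ->
    field_law (left_shift h @^-1` A) = field_law A.

Definition ergodic_field :=
  forall A : set (G -> R), cylinder_algebra A ->
    (forall h : G, left_shift h @^-1` A = A) ->
    field_law A = 0%E \/ field_law A = 1%E.

Context {X : metricType R} (act : G -> X -> X) (o : X).
Context (m : {measure set (gboundary o * gboundary o) -> \bar R}).
Local Notation S := (bd_pairs o).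
Local Notation phi := (bd_phi act).

(* [w] is a version of the Radon-Nikodym derivative of [m \o phi g]. *)
Definition rn_derivative (g : G) (w : gboundary o * gboundary o -> R) :=
  [/\ measurable_fun S w, forall z, S z -> 0 <= w z &
      forall A : set (gboundary o * gboundary o), measurable A -> A `<=` S ->
        m (phi g @` A) = (\int[m]_(z in A) (w z)%:E)%E].

Definition sign_cocycle (c : G -> gboundary o * gboundary o -> R) :=
  [/\ forall g, measurable_fun S (c g),
      forall g z, S z -> c g z = 1 \/ c g z = -1 &
      forall g h, {ae m, forall z, S z ->
        c (g * h)%g z = c g z * c h (phi g z)}].

(* The joint characteristic function is real, so the identity for
   [E exp (i U)] is split into [E cos U] and [E sin U]. *)
Definition sas_field (alpha : R) :=
  stationary_field /\
  exists (c w : G -> gboundary o * gboundary o -> R)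
         (f : gboundary o * gboundary o -> R),
    let f_ g z := c g z * (w g z `^ alpha^-1) * f (phi g z) in
    [/\ sign_cocycle c,
        forall g, rn_derivative g (w g),
        measurable_fun S f /\
          (\int[m]_(z in S) (`|f z| `^ alpha)%:E < +oo)%E,
        {ae m, forall z, S z -> exists g, f_ g z != 0} &
        forall (n : nat) (a : 'I_n -> R) (t : 'I_n -> G),
          'E_P[fun w => cos (\sum_(j < n) a j * Y (t j) w)%R]%E
            = (expR (- \int[m]_(z in S)
                 (`|\sum_(j < n) a j * f_ (t j) z| `^ alpha)))%:E /\
          'E_P[fun w => sin (\sum_(j < n) a j * Y (t j) w)%R]%E = 0%E].

End fields.

(* Main.v *)
Require Import Defs.
From HB Require Import structures.
From mathcomp Require Import all_boot all_order all_algebra finmap.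
From mathcomp Require Import all_classical all_reals all_analysis.
From mathcomp Require Import measurable_realfun lra.

Set Implicit Arguments.
Unset Strict Implicit.
Unset Printing Implicit Defensive.

Import Order.TTheory GRing.Theory Num.Theory.
Import numFieldNormedType.Exports.

Local Open Scope classical_set_scope.
Local Open Scope ring_scope.

(** For the first assertion it is enough that the action is mixing in the strong
    sense that, for every [B] of finite measure and every [e > 0], only finitely
    many [g] satisfy [m (B `&` phi g @` B) >= e]: then averages over any finite
    sets exhausting the infinite group [G] tend to zero ([cvg_average]). By
    invariance of [m] and exhaustion of the complement of the diagonal, [B] may be
    assumed to consist of pairs with bounded Gromov product; on such pairs [m] is
    dominated by [mu o \x mu o] ([bms_le], [bms_mixing]). A pair of this kind,
    whose translate is again of this kind, is joined by a line passing near [o]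
    and [g o], so one of its ends lies in the shadow of [g o] seen from [o]
    ([near_line_shadow]). The measure of this shadow is at most a constant times
    [exp (- v d(o, g o))] by quasiconformality ([shadow_measure_le]), which tends
    to zero if the critical exponent [v] is positive ([bounded_recurrence]).

    If [v = 0] this bound says nothing, but then the measure [mu o] is
    quasi-invariant with bounded derivatives, and a failure of mixing concentrates
    mass on ever smaller shadows, at both ends of the lines: this yields two distinct atoms ([recurrent_pairs_elementary]). Atoms have
    finite orbits, and a group with two boundary points of finite orbit is
    elementary, because a horofunction at one of them is a proper quasimorphism
    on their common stabilizer ([finite_orbits_elementary],
    [quasimorphism_elementary]).

    For the second assertion, invariance of [m] makes the Radon--Nikodym factors
    trivial. Let [F] be the kernel of a linear combination of the field. Since
    [|F|^alpha] and its translates are asymptotically disjoint by mixing, the scale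
    [\int |F + F_h|^alpha] tends to [2 \int |F|^alpha] as [h] leaves finite sets
    ([scale_additive]), where [F_h] is the kernel of the translated combination, so
    that characters of the field decorrelate ([stable_decorrelated]). Summing many pairwise almost uncorrelated
    translates, as in the mean ergodic theorem, shows that the indicator of an
    invariant event is uncorrelated with every character
    ([invariant_decorrelated]). A uniqueness argument for Fourier transforms
    ([multiplier_generated]) extends this to all events generated by the
    coordinates, including the invariant event itself, whose probability [c]
    therefore satisfies [c = c^2] ([decorrelated_ergodic]). *)

(** * Gromov products along sequences *)

Lemma cvg_pinfty2P (R : realType) (f : nat -> nat -> R) :
  (f ij.1 ij.2 @[ij --> (\oo, \oo)] --> +oo) <->
  forall A : R, exists N, forall i j, (N <= i)%N -> (N <= j)%N -> A < f i j.
Proof.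
split=> [fy A|fy].
  have /fy : nbhs +oo [set t : R | A < t] by exists A; split => //; apply: num_real.
  case=> -[U V] /= [[N _ NU] [M _ MV]] UV; exists (maxn N M) => i j.
  rewrite !geq_max => /andP[Ni Mi] /andP[Nj Mj].
  by apply: (UV (i, j)); split => /=; [exact: NU|exact: MV].
move=> B [A [_ AB]]; have [N NA] := fy A.
exists ([set i | (N <= i)%N], [set i | (N <= i)%N]) => /=; first by split; exists N.
by move=> [i j] /= [Ni Nj]; apply: AB; apply: NA.
Qed.

Section gromov_product.
Context {R : realType} {X : metricType R}.
Implicit Types p q x y z : X.
Local Notation gp := (gromov_product (@mdist R X)).

Lemma gromov_productC p x y : gp p x y = gp p y x.
Proof. by rewrite /gromov_product (metric_sym x y) (addrC (mdist x p)). Qed.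

Lemma gromov_product_le_dist p x y : gp p x y <= mdist p y.
Proof.
rewrite /gromov_product.
have := metric_triangle x y p; rewrite (metric_sym p y); lra.
Qed.

Lemma gromov_product_base p q x y : gp p x y <= gp q x y + mdist p q.
Proof.
rewrite /gromov_product (metric_sym p q).
have := metric_triangle x q p; have := metric_triangle y q p; lra.
Qed.

Lemma gromov_product_lip p x y z : gp p x y - mdist y z <= gp p x z.
Proof.
rewrite /gromov_product.
have := metric_triangle y z p; have := metric_triangle x y z; lra.
Qed.

End gromov_product.

Lemma gromov_hyperbolic_gt0 (R : realType) (T : Type) (d : T -> T -> R) :
  gromov_hyperbolic d ->
  exists2 delta : R, 0 < delta & forall o x y z : T,
    Num.min (gromov_product d o x y) (gromov_product d o y z) - delta
      <= gromov_product d o x z.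
Proof.
move=> [e he]; exists (Num.max e 1); first by rewrite lt_max ltr01 orbT.
move=> o x y z; apply: le_trans (he o x y z).
by rewrite lerD2l lerN2 le_max lexx.
Qed.

(** * Boundary points and neighbourhoods, through sequences *)

Section boundary.
Context {R : realType} {X : metricType R} (o : X).
Local Notation gp := (gromov_product (@mdist R X)).
Local Notation bd := (gboundary o).
Variables (delta : R) (delta_gt0 : 0 < delta).
Hypothesis hyp : forall o x y z : X,
  Num.min (gp o x y) (gp o y z) - delta <= gp o x z.
Implicit Types (xi eta zeta : bd) (p q : X) (x y z : nat -> X) (r s t : R).

Lemma gromov_product_trans p (a b c : X) t :
  t + delta < gp p a b -> t + delta < gp p b c -> t < gp p a c.
Proof.
move=> h1 h2; have := hyp p a b c.
have : t + delta < Num.min (gp p a b) (gp p b c) by rewrite lt_min h1 h2.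
lra.
Qed.

Lemma gromov_seqP x : gromov_seq o x <->
  forall r, exists N, forall i j, (N <= i)%N -> (N <= j)%N -> r < gp o (x i) (x j).
Proof. exact: (cvg_pinfty2P (fun i j => gp o (x i) (x j))). Qed.

Lemma gromov_equivP x y : gromov_equiv o x y <->
  forall r, exists N, forall i j, (N <= i)%N -> (N <= j)%N -> r < gp o (x i) (y j).
Proof. exact: (cvg_pinfty2P (fun i j => gp o (x i) (y j))). Qed.

Lemma gromov_equiv_sym x y : gromov_equiv o x y -> gromov_equiv o y x.
Proof.
move=> /gromov_equivP xy; apply/gromov_equivP => r; have [N hN] := xy r.
by exists N => i j Ni Nj; rewrite gromov_productC; apply: hN.
Qed.

Lemma gromov_equiv_trans y x z :
  gromov_equiv o x y -> gromov_equiv o y z -> gromov_equiv o x z.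
Proof.
move=> /gromov_equivP xy /gromov_equivP yz; apply/gromov_equivP => r.
have [N hN] := xy (r + delta); have [M hM] := yz (r + delta).
exists (maxn N M) => i j; rewrite !geq_max => /andP[Ni Mi] /andP[Nj Mj].
apply: (@gromov_product_trans _ _ (y (maxn N M))).
  by apply: hN => //; rewrite leq_maxl.
by apply: hM => //; rewrite leq_maxr.
Qed.

Lemma gseqs_gromov xi x : gseqs xi x -> gromov_seq o x.
Proof. by case: xi => s /= [[y yP ->] []|[_ ->]]. Qed.

Lemma gseqs_ex xi eta x : gseqs xi x -> exists y, gseqs eta y.
Proof.
move=> xix; have [y yP ->] := gboundaryP eta (gseqs_gromov xix).
by exists y; split.
Qed.

Lemma gseqs_equiv xi x y : gseqs xi x -> gseqs xi y -> gromov_equiv o x y.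
Proof.
case: xi => s /= [[z zP ->] [_ zx] [_ zy]|[_ -> //]].
exact: gromov_equiv_trans (gromov_equiv_sym zx) zy.
Qed.

Lemma gseqs_closed xi x y : gseqs xi x -> gromov_seq o y -> gromov_equiv o x y ->
  gseqs xi y.
Proof.
case: xi => s /= [[z zP ->] [_ zx] yP xy|[_ -> //]]; split => //.
exact: gromov_equiv_trans xy.
Qed.

Lemma gboundary_inj xi eta : gseqs xi = gseqs eta -> xi = eta.
Proof.
by case: xi eta => [s sP] [t tP] /= st; subst t; congr GBoundary; apply: Prop_irrelevance.
Qed.

Lemma gseqs_common xi eta x : gseqs xi x -> gseqs eta x -> xi = eta.
Proof.
move=> xix etax; apply: gboundary_inj; apply/seteqP; split=> y hy.
  exact: gseqs_closed etax (gseqs_gromov hy) (gseqs_equiv xix hy).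
exact: gseqs_closed xix (gseqs_gromov hy) (gseqs_equiv etax hy).
Qed.

Lemma gboundary_eq xi eta : (forall x, gseqs xi x -> gseqs eta x) -> xi = eta.
Proof.
move=> h; have [[x xix]|noseq] := pselect (exists x, gseqs xi x).
  exact: gseqs_common xix (h _ xix).
apply: gboundary_inj; apply/seteqP; split=> y hy; first by case: noseq; exists y.
by case: noseq; exact: (gseqs_ex xi hy).
Qed.

(** Neighbourhoods are handled through these two predicates, which quantify over
    all representing sequences. Up to a multiple of [delta] they are the
    superlevel sets of the extended Gromov products, but the four-point
    inequality passes to them with the loss of a single [delta] and no
    manipulation of limits. *)
Definition near_bd xi eta r := forall x y, gseqs xi x -> gseqs eta y ->
  exists N, forall i j, (N <= i)%N -> (N <= j)%N -> r < gp o (x i) (y j).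

Definition near_pt xi p t := forall x, gseqs xi x ->
  exists N, forall i, (N <= i)%N -> t < gp o (x i) p.

Lemma near_bdW xi eta r s : s <= r -> near_bd xi eta r -> near_bd xi eta s.
Proof.
move=> sr h x y xx yy; have [N hN] := h _ _ xx yy.
by exists N => i j Ni Nj; apply: le_lt_trans sr _; apply: hN.
Qed.

Lemma near_ptW xi p r s : s <= r -> near_pt xi p r -> near_pt xi p s.
Proof.
move=> sr h x xx; have [N hN] := h _ xx.
by exists N => i Ni; apply: le_lt_trans sr _; apply: hN.
Qed.

Lemma near_bdxx xi r : near_bd xi xi r.
Proof. by move=> x y xx yy; have /gromov_equivP/(_ r) := gseqs_equiv xx yy. Qed.

Lemma near_bd_trans eta xi zeta r :
  near_bd xi eta (r + delta) -> near_bd eta zeta (r + delta) -> near_bd xi zeta r.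
Proof.
move=> h1 h2 x z xx zz; have [y yy] := gseqs_ex eta xx.
have [N hN] := h1 _ _ xx yy; have [M hM] := h2 _ _ yy zz.
exists (maxn N M) => i j; rewrite !geq_max => /andP[Ni Mi] /andP[Nj Mj].
apply: (@gromov_product_trans _ _ (y (maxn N M))).
  by apply: hN => //; rewrite leq_maxl.
by apply: hM => //; rewrite leq_maxr.
Qed.

Lemma near_pt_bd eta xi p t :
  near_pt xi p (t + delta) -> near_bd xi eta (t + delta) -> near_pt eta p t.
Proof.
move=> h1 h2 y yy; have [x xx] := gseqs_ex xi yy.
have [N hN] := h1 _ xx; have [M hM] := h2 _ _ xx yy.
exists (maxn N M) => i; rewrite !geq_max => /andP[Ni Mi].
apply: (@gromov_product_trans _ _ (x (maxn N M))).
  by rewrite gromov_productC; apply: hM => //; rewrite leq_maxr.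
by apply: hN => //; rewrite leq_maxl.
Qed.

Lemma near_bd_pt p xi eta t :
  near_pt xi p (t + delta) -> near_pt eta p (t + delta) -> near_bd xi eta t.
Proof.
move=> h1 h2 x y xx yy; have [N hN] := h1 _ xx; have [M hM] := h2 _ yy.
exists (maxn N M) => i j; rewrite !geq_max => /andP[Ni Mi] /andP[Nj Mj].
apply: (@gromov_product_trans _ _ p); first exact: hN.
by rewrite gromov_productC; apply: hM.
Qed.

(** Two sequences representing the same point have arbitrarily large products,
    so one far index on one sequence controls the tails of all of them. *)
Lemma near_pt_frequently xi p t x : gseqs xi x ->
  (forall N, exists2 i, (N <= i)%N & t + delta < gp o (x i) p) -> near_pt xi p t.
Proof.
move=> xx h y yy; have /gromov_equivP/(_ (t + delta))[N hN] := gseqs_equiv yy xx.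
have [i Ni hi] := h N; exists N => j Nj.
by apply: (@gromov_product_trans _ _ (x i)) => //; apply: hN.
Qed.

Lemma near_bd_frequently xi eta r x y : gseqs xi x -> gseqs eta y ->
  (forall N, exists i j, [/\ (N <= i)%N, (N <= j)%N &
     r + delta + delta < gp o (x i) (y j)]) -> near_bd xi eta r.
Proof.
move=> xx yy h x' y' xx' yy'.
have /gromov_equivP/(_ (r + delta))[N hN] := gseqs_equiv xx' xx.
have /gromov_equivP/(_ (r + delta + delta))[M hM] := gseqs_equiv yy yy'.
have [i [j [hi hj hij]]] := h (maxn N M).
move: hi hj; rewrite !geq_max => /andP[Ni Mi] /andP[Nj Mj].
exists (maxn N M) => k l; rewrite !geq_max => /andP[Nk Mk] /andP[Nl Ml].
apply: (@gromov_product_trans _ _ (x i)); first exact: hN.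
by apply: (@gromov_product_trans _ _ (y j)) => //; exact: hM.
Qed.

Lemma near_bd_eq xi eta : (forall r, near_bd xi eta r) -> xi = eta.
Proof.
move=> h; apply: gboundary_eq => x xx; have [y yy] := gseqs_ex eta xx.
apply: (gseqs_closed yy (gseqs_gromov xx)); apply/gromov_equivP => r.
have [N hN] := h r _ _ xx yy.
by exists N => i j Ni Nj; rewrite gromov_productC; exact: hN.
Qed.

Lemma near_bd_neq xi eta : xi <> eta -> exists r, ~ near_bd xi eta r.
Proof.
by move=> ne; apply/existsNP => h; apply: ne; apply: near_bd_eq.
Qed.

Lemma limf_einf_gt (U : choiceType) (T : filteredType U) (f : T -> R) (F : set_system T) {FF : Filter F} r :
  (r%:E < limf_einf (fun i => (f i)%:E) F)%E -> \forall i \near F, r < f i.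
Proof.
rewrite limf_einfE => /ereal_sup_gt[_ [A FA <-]] rA.
apply: filterS FA => i Ai; rewrite -lte_fin; apply: lt_le_trans rA _.
by apply: ereal_inf_lbound; exists i.
Qed.

Lemma limf_einf_ge (U : choiceType) (T : filteredType U) (f : T -> R) (F : set_system T) {FF : Filter F} r :
  (\forall i \near F, r < f i) -> (r%:E <= limf_einf (fun i => (f i)%:E) F)%E.
Proof.
move=> hF; rewrite limf_einfE; apply: le_trans (ereal_sup_ubound _); last first.
  by exists [set i | r < f i] => //; exact: hF.
by apply: le_ereal_inf_tmp => _ [i /= ri <-]; rewrite lee_fin ltW.
Qed.

Lemma bd_product_gt xi eta r :
  (r%:E < bd_product xi eta)%E -> near_bd xi eta (r - delta - delta).
Proof.
move=> /ereal_sup_gt[_ [[x y] [/= xx yy] <-]].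
move=> /limf_einf_gt[[U V] /= [[N _ NU] [M _ MV]] UV].
apply: (near_bd_frequently xx yy) => K; exists (maxn K (maxn N M)), (maxn K (maxn N M)).
split; rewrite ?leq_maxl //; rewrite !subrK.
apply: (UV (_, _)); split=> /=.
  by apply: NU => /=; rewrite !leq_max leqnn orbT.
by apply: MV => /=; rewrite !leq_max leqnn !orbT.
Qed.

Lemma bd_product_ge xi eta r x : gseqs xi x -> near_bd xi eta r ->
  (r%:E <= bd_product xi eta)%E.
Proof.
move=> xx h; have [y yy] := gseqs_ex eta xx.
apply: le_trans (ereal_sup_ubound _); last by exists (x, y).
apply: limf_einf_ge; have [N hN] := h _ _ xx yy.
exists ([set i | (N <= i)%N], [set i | (N <= i)%N]) => /=; first by split; exists N.
by move=> [i j] /= [Ni Nj]; apply: hN.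
Qed.

Lemma bdX_product_ge xi p t x : gseqs xi x -> near_pt xi p t ->
  (t%:E <= bdX_product xi p)%E.
Proof.
move=> xx h; apply: le_trans (ereal_sup_ubound _); last by exists x.
by apply: limf_einf_ge; have [N hN] := h _ xx; exists N.
Qed.

(** The points with a whole neighbourhood in the shadow of [p] at level [t]: this
    variant of the shadow is open by construction, hence measurable, and it is
    squeezed between the shadows at levels [t + delta] and [t]. *)
Definition shadow p t : set bd :=
  [set xi | exists s, forall eta, near_bd xi eta s -> near_pt eta p t].

Lemma shadow_near p t xi : shadow p t xi -> near_pt xi p t.
Proof. by move=> [s]; apply; exact: near_bdxx. Qed.

Lemma near_shadow p t xi : near_pt xi p (t + delta) -> shadow p t xi.
Proof. by move=> h; exists (t + delta) => eta; apply: near_pt_bd. Qed.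

Lemma shadow_open p t : open (shadow p t).
Proof.
move=> xi [s hs]; exists (s + delta + delta + delta) => eta /= /bd_product_gt.
rewrite !addrK => h; exists (s + delta) => zeta h'.
by apply: hs; apply: near_bd_trans h h'.
Qed.

Lemma measurable_shadow p t : measurable (shadow p t).
Proof. by apply: sub_sigma_algebra; exact: shadow_open. Qed.

(** Along a representing sequence [d(o, x_i) - d(q, x_i)] is
    [2 <x_i, q>_o - d(o, q)]. The upper limit is also at most [d(o, q)], so that
    it is a real number and [fine] loses nothing. *)
Lemma busemann_ge xi q t x : gseqs xi x -> near_pt xi q t ->
  2 * t - mdist o q <= busemann xi q o.
Proof.
move=> xx h; rewrite /busemann.
set L := limf_esup _ _.
suff [L1 L2] : ((2 * t - mdist o q)%:E <= L)%E /\ (L <= (mdist o q)%:E)%E.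
  by rewrite -lee_fin fineK // fin_real // (lt_le_trans _ L1) ?ltNyr //=
     (le_lt_trans L2) ?ltry.
split; rewrite /L limf_esupE.
  apply: le_ereal_inf_tmp => _ [V [r rV] <-].
  have [N hN] := h _ xx.
  have /gromov_seqP/(_ (r + 1 + delta))[M hM] := gseqs_gromov xx.
  pose k := maxn N M.
  have Mk : (M <= k)%N by rewrite leq_maxr.
  apply: le_trans (ereal_sup_ubound (_ : _ (mdist o (x k) - mdist q (x k))%:E)); last first.
    exists (x k) => //; apply: rV => /=; apply: (@lt_le_trans _ _ (r + 1)%:E).
      by rewrite lte_fin ltrDl.
    apply: (bdX_product_ge xx); apply: (near_pt_frequently xx) => K.
    by exists (maxn K M); rewrite ?leq_maxl // hM // leq_maxr.
  have := hN k (leq_maxl _ _); rewrite lee_fin /gromov_product.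
  rewrite (metric_sym (x k) o) (metric_sym (x k) q) (metric_sym q o); lra.
apply: le_trans (ereal_inf_lbound _) _.
  by exists setT => //; exists 0.
apply: ub_ereal_sup => _ [z _ <-]; rewrite lee_fin.
have := metric_triangle o q z; lra.
Qed.
End boundary.

(** * The action on the boundary *)

Lemma countable_surj (T : Type) (t0 : T) : countable [set: T] ->
  exists e : nat -> T, forall t, exists n, e n = t.
Proof.
move=> /countable_injP[f /in2TT fI].
have /choice[e he] : forall n, exists t, forall t', f t' = n -> t = t'.
  move=> n; have [[t <-]|nt] := pselect (exists t, f t = n).
    by exists t => t' /fI ->.
  by exists t0 => t' ft'; case: nt; exists t'.
by exists e => t; exists (f t); apply: he.
Qed.

Section action.
Context {R : realType} {G : groupType} {X : metricType R}.
Context (act : G -> X -> X) (o : X).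
Local Notation gp := (gromov_product (@mdist R X)).
Local Notation bd := (gboundary o).
Local Notation bact := (@bd_act R X o G act).
Local Notation len g := (mdist o (act g o)).
Variables (delta : R) (delta_gt0 : 0 < delta).
Hypothesis hyp : forall o x y z : X,
  Num.min (gp o x y) (gp o y z) - delta <= gp o x z.
Hypothesis isom : isometric_action act.
Implicit Types (xi eta zeta : bd) (p q : X) (x y z : nat -> X) (r s t : R).

Lemma act1 p : act 1%g p = p.
Proof. by have [] := isom. Qed.

Lemma actM g h p : act (g * h)%g p = act g (act h p).
Proof. by have [] := isom. Qed.

Lemma actKV g p : act g (act g^-1%g p) = p.
Proof. by rewrite -actM mulgV act1. Qed.

Lemma mdist_act g p q : mdist (act g p) (act g q) = mdist p q.
Proof. by have [] := isom. Qed.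

Lemma mdist_actV g p q : mdist (act g^-1%g p) q = mdist p (act g q).
Proof. by rewrite -(mdist_act g) actKV. Qed.

Lemma lenV g : len g^-1%g = len g.
Proof. by rewrite metric_sym mdist_actV. Qed.

Lemma gromov_product_act g p (a b : X) :
  gp (act g p) (act g a) (act g b) = gp p a b.
Proof. by rewrite /gromov_product !mdist_act. Qed.

Lemma gromov_product_act_base g (a b : X) :
  gp o a b - len g <= gp o (act g a) (act g b).
Proof.
rewrite -(gromov_product_act g) lerBlDr metric_sym.
exact: gromov_product_base.
Qed.

Lemma act_gromov_equiv g x y : gromov_equiv o x y ->
  gromov_equiv o (act g \o x) (act g \o y).
Proof.
move=> /gromov_equivP xy; apply/gromov_equivP => r.
have [N hN] := xy (r + len g); exists N => i j Ni Nj.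
by apply: lt_le_trans (gromov_product_act_base g _ _); rewrite ltrBrDr hN.
Qed.

Lemma bd_actP g xi x : gseqs xi x -> gseqs (bact g xi) (act g \o x).
Proof.
move=> xx; have sx : gromov_seq o (act g \o x).
  exact: act_gromov_equiv (gseqs_gromov xx).
have [x' xx' xg] : [set eta : bd | exists2 x, gseqs xi x & gseqs eta (act g \o x)]
    (bact g xi).
  apply: getPex; exists (GBoundary (or_introl (ex_intro2 _ _ _ sx erefl))) => /=.
  by exists x => //; split => //; exact: sx.
apply: (gseqs_closed hyp xg sx); apply: act_gromov_equiv.
exact: (gseqs_equiv hyp xx' xx).
Qed.

Lemma gboundary_eqW xi eta zeta :
  (forall x, gseqs zeta x -> exists2 y, gseqs xi y & gseqs eta y) -> xi = eta.
Proof.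
move=> h; apply: (gboundary_eq hyp) => x xix; have [z zz] := gseqs_ex zeta xix.
by have [y yx ye] := h z zz; rewrite -(gseqs_common hyp yx ye).
Qed.

Lemma bd_act1 xi : bact 1%g xi = xi.
Proof.
apply: (@gboundary_eqW _ _ xi) => x xx; exists x => //.
have := bd_actP 1%g xx; congr (gseqs _ _).
by apply/funext => n /=; rewrite act1.
Qed.

Lemma bd_actM g h xi : bact (g * h)%g xi = bact g (bact h xi).
Proof.
apply: (@gboundary_eqW _ _ xi) => x xx.
exists (act (g * h)%g \o x); first exact: bd_actP.
have := bd_actP g (bd_actP h xx); congr (gseqs _ _).
by apply/funext => n /=; rewrite actM.
Qed.

Lemma bd_actK g : cancel (bact g) (bact g^-1%g).
Proof. by move=> xi; rewrite -bd_actM mulVg bd_act1. Qed.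

Lemma bd_actKV g : cancel (bact g^-1%g) (bact g).
Proof. by move=> xi; rewrite -bd_actM mulgV bd_act1. Qed.

Lemma near_bd_act g xi eta r :
  near_bd xi eta (r + delta + delta + len g) -> near_bd (bact g xi) (bact g eta) r.
Proof.
move=> h u v uu vv; have [x xx] := gseqs_ex xi uu; have [y yy] := gseqs_ex eta uu.
suff : near_bd (bact g xi) (bact g eta) r by apply.
apply: (near_bd_frequently hyp (bd_actP g xx) (bd_actP g yy)) => N.
have [M hM] := h _ _ xx yy; exists (maxn N M), (maxn N M).
split; rewrite ?leq_maxl //; apply: lt_le_trans (gromov_product_act_base g _ _).
by rewrite ltrBrDr; apply: hM; rewrite leq_maxr.
Qed.

(** Continuity: moving by [g] changes Gromov products by at most [len g] and
    multiples of [delta]. When no sequence converges to infinity, all products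
    are [-oo] and there is nothing to check. *)
Lemma measurable_bd_act g : measurable_fun setT (bact g).
Proof.
apply: (measurability [set U : set bd | open U]) => //= _ [U Uo <-].
rewrite setTI; apply: sub_sigma_algebra.
suff : gboundary_open (bact g @^-1` U) by [].
move=> xi /= Uxi.
have [r rU] := Uo _ Uxi.
exists (r + 1 + 4 * delta + len g) => eta /= h; apply: rU => /=.
have nb := bd_product_gt hyp h.
have [[x xx]|noseq] := pselect (exists x, gseqs xi x).
  apply: (@lt_le_trans _ _ (r + 1)%:E); first by rewrite lte_fin ltrDl.
  apply: (bd_product_ge (bd_actP g xx)); apply: near_bd_act.
  apply: near_bdW nb; lra.
suff : bd_product xi eta = -oo%E by move=> E; rewrite E in h.
rewrite /bd_product [X in ereal_sup X](_ : _ = set0) ?ereal_sup0 //.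
by apply/seteqP; split => // _ [[x y] [/= xx _] _]; case: noseq; exists x.
Qed.

Lemma measurable_bd_phi g : measurable_fun setT (bd_phi act g : bd * bd -> bd * bd).
Proof.
apply: measurable_fun_pair; apply: measurableT_comp; first exact: measurable_bd_act.
- exact: measurable_fst.
- exact: measurable_bd_act.
- exact: measurable_snd.
Qed.

Lemma bd_phi1 (z : bd * bd) : bd_phi act 1%g z = z.
Proof. by case: z => a b; rewrite /bd_phi /= invg1 !bd_act1. Qed.

Lemma bd_phiM g h (z : bd * bd) : bd_phi act (g * h)%g z = bd_phi act h (bd_phi act g z).
Proof. by rewrite /bd_phi /= invgM !bd_actM. Qed.

Lemma bd_phiK g : cancel (bd_phi act g : bd * bd -> _) (bd_phi act g^-1%g).
Proof. by move=> z; rewrite -bd_phiM mulgV bd_phi1. Qed.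

Lemma bd_phiKV g : cancel (bd_phi act g^-1%g : bd * bd -> _) (bd_phi act g).
Proof. by move=> z; rewrite -bd_phiM mulVg bd_phi1. Qed.

Lemma bd_phi_image g (A : set (bd * bd)) :
  bd_phi act g @` A = bd_phi act g^-1%g @^-1` A.
Proof.
apply/seteqP; split => [_ [z Az <-]|z Az] /=; first by rewrite bd_phiK.
by exists (bd_phi act g^-1%g z) => //; rewrite bd_phiKV.
Qed.

Lemma bd_phi_pairs g (z : bd * bd) : bd_pairs o (bd_phi act g z) <-> bd_pairs o z.
Proof.
split; rewrite /bd_pairs /= => ne e; apply: ne; first by rewrite e.
exact: (can_inj (bd_actK g^-1%g)) e.
Qed.

(** The two hypotheses say that [o] and [g o] lie at bounded distance from the
    line joining [xi] and [eta]. Going along this line, one end is then reached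
    from [o] by passing near [g o], and the other one from [g o] by passing near
    [o]; which is which depends on the position of [g o] with respect to [o].
    The proof reads this off the four-point inequality for [o], [g o] and far
    terms [x i], [y i] of representing sequences; one of the two configurations
    occurs for infinitely many [i]. *)
Lemma near_line_shadow g xi eta r :
  ~ near_bd xi eta r -> ~ near_bd (bact g^-1%g xi) (bact g^-1%g eta) r ->
  let c := len g - (r + 5 * delta) in
  (near_pt xi (act g o) c /\ near_pt (bact g^-1%g eta) (act g^-1%g o) c) \/
  (near_pt eta (act g o) c /\ near_pt (bact g^-1%g xi) (act g^-1%g o) c).
Proof.
move=> n1 n2 c.
have [x [y [xx yy]]] : exists x y, gseqs xi x /\ gseqs eta y.
  have [x [y]] : exists x y, gseqs xi x /\ gseqs eta y.
    apply: contrapT => hn; apply: n1 => x y xx yy.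
    by exfalso; apply: hn; exists x, y.
  by exists x, y.
have ev (xi' eta' : bd) x' y' : gseqs xi' x' -> gseqs eta' y' -> ~ near_bd xi' eta' r ->
    exists N, forall i, (N <= i)%N -> gp o (x' i) (y' i) <= r + delta + delta.
  move=> xx' yy' nn; apply: contrapT => hn; apply: nn.
  apply: (near_bd_frequently hyp xx' yy') => N; apply: contrapT => hN.
  apply: hn; exists N => i Ni; rewrite leNgt; apply/negP => hi.
  by apply: hN; exists i, i; split.
have [N1 h1] := ev _ _ _ _ xx yy n1.
have [N2 h2] := ev _ _ _ _ (bd_actP g^-1%g xx) (bd_actP g^-1%g yy) n2.
pose A i := c + delta < gp o (x i) (act g o) /\
  c + delta < gp o (act g^-1%g (y i)) (act g^-1%g o).
pose B i := c + delta < gp o (y i) (act g o) /\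
  c + delta < gp o (act g^-1%g (x i)) (act g^-1%g o).
have AB i : (N1 <= i)%N -> (N2 <= i)%N -> A i \/ B i.
  move=> /h1 H1 /h2 H2; move: H1 H2; rewrite /A /B /c /gromov_product /=.
  rewrite !mdist_act !mdist_actV !(metric_sym _ (act g o)) !(metric_sym _ o).
  have := hyp o (x i) (act g o) (y i); have := delta_gt0.
  rewrite /gromov_product !(metric_sym _ (act g o)) !(metric_sym _ o).
  set dxy := mdist (x i) (y i); set dox := mdist o (x i); set doy := mdist o (y i).
  set l := mdist o (act g o); set dgx := mdist (act g o) (x i).
  set dgy := mdist (act g o) (y i).
  clearbody dxy dox doy l dgx dgy.
  rewrite minEle; case: ifP => _ *; [right|left]; split; lra.
have [Ai|] := pselect (forall N, exists2 i, (N <= i)%N & A i).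
  left; split.
    by apply: (near_pt_frequently hyp xx) => N; have [i Ni [a _]] := Ai N; exists i.
  apply: (near_pt_frequently hyp (bd_actP g^-1%g yy)) => N.
  by have [i Ni [_ a]] := Ai N; exists i.
move=> /existsNP[M hM].
have Bi N : exists2 i, (N <= i)%N & B i.
  pose i := maxn (maxn N M) (maxn N1 N2).
  have [Ni Mi N1i N2i] : [/\ N <= i, M <= i, N1 <= i & N2 <= i]%N.
    by rewrite /i !leq_max !leqnn !orbT.
  have [Ai|Bi] := AB i N1i N2i; last by exists i.
  by case: hM; exists i.
right; split.
  by apply: (near_pt_frequently hyp yy) => N; have [i Ni [a _]] := Bi N; exists i.
apply: (near_pt_frequently hyp (bd_actP g^-1%g xx)) => N.
by have [i Ni [_ a]] := Bi N; exists i.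
Qed.

End action.

(** * Virtually cyclic groups *)

(** Translating by powers of one element of large value brings any value into a
    bounded window, where properness leaves finitely many elements. *)
Lemma quasimorphism_elementary (R : realType) (G : groupType) (H : set G)
    (b : G -> R) (K : R) (T : set G) :
  H 1%g -> (forall h, H h -> H h^-1%g) -> (forall h k, H h -> H k -> H (h * k)%g) ->
  (forall h k, H h -> H k -> `|b (h * k)%g - b h - b k| <= K) ->
  (forall r : R, finite_set [set h | H h /\ `|b h| <= r]) ->
  finite_set T -> (forall g, exists h t, [/\ H h, T t & g = (h * t)%g]) ->
  elementary G.
Proof.
move=> H1 HV HM bK bfin Tfin HT.
have K0 : 0 <= K by apply: le_trans (bK _ _ H1 H1); exact: normr_ge0.
have b1 : `|b 1%g| <= K.
  have := bK _ _ H1 H1; rewrite mulg1 !ler_norml; lra.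
have bV h : H h -> `|b h^-1%g + b h| <= 2 * K.
  move=> Hh; have := bK _ _ (HV _ Hh) Hh; rewrite mulVg.
  move: b1; rewrite !ler_norml; lra.
suff [a [C aC]] : exists (a : G) (C : set G), finite_set C /\ forall h, H h ->
    exists n c, C c /\ (h = (a ^+ n * c)%g \/ h = (a ^- n * c)%g).
  have [Cfin aP] := aC; pose T' := (fun ct : G * G => (ct.1 * ct.2)%g) @` (C `*` T).
  have T'fin : finite_set T' by apply: finite_image; exact: finite_setX.
  exists a, (fset_set T') => g; have [h [t [Hh Tt ->]]] := HT g.
  have [n [c [Cc hc]]] := aP _ Hh; exists n, (c * t)%g; split.
    by rewrite in_fset_set // inE; exists (c, t).
  by case: hc => ->; [left|right]; rewrite mulgA.
(* If [b] is bounded then [H] is finite; otherwise some [a] in [H] has a value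
   larger than all the multiples of [K] that occur below as errors. *)
have [[a [Ha ab]]|ball] := pselect (exists a, H a /\ 10 * K + 1 < `|b a|); last first.
  exists 1%g, [set h | H h /\ `|b h| <= 10 * K + 1]; split => // h Hh.
  exists 0%N, h; split; last by left; rewrite expg0 mul1g.
  by split => //; rewrite leNgt; apply/negP => hb; apply: ball; exists h.
wlog {ab} ab : a Ha / 8 * K + 1 < b a.
  move=> wl; have [ba|ba] := ltrP (8 * K + 1) (b a); first exact: wl ba.
  apply: (wl a^-1%g (HV _ Ha)).
  by have := bV _ Ha; move: ab; rewrite ltr_normr ler_norml => /orP[|]; lra.
exists a, [set h | H h /\ `|b h| <= b a + 3 * K]; split => // h Hh.
have Hm h' : H h' -> `|b (a^-1 * h')%g - b h' + b a| <= 3 * K.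
  move=> Hh'; have := bK _ _ (HV _ Ha) Hh'; have := bV _ Ha.
  rewrite !ler_norml; lra.
have Hp h' : H h' -> `|b (a * h')%g - b h' - b a| <= K.
  by move=> Hh'; have := bK _ _ Ha Hh'; rewrite !ler_norml; lra.
(* Multiplying by [a^-1] lowers a value in [b a, oo) by at least [b a - 3 K > 1]
   without making it very negative, so the number of steps is bounded by [m]. *)
have down (m : nat) : forall h', H h' -> 0 <= b h' <= m%:R ->
    exists n, H (a ^- n * h')%g /\ `|b (a ^- n * h')%g| <= b a + 3 * K.
  elim: m => [|m IH] h' Hh' /andP[h0 hm].
    exists 0%N; rewrite expg0 invg1 mul1g; split => //.
    by rewrite ler_norml; lra.
  have [ha|ha] := lerP (b h') (b a).
    exists 0%N; rewrite expg0 invg1 mul1g; split => //.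
    by rewrite ler_norml; lra.
  have Hah : H (a^-1 * h')%g by apply: HM => //; exact: HV.
  have := Hm _ Hh'; rewrite ler_norml => hb.
  have [h1|h1] := lerP 0 (b (a^-1 * h')%g).
    have [|n [Hn bn]] := IH _ Hah.
      by rewrite h1 /=; move: hm; rewrite -natr1; lra.
    by exists n.+1; rewrite expgS invgM -mulgA.
  by exists 1%N; rewrite expg1; split => //; rewrite ler_norml; lra.
have up (m : nat) : forall h', H h' -> - m%:R <= b h' <= 0 ->
    exists n, H (a ^+ n * h')%g /\ `|b (a ^+ n * h')%g| <= b a + 3 * K.
  elim: m => [|m IH] h' Hh' /andP[hm h0].
    exists 0%N; rewrite expg0 mul1g; split => //.
    by rewrite ler_norml; lra.
  have [ha|ha] := lerP (- b a) (b h').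
    exists 0%N; rewrite expg0 mul1g; split => //.
    by rewrite ler_norml; lra.
  have Hah : H (a * h')%g by apply: HM.
  have := Hp _ Hh'; rewrite ler_norml => hb.
  have [h1|h1] := lerP (b (a * h')%g) 0.
    have [|n [Hn bn]] := IH _ Hah.
      by rewrite h1 andbT; move: hm; rewrite -natr1; lra.
    by exists n.+1; rewrite expgSr -mulgA.
  by exists 1%N; rewrite expg1; split => //; rewrite ler_norml; lra.
have [m hm] : exists m : nat, `|b h| <= m%:R.
  by exists (Num.bound `|b h|); apply: ltW; exact: archi_boundP.
move: hm; rewrite ler_norml => hm.
have [b0|b0] := lerP 0 (b h).
  have [|n hn] := down m _ Hh; first by move: hm => /andP[_ ->]; rewrite b0.
  by exists n, (a ^- n * h)%g; split => //; left; rewrite mulgA mulgV mul1g.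
have [|n hn] := up m _ Hh; first by move: hm => /andP[-> _]; rewrite ltW.
by exists n, (a ^+ n * h)%g; split => //; right; rewrite mulgA mulVg mul1g.
Qed.

Lemma finite_elementary (G : groupType) : finite_set [set: G] -> elementary G.
Proof.
move=> fG; exists 1%g, (fset_set setT) => g; exists 0%N, g.
by rewrite in_fset_set // inE expg0 mul1g; split=> //; left.
Qed.

(** * Boundary points of finite orbit, and separation by shadows *)

Section orbit.
Context {R : realType} {G : groupType} {X : metricType R}.
Context (act : G -> X -> X) (o : X).
Local Notation gp := (gromov_product (@mdist R X)).
Local Notation bd := (gboundary o).
Local Notation bact := (@bd_act R X o G act).
Local Notation len g := (mdist o (act g o)).

Lemma proper_finite_len (r : R) : proper_space X -> properly_discontinuous act ->
  finite_set [set g | len g <= r].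
Proof.
move=> pX pd; have [r0|r0] := lerP 0 r.
  apply: sub_finite_set (pd _ (pX o r)) => g /= gr.
  by exists (act g o); split => //; exists o => //=; rewrite mdistxx.
rewrite (_ : [set _ | _] = set0) //; apply/seteqP; split => // g /= gr.
by have := le_lt_trans gr r0; rewrite ltNge mdist_ge0.
Qed.

Lemma cocompact_bounded : isometric_action act -> cocompact act ->
  exists D : R, forall p, exists g, mdist p (act g o) <= D.
Proof.
move=> [_ _ iso] [K /compact_near_coveringP cK KX].
have [N _ hN] : \forall n \near \oo, K `<=` [set x | mdist o x <= n%:R].
  apply: (cK nat \oo (fun n x => mdist o x <= n%:R)) => x Kx.
  exists (ball x 1, [set n | (Num.bound (mdist o x + 1) <= n)%N]) => /=.
    by split; [exact: nbhsx_ballx|exists (Num.bound (mdist o x + 1))].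
  move=> [y n] /= [+ nx]; rewrite ballEmdist /= => xy.
  have : mdist o x + 1 <= n%:R.
    apply: le_trans (_ : (Num.bound (mdist o x + 1))%:R <= _); last by rewrite ler_nat.
    by apply: ltW; apply: le_lt_trans (archi_boundP _) => //; rewrite addr_ge0 ?mdist_ge0.
  by have := metric_triangle o x y; lra.
exists N%:R => p; have : [set: X] p by []. rewrite -KX => -[g _ [x Kx <-]].
exists g; rewrite iso metric_sym.
by have := hN N (leqnn N) x Kx.
Qed.

Variables (delta : R) (delta_gt0 : 0 < delta).
Hypothesis hyp : forall o x y z : X,
  Num.min (gp o x y) (gp o y z) - delta <= gp o x z.
Hypothesis isom : isometric_action act.
Hypothesis fin_len : forall r : R, finite_set [set g | len g <= r].
Implicit Types (xi eta zeta : bd) (p q : X) (x y z : nat -> X) (r s t : R).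

(** Hyperbolicity makes the differences of distances to [p] and [q] converge up
    to a multiple of [delta] along sequences tending to [xi]. *)
Lemma horofunction_cvg xi p q : exists v : R, forall x, gseqs xi x ->
  exists N, forall i, (N <= i)%N -> `|mdist p (x i) - mdist q (x i) - v| <= 4 * delta.
Proof.
have [[y yy]|noseq] := pselect (exists y, gseqs xi y); last first.
  by exists 0 => x xx; case: noseq; exists x.
have key (u w : X) : mdist p q + mdist o p < gp o u w ->
    mdist p w - mdist q w <= mdist p u - mdist q u + 2 * delta.
  move=> h; have := hyp p u w q.
  have /= := gromov_product_base o p u w; have := gromov_product_le_dist p w q.
  have : gp p w q = (mdist p w + mdist p q - mdist q w) / 2.
    by rewrite /gromov_product !(metric_sym _ p) (metric_sym w q).
  have : gp p u q = (mdist p u + mdist p q - mdist q u) / 2.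
    by rewrite /gromov_product !(metric_sym _ p) (metric_sym u q).
  by rewrite minEle; case: ifP => [/idP|_]; lra.
have kkey (u w : X) : mdist p q + mdist o p < gp o u w ->
    `|mdist p u - mdist q u - (mdist p w - mdist q w)| <= 2 * delta.
  move=> h; have := key u w h; have := key w u; rewrite gromov_productC => /(_ h).
  by rewrite ler_norml; lra.
have /gromov_equivP/(_ (mdist p q + mdist o p))[M hM] := gseqs_equiv hyp yy yy.
exists (mdist p (y M) - mdist q (y M)) => x xx.
have /gromov_equivP/(_ (mdist p q + mdist o p))[N hN] := gseqs_equiv hyp xx yy.
exists N => i Ni.
have := kkey _ _ (hM M (maxn M N) (leqnn _) (leq_maxl _ _)).
have := kkey _ _ (hN i (maxn M N) Ni (leq_maxr _ _)).
by rewrite !ler_norml; lra.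
Qed.

(** The horofunction at one of the points, restricted to the common stabilizer, is
    a quasimorphism; it is proper because the stabilizer moves [o] along the line
    joining the two points. *)
Lemma finite_orbits_elementary xi eta : xi <> eta ->
  finite_set (range (bact^~ xi)) -> finite_set (range (bact^~ eta)) -> elementary G.
Proof.
move=> ne fxi feta; have [r nr] := near_bd_neq hyp ne.
have [x [y [xx yy]]] : exists x y, gseqs xi x /\ gseqs eta y.
  apply: contrapT => hn; apply: nr => x y xx yy.
  by exfalso; apply: hn; exists x, y.
pose H := [set g | bact g xi = xi /\ bact g eta = eta].
have H1 : H 1%g by split; apply: (bd_act1 hyp isom).
have HV h : H h -> H h^-1%g.
  by move=> [h1 h2]; split; [rewrite -{1}h1|rewrite -{1}h2]; apply: (bd_actK hyp isom).
have HM h k : H h -> H k -> H (h * k)%g.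
  by move=> [h1 h2] [k1 k2]; split; rewrite (bd_actM hyp isom) ?k1 ?k2.
have /choice[b hb] := fun h => horofunction_cvg xi (act h o) o.
have bK h k : H h -> H k -> `|b (h * k)%g - b h - b k| <= 12 * delta.
  move=> Hh Hk; have [N1 h1] := hb (h * k)%g _ xx; have [N2 h2] := hb h _ xx.
  have xh : gseqs xi (act h^-1%g \o x).
    by have [E _] := HV _ Hh; rewrite -E; apply: (bd_actP hyp isom).
  have [N3 h3] := hb k _ xh.
  pose i := maxn N1 (maxn N2 N3).
  have [i1 i2 i3] : [/\ N1 <= i, N2 <= i & N3 <= i]%N.
    by rewrite /i !leq_max !leqnn !orbT.
  have := h1 i i1; have := h2 i i2; have /= := h3 i i3.
  rewrite ![mdist _ (act h^-1%g _)]metric_sym !(mdist_actV isom) (actM isom).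
  by rewrite ![mdist (x i) _]metric_sym !ler_norml; lra.
(* [near_line_shadow] locates [h o] near the line from [xi] to [eta]; the
   horofunction at [xi] then recovers the displacement of [o]. *)
pose c := r + 5 * delta.
have low h (t : R) : near_pt xi (act h o) (len h - t) -> len h <= `|b h| + 2 * t + 4 * delta.
  move=> hh; have [N1 h1] := hb h _ xx; have [N2 h2] := hh _ xx.
  have := h1 _ (leq_maxl N1 N2); have := h2 _ (leq_maxr N1 N2).
  rewrite /gromov_product (metric_sym (x _) o) (metric_sym (x _) (act h o)).
  rewrite (metric_sym (act h o) o) ler_norml.
  have := ler_norm (b h); have := ler_norm (- b h); rewrite normrN; lra.
have proper h : H h -> len h <= `|b h| + 2 * c + 100 * delta.
  move=> Hh; have [E1 E2] := HV _ Hh.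
  have nr' : ~ near_bd (bact h^-1%g xi) (bact h^-1%g eta) r by rewrite E1 E2.
  have d0 := delta_gt0.
  have /= := near_line_shadow delta_gt0 hyp isom nr nr'.
  rewrite E1 E2 -/c => -[[h1 _]|[_ h2]]; first by have := low _ _ h1; lra.
  have := low h^-1%g c; rewrite (lenV _ isom) => /(_ h2).
  have := bK _ _ Hh (HV _ Hh); rewrite mulgV.
  have := bK _ _ H1 H1; rewrite mulg1.
  have [->|->] : `|b h^-1%g| = b h^-1%g \/ `|b h^-1%g| = - b h^-1%g.
    by case: (lerP 0 (b h^-1%g)) => b0; [left; rewrite ger0_norm|right; rewrite ltr0_norm].
    have := ler_norm (b h); have := ler_norm (- b h); rewrite normrN.
    by rewrite !ler_norml; lra.
  have := ler_norm (b h); have := ler_norm (- b h); rewrite normrN.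
  by rewrite !ler_norml; lra.
(* The cosets of [H] are the finitely many values of [F]; [rep] picks one
   representative of each. *)
pose F g := (bact g^-1%g xi, bact g^-1%g eta).
have Ffin : finite_set (range F).
  apply: sub_finite_set (finite_setX fxi feta) => _ [g _ <-] /=.
  by split; exists g^-1%g.
have /choice[rep hrep] : forall w, exists g, forall g', F g' = w -> F g = w.
  move=> w; have [[g gw]|ng] := pselect (exists g, F g = w); first by exists g.
  by exists 1%g => g' g'w; case: ng; exists g'.
apply: (@quasimorphism_elementary R G H b (12 * delta) (rep @` range F)) => //.
- move=> s; apply: sub_finite_set (fin_len (s + 2 * c + 100 * delta)) => h /= [Hh hs].
  by have := proper _ Hh; lra.
- exact: finite_image.
- move=> g; have /= [e1 e2] := hrep (F g) g erefl; set t := rep (F g) in e1 e2 *.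
  exists (g * t^-1)%g, t; split; last by rewrite -mulgA mulVg mulg1.
    by split; rewrite (bd_actM hyp isom) ?e1 ?e2; apply: (bd_actKV hyp isom).
  by exists (F g) => //; exists g.
Qed.

Lemma near_pt_ex xi (D t : R) : (forall p, exists g, mdist p (act g o) <= D) ->
  exists g, near_pt xi (act g o) t.
Proof.
move=> hD; have [[x xx]|noseq] := pselect (exists x, gseqs xi x); last first.
  by exists 1%g => x xx; case: noseq; exists x.
have /gromov_seqP/(_ (t + delta + D))[N hN] := gseqs_gromov xx.
have [g hg] := hD (x N); exists g; apply: (near_pt_frequently hyp xx) => M.
exists (maxn M N); rewrite ?leq_maxl //.
apply: lt_le_trans (gromov_product_lip _ _ (x N) _).
by have := hN (maxn M N) N (leq_maxr _ _) (leqnn _); lra.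
Qed.

(** Shadows of orbit points at natural levels form a countable family, since
    balls in [G] are finite, and contain arbitrarily small neighbourhoods of all
    boundary points, since the orbit is cobounded. So the rectangles of shadows
    on which the Gromov product is bounded cover the complement of the diagonal:
    the source of all measurability and finiteness statements on pairs. *)
Lemma separating_rectangles (D : R) : (forall p, exists g, mdist p (act g o) <= D) ->
  exists (A B : nat -> set bd) (r : nat -> R),
  [/\ forall k, measurable (A k), forall k, measurable (B k),
      forall k xi eta, A k xi -> B k eta -> ~ near_bd xi eta (r k) &
      forall xi eta, xi <> eta -> exists k, A k xi /\ B k eta].
Proof.
move=> hD.
have cG : countable [set: G].
  have -> : [set: G] = \bigcup_(n : nat) [set g | len g <= n%:R].
    apply/seteqP; split => // g _; exists (Num.bound (len g)) => //=.
    by apply: ltW; apply: archi_boundP; exact: mdist_ge0.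
  by apply: bigcup_countable => // n _; apply: finite_set_countable.
have [e he] : exists e : nat -> G * G * nat, forall w, exists n, e n = w.
  apply: (countable_surj ((1%g, 1%g), 0%N)).
  rewrite (_ : setT = ([set: G] `*` [set: G]) `*` [set: nat]); last by apply/seteqP; split.
  by apply: countableX => //; exact: countableX.
pose U k := shadow (act (e k).1.1 o) (e k).2%:R : set bd.
pose V k := shadow (act (e k).1.2 o) (e k).2%:R : set bd.
pose good k := exists r, forall xi eta, U k xi -> V k eta -> ~ near_bd xi eta r.
have /choice[r hr] : forall k, exists r, good k -> forall xi eta, U k xi -> V k eta ->
    ~ near_bd xi eta r.
  by move=> k; have [[r hr]|ng] := pselect (good k); [exists r|exists 0].
exists (fun k => [set xi | good k /\ U k xi]), V, r; split.
- move=> k; have [gk|ngk] := pselect (good k).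
    rewrite (_ : [set _ | _] = U k); first exact: (measurable_shadow hyp).
    by apply/seteqP; split => x //= [].
  by rewrite (_ : [set _ | _] = set0) //; apply/seteqP; split => x //= [].
- by move=> k; exact: (measurable_shadow hyp).
- by move=> k xi eta [gk Uxi] Veta; apply: hr.
move=> xi eta /(near_bd_neq hyp)[s ns].
pose n := Num.bound `|s + 3 * delta|.
have sn : s + 3 * delta <= n%:R.
  by apply: le_trans (ler_norm _) _; apply: ltW; apply: archi_boundP.
have [g hg] := near_pt_ex xi (n%:R + delta) hD.
have [h hh] := near_pt_ex eta (n%:R + delta) hD.
have [k hk] := he (g, h, n).
exists k; rewrite /V /= hk /=; split; last exact: near_shadow.
split; last by rewrite /U hk; exact: near_shadow.
exists (s + 2 * delta) => xi' eta'; rewrite /U /V hk /= => /(shadow_near hyp) h1 /(shadow_near hyp) h2 h3.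
have d0 := delta_gt0; apply: ns.
have a1 : near_bd xi xi' (s + 2 * delta).
  by apply: (near_bd_pt hyp (p := act g o)); [apply: near_ptW hg|apply: near_ptW h1]; lra.
have a2 : near_bd eta' eta (s + delta).
  by apply: (near_bd_pt hyp (p := act h o)); [apply: near_ptW h2|apply: near_ptW hh]; lra.
apply: (near_bd_trans hyp _ a2); apply: (near_bd_trans hyp (eta := xi')).
  by apply: near_bdW a1; lra.
by apply: near_bdW h3; lra.
Qed.

End orbit.

(** * Quasi-invariant measures on the boundary *)

Lemma lim_sup_set_ge d (T : measurableType d) (R : realType)
    (mu : {finite_measure set T -> \bar R}) (F : (set T)^nat) (e : \bar R) :
  (forall n, measurable (F n)) -> (forall n, (e <= mu (F n))%E) ->
  (e <= mu (lim_sup_set F))%E.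
Proof.
move=> mF eF; have mU n : measurable (\bigcup_(k >= n) F k).
  by apply: bigcup_measurable => k _.
have cv : mu (\bigcup_(k >= n) F k) @[n --> \oo] --> mu (lim_sup_set F).
  by apply: lim_sup_set_cvg => //; rewrite -ge0_fin_numE // fin_num_measure.
rewrite -(cvg_lim _ cv) //; apply: lime_ge; first by apply/cvg_ex; eexists; exact: cv.
apply: nearW => n; apply: le_trans (eF n) _; apply: le_measure; rewrite ?inE //.
by move=> x Fx; exists n => /=.
Qed.

Section quasi_invariant.
Context {R : realType} {G : groupType} {X : metricType R}.
Context (act : G -> X -> X) (o : X).
Local Notation gp := (gromov_product (@mdist R X)).
Local Notation bd := (gboundary o).
Local Notation bact := (@bd_act R X o G act).
Local Notation len g := (mdist o (act g o)).
Variables (delta : R) (delta_gt0 : 0 < delta).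
Hypothesis hyp : forall o x y z : X,
  Num.min (gp o x y) (gp o y z) - delta <= gp o x z.
Hypothesis isom : isometric_action act.
Hypothesis fin_len : forall r : R, finite_set [set g | len g <= r].
Hypothesis meas1 : forall xi : bd, measurable [set xi].
Variable nu : {finite_measure set bd -> \bar R}.
Implicit Types (xi eta : bd) (e r t : R).

(** A measure cannot stay bounded below on sets shrinking to the boundary
    without charging a point: two points of the upper limit of the sets are
    close to the same orbit points, hence equal. *)
Lemma shrinking_atom (g : nat -> G) (D : nat -> set bd) k e :
  (forall n, n%:R < len (g n)) -> (forall n, measurable (D n)) ->
  (forall n xi, D n xi -> near_pt xi (act (g n) o) (len (g n) - k)) ->
  0 < e -> (forall n, (e%:E <= nu (D n))%E) ->
  exists xi, (e%:E <= nu [set xi])%E /\ forall N, exists2 n, (N <= n)%N & D n xi.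
Proof.
move=> gn mD Dn e0 eD.
have [xi xiL] : lim_sup_set D !=set0.
  apply/set0P/eqP => L0; have := lim_sup_set_ge mD eD.
  by rewrite L0 measure0 lee_fin leNgt e0.
have /choice[f hf] : forall N, exists n, (N <= n)%N /\ D n xi.
  by move=> N; have [n /= Nn Dxi] := xiL N I; exists n.
exists xi; split; last by move=> N; exists (f N); have [] := hf N.
apply: le_trans (@lim_sup_set_ge _ _ _ nu (D \o f) e%:E _ _) _ => //=.
apply: le_measure; rewrite ?inE //.
  by apply: bigcap_measurable => // n _; apply: bigcup_measurable => j _; exact: mD.
move=> zeta zL; apply: (near_bd_eq hyp) => r.
pose N := Num.bound `|r + delta + k|.
have [n /= Nn Dz] := zL N I; have [fn Dxi] := hf n.
have rn : r + delta <= len (g (f n)) - k.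
  have : r + delta + k <= N%:R.
    by apply: le_trans (ler_norm _) _; apply: ltW; exact: archi_boundP.
  have : (N%:R : R) <= (f n)%:R by rewrite ler_nat (leq_trans Nn).
  by have := gn (f n); lra.
by apply: (near_bd_pt hyp (p := act (g (f n)) o)); apply: near_ptW rn _; exact: Dn.
Qed.

Variables (C : R) (C_ge1 : 1 <= C).
Hypothesis nu_inv : forall g (A : set bd), measurable A ->
  (nu (bact g @^-1` A) <= C%:E * nu A)%E.

(** Quasi-invariance bounds the mass of all translates of an atom below. *)
Lemma act_atom g xi e : 0 < e -> (e%:E <= nu [set xi])%E ->
  ((e / C)%:E <= nu [set bact g xi])%E.
Proof.
move=> e0 exi; have C0 : 0 < C by apply: lt_le_trans C_ge1.
have -> : [set bact g xi] = bact g^-1%g @^-1` [set xi].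
  apply/seteqP; split => [_ ->|eta /= <-] /=; first by rewrite (bd_actK hyp isom).
  by rewrite (bd_actKV hyp isom).
rewrite mulrC EFinM lee_pdivrMl //; apply: le_trans exi _.
have mA : measurable (bact g^-1%g @^-1` [set xi]).
  rewrite -[X in measurable X]setTI.
  exact: (measurable_bd_act hyp isom).
have := nu_inv g mA; rewrite (_ : bact g @^-1` _ = [set xi]) //.
by apply/seteqP; split => eta /=; rewrite (bd_actK hyp isom).
Qed.

(** An infinite orbit would carry infinitely many atoms of mass [e / C], whereas
    no point lies in infinitely many terms of an injective sequence of
    singletons. *)
Lemma atom_finite_orbit xi e : 0 < e -> (e%:E <= nu [set xi])%E ->
  finite_set (range (bact^~ xi)).
Proof.
move=> e0 exi; have C0 : 0 < C by apply: lt_le_trans C_ge1.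
apply: contrapT => /infiniteP /pcard_leP/injfunPex[f fr finj].
have [zeta zL] : lim_sup_set (fun n => [set f n]) !=set0.
  apply/set0P/eqP => L0.
  have := @lim_sup_set_ge _ _ _ nu (fun n => [set f n]) (e / C)%:E.
  rewrite L0 measure0 lee_fin leNgt divr_gt0 //= => h; suff : false by [].
  by apply: h => // n; have [g _ <-] := fr n I; exact: act_atom.
have [n _ zn] := zL 0%N I; have [m /= nm zm] := zL n.+1 I.
have /finj : f n = f m by rewrite -[LHS]zn -[RHS]zm.
by rewrite !inE => /(_ I I) E; rewrite E ltnn in nm.
Qed.

(** Fubini and the Markov inequality: sections of mass below [e / (2 t)]
    contribute at most [e / 2] to the product measure, and the mass of every
    section is at most [t]. *)
Lemma section_ge (E : set (bd * bd)) (t : R) (e : R) : measurable E -> 0 < t ->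
  (nu setT <= t%:E)%E -> 0 < e -> (e%:E <= (nu \x nu)%E E)%E ->
  ((e / (2 * t))%:E <= nu [set xi | (e / (2 * t))%:E <= nu (xsection E xi)]%E)%E.
Proof.
move=> mE t0 nut e0 eE; set a := e / (2 * t); set D := [set xi | _].
have mx := measurable_fun_xsection nu mE.
have mD : measurable D.
  by rewrite -[D]setTI; exact: emeasurable_fun_c_infty.
have a0 : 0 < a by rewrite divr_gt0 // mulr_gt0.
have nf (A : set bd) : measurable A -> nu A \is a fin_num by exact: fin_num_measure.
have le1 : (e%:E <= t%:E * nu D + a%:E * nu setT)%E.
  apply: le_trans eE _; rewrite /= /product_measure1.
  apply: (@le_trans _ _ (\int[nu]_x (t%:E * (\1_D x)%:E + a%:E))%E).
    apply: ge0_le_integral => //=.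
    - apply: emeasurable_funD => //.
      apply: measurable_funeM; apply/measurable_EFinP; exact: measurable_indic.
    - move=> x _; rewrite /indic; have [xD|xD] /= := boolP (x \in D).
        rewrite mule1; apply: le_trans (_ : t%:E <= _)%E; last by rewrite leeDl ?lee_fin // ltW.
        by apply: le_trans nut; apply: le_measure; rewrite ?inE //; exact: measurable_xsection.
      rewrite mule0 add0e leNgt; apply/negP => h; move/negP : xD; apply.
      by rewrite inE; exact: ltW.
  rewrite ge0_integralD //=; last 3 first.
  - by move=> x _; rewrite mule_ge0 // lee_fin // ltW.
  - by apply: measurable_funeM; apply/measurable_EFinP; exact: measurable_indic.
  - by move=> x _; rewrite lee_fin ltW.
  rewrite ge0_integralZl //=; last 2 first.
  - by apply/measurable_EFinP; exact: measurable_indic.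
  - by rewrite lee_fin ltW.
  by rewrite integral_indic // setIT integral_cst.
have [u uD] : exists u : R, nu D = u%:E by exists (fine (nu D)); rewrite fineK // nf.
have [w wT] : exists w : R, nu setT = w%:E by exists (fine (nu setT)); rewrite fineK // nf.
move: le1 nut; rewrite uD wT !lee_fin => h1 h2.
have aw : a * w <= e / 2.
  apply: le_trans (_ : a * t <= _); first by rewrite ler_pM2l.
  by rewrite /a invfM mulrA -mulrA mulVf ?mulr1 // gt_eqF.
by rewrite /a invfM mulrA ler_pdivrMr // mulrC; lra.
Qed.

(** In [E g] the first coordinate is in the shadow of [g o] and the second,
    pulled back by [g], in the shadow of [g^-1 o]. If [E g] has definite product
    measure for infinitely many [g], the sets of first coordinates with a
    heavy section shrink to an atom [xi0]; the sections over [xi0], pulled back,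
    shrink to an atom [eta0] distinct from [g^-1 xi0] for some [g], because [K]
    is off the diagonal. Atoms of a finite quasi-invariant measure have finite
    orbits, and two such points make the group elementary. *)
Lemma recurrent_pairs_elementary (K : set (bd * bd)) (E : G -> set (bd * bd))
    (I : set G) k e :
  K `<=` bd_pairs o -> (forall g, measurable (E g)) ->
  (forall g z, E g z -> [/\ K (bact g^-1%g z.1, bact g^-1%g z.2),
     near_pt z.1 (act g o) (len g - k) &
     near_pt (bact g^-1%g z.2) (act g^-1%g o) (len g - k)]) ->
  infinite_set I -> 0 < e -> (forall g, I g -> (e%:E <= (nu \x nu)%E (E g))%E) ->
  elementary G.
Proof.
move=> KS mE EP infI e0 eE; have C0 : 0 < C by apply: lt_le_trans C_ge1.
have [t [t0 nut]] : exists t : R, 0 < t /\ (nu setT <= t%:E)%E.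
  have nf : nu setT \is a fin_num by exact: fin_num_measure.
  exists (fine (nu setT) + 1); split; first by rewrite ltr_wpDl // fine_ge0.
  by rewrite EFinD fineK // leeDl.
have /choice[g gP] : forall n : nat, exists g, I g /\ n%:R < len g.
  move=> n; apply: contrapT => h; apply: infI; apply: sub_finite_set (fin_len n%:R) => g Ig /=.
  by rewrite leNgt; apply/negP => ng; apply: h; exists g.
set a := e / (2 * t); have a0 : 0 < a by rewrite divr_gt0 // mulr_gt0.
pose D n := [set xi | (a%:E <= nu (xsection (E (g n)) xi))%E].
have mD n : measurable (D n).
  rewrite -[D n]setTI; apply: emeasurable_fun_c_infty => //.
  exact: measurable_fun_xsection.
have aD n : (a%:E <= nu (D n))%E.
  by apply: section_ge => //; apply: eE; have [] := gP n.
have ne n xi : D n xi -> exists eta, E (g n) (xi, eta).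
  move=> Dn; have /set0P[eta] : xsection (E (g n)) xi != set0.
    by apply: contraTneq Dn => h; rewrite /D /= h measure0 lee_fin leNgt a0.
  by rewrite /xsection /= inE => ?; exists eta.
have [||xi0 [axi xiD]] := @shrinking_atom g D k a _ mD _ a0 aD.
- by move=> n; have [] := gP n.
- by move=> n xi /ne[eta /EP[]].
have /choice[f fP] : forall N, exists n, (N <= n)%N /\ D n xi0.
  by move=> N; have [n] := xiD N; exists n.
pose h n := (g (f n))^-1%g.
pose D' n := bact (g (f n)) @^-1` (xsection (E (g (f n))) xi0).
have mD' n : measurable (D' n).
  rewrite -[D' n]setTI; apply: (measurable_bd_act hyp isom) => //.
  exact: measurable_xsection.
have aC : 0 < a / C by rewrite divr_gt0.
have aD' n : ((a / C)%:E <= nu (D' n))%E.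
  rewrite mulrC EFinM lee_pdivrMl //.
  have := nu_inv (g (f n))^-1%g (mD' n); apply: le_trans.
  have [_ /=] := fP n; rewrite /D /=; congr (_ <= nu _)%E.
  by apply/seteqP; split => eta; rewrite /D' /= (bd_actKV hyp isom).
have D'P n eta : D' n eta -> E (g (f n)) (xi0, bact (g (f n)) eta).
  by rewrite /D' /= /xsection /= inE.
have [||eta0 [aeta etaD]] := @shrinking_atom h D' k (a / C) _ mD' _ aC aD'.
- move=> n; rewrite /h (lenV _ isom); have [_] := gP (f n); apply: le_lt_trans.
  by rewrite ler_nat; have [] := fP n.
- move=> n eta /D'P/EP[_ _] /=; rewrite (bd_actK hyp isom) /h (lenV _ isom).
  exact.
have [n _ /D'P/EP[/= + _ _]] := etaD 0%N.
rewrite (bd_actK hyp isom) => /KS; rewrite /bd_pairs /= => neq.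
apply: (finite_orbits_elementary delta_gt0 hyp isom fin_len neq).
  by apply: (@atom_finite_orbit _ (a / C)) => //; exact: act_atom.
exact: atom_finite_orbit aC aeta.
Qed.

End quasi_invariant.

(** * Mixing of the boundary action *)

Lemma product_measure_swap d (T : measurableType d) (R : realType)
    (nu : {finite_measure set T -> \bar R}) (A : set (T * T)) : measurable A ->
  (nu \x nu)%E [set z | A (z.2, z.1)] = (nu \x nu)%E A.
Proof.
move=> mA; transitivity ((nu \x^ nu)%E A); first by [].
by symmetry; apply: product_measure_unique => //= B1 B2 mB1 mB2; rewrite product_measure2E.
Qed.

(** For negative [s] the Poincare series has infinitely many terms at least [1]. *)
Lemma critical_exponent_ge0 (R : realType) (G : groupType) (X : metricType R)
    (act : G -> X -> X) (o : X) : infinite_set [set: G] -> 0 <= critical_exponent act o.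
Proof.
move=> infG; rewrite /critical_exponent; set A := [set s | _].
have [->|/set0P An] := eqVneq A set0; first by rewrite inf0.
apply: lb_le_inf => // s As; rewrite leNgt; apply/negP => s0.
suff E : (\esum_(g in [set: G]) (expR (- s * mdist o (act g o)))%:E = +oo)%E.
  by move: As; rewrite /A /= E.
apply: eq_infty => r; apply: esum_ge.
have [Y _ Yr] := infinite_set_fset (Num.bound `|r|) infG.
exists [set` Y] => /=; first by split; [exact: finite_fset|].
rewrite fsbig_finite /=; last exact: finite_fset.
rewrite set_fsetK.
apply: (@le_trans _ _ (\sum_(g <- Y) 1%:E)%E).
  rewrite sumEFin big_const_seq count_predT iter_addr_0 lee_fin.
  apply: le_trans (ler_norm r) _; apply: le_trans (ltW (archi_boundP (normr_ge0 r))) _.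
  by rewrite ler_nat.
apply: lee_sum => g _; rewrite lee_fin -expR0 ler_expR mulr_ge0 ?mdist_ge0 //.
by rewrite oppr_ge0 ltW.
Qed.

Lemma dominated_le d (T : measurableType d) (R : realType)
    (nu1 nu2 : {finite_measure set T -> \bar R}) (f : T -> R) (c : R) (A : set T) :
  0 <= c -> nu1 `<< nu2 ->
  {ae nu2, forall x, (0 <= Radon_Nikodym (charge_of_finite_measure nu1) nu2 x)%E /\
     (Radon_Nikodym (charge_of_finite_measure nu1) nu2 x <= (f x)%:E)%E} ->
  measurable A -> (forall x, A x -> f x <= c) -> (nu1 A <= c%:E * nu2 A)%E.
Proof.
move=> c0 dom [N [mN N0 HN]] mA fc.
have mAN : measurable (A `\` N) by exact: measurableD.
have -> : nu1 A = nu1 (A `\` N).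
  have nN : nu1 N = 0%E by apply: (dom N) => //; apply/measure0_null_setP.
  apply/eqP; rewrite eq_le; apply/andP; split; last first.
    by apply: le_measure; rewrite ?inE //; exact: subDsetl.
  apply: (@le_trans _ _ (nu1 (A `\` N) + nu1 N)%E); last by rewrite nN adde0.
  apply: le_trans (measureU2 _ _ _) => //.
  apply: le_measure; rewrite ?inE //; first exact: measurableU.
  by move=> x Ax; have [xN|xN] := pselect (N x); [right|left].
have -> : nu1 (A `\` N) =
    (\int[nu2]_(x in A `\` N) Radon_Nikodym (charge_of_finite_measure nu1) nu2 x)%E.
  exact: (@Radon_Nikodym_integral _ _ _ (charge_of_finite_measure nu1)).
have HN' x : (A `\` N) x -> (0 <= Radon_Nikodym (charge_of_finite_measure nu1) nu2 x)%E /\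
     (Radon_Nikodym (charge_of_finite_measure nu1) nu2 x <= (f x)%:E)%E.
  by move=> [_ xN]; apply: contrapT => h; apply: xN; exact: HN.
apply: (@le_trans _ _ (\int[nu2]_(x in A `\` N) c%:E)%E).
  apply: ge0_le_integral => //=.
  - by move=> x /HN'[].
  - apply: measurable_funTS; apply: measurable_int.
    exact: (@Radon_Nikodym_integrable _ _ _ (charge_of_finite_measure nu1)).
  - by move=> x ANx; apply: le_trans (HN' x ANx).2 _; rewrite lee_fin fc //; case: ANx.
rewrite integral_cst //; apply: lee_wpmul2l; first by rewrite lee_fin.
by apply: le_measure; rewrite ?inE //; exact: subDsetl.
Qed.

Section mixing.
Context {R : realType} {G : groupType} {X : metricType R}.
Context (act : G -> X -> X) (o : X).
Local Notation gp := (gromov_product (@mdist R X)).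
Local Notation bd := (gboundary o).
Local Notation bact := (@bd_act R X o G act).
Local Notation len g := (mdist o (act g o)).
Local Notation v := (critical_exponent act o).
Variables (delta : R) (delta_gt0 : 0 < delta).
Hypothesis hyp : forall o x y z : X,
  Num.min (gp o x y) (gp o y z) - delta <= gp o x z.
Hypothesis isom : isometric_action act.
Hypothesis fin_len : forall r : R, finite_set [set g | len g <= r].
Variable D : R.
Hypothesis cobounded : forall p, exists g, mdist p (act g o) <= D.
Hypothesis nonelementary : ~ elementary G.
Variable mu : X -> {finite_measure set bd -> \bar R}.
Hypothesis ps : patterson_sullivan act mu.
Implicit Types (xi eta : bd) (z : bd * bd) (e r t : R).

Let infG : infinite_set [set: G].
Proof. by move=> /finite_elementary. Qed.

Let v_ge0 : 0 <= v. Proof. exact: critical_exponent_ge0. Qed.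

(** A point is the complement of a countable union of separating shadows. *)
Lemma measurable_point xi : measurable [set xi].
Proof.
have [A [B [r [mA mB AB sep]]]] := separating_rectangles delta_gt0 hyp fin_len cobounded.
rewrite -[[set xi]]setCK; apply: measurableC.
rewrite (_ : ~` [set xi] = \bigcup_(k in [set k | A k xi]) B k).
  by apply: bigcup_measurable.
apply/seteqP; split=> eta /=; first by move=> /nesym /sep[k []]; exists k.
move=> [k /= Ak Bk] E; apply: (AB _ _ _ Ak Bk); rewrite E; exact: near_bdxx.
Qed.

Lemma conformal_le x y (A : set bd) C c : 0 <= c -> measurable A ->
  {ae mu y, forall xi : bd,
      ((C^-1 * expR (- v * busemann xi y x))%:E
        <= Radon_Nikodym (charge_of_finite_measure (mu x)) (mu y) xi)%E /\
      (Radon_Nikodym (charge_of_finite_measure (mu x)) (mu y) xi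
        <= (C * expR (- v * busemann xi y x))%:E)%E} -> 1 <= C ->
  mu x `<< mu y ->
  (forall xi, A xi -> C * expR (- v * busemann xi y x) <= c) ->
  (mu x A <= c%:E * mu y A)%E.
Proof.
move=> c0 mA ae C1 dom h; apply: (dominated_le c0 dom _ mA h).
apply: filterS ae => xi [h1 h2]; split => //; apply: le_trans h1.
by rewrite lee_fin mulr_ge0 ?expR_ge0 // invr_ge0 (le_trans _ C1).
Qed.

(** The shadow lemma: on the shadow of [g o] the Busemann cocycle from [g o] to
    [o] is, up to a constant, the length of [g]. *)
Lemma shadow_measure_le (x0 : nat -> X) (k : R) : gromov_seq o x0 ->
  exists2 c : R, 0 <= c & forall g,
    (mu o (shadow (act g o) (len g - k)) <= (c * expR (- v * len g))%:E)%E.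
Proof.
move=> x0P; have [_ equiv [C C1 qc]] := ps.
have nf : mu o setT \is a fin_num by exact: fin_num_measure.
have C0 : 0 <= C by apply: le_trans C1.
exists (C * expR (v * (2 * k)) * fine (mu o setT)).
  by rewrite !mulr_ge0 ?expR_ge0 // fine_ge0.
move=> g; have [dom ae] := qc o (act g o).
set S := shadow _ _; have mS : measurable S by exact: (measurable_shadow hyp).
pose c := C * expR (v * (2 * k)) * expR (- v * len g).
apply: (@le_trans _ _ (c%:E * mu (act g o) S)%E).
  apply: (conformal_le _ mS ae) => //; first by rewrite !mulr_ge0 ?expR_ge0.
  move=> xi /(shadow_near hyp) Sxi; rewrite /c -mulrA -expRD ler_pM2l; last exact: lt_le_trans C1.
  rewrite ler_expR.
  have [x xx E] := gboundaryP xi x0P.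
  have xix : gseqs xi x by rewrite E; split => //; exact: xx.
  by have := ler_wpM2l v_ge0 (busemann_ge hyp xix Sxi); lra.
apply: (@le_trans _ _ (c%:E * mu (act g o) setT)%E).
  apply: lee_wpmul2l; first by rewrite lee_fin /c !mulr_ge0 ?expR_ge0.
  by apply: le_measure; rewrite ?inE.
rewrite equiv // preimage_setT -[X in (_ * X)%E]fineK // -EFinM lee_fin /c.
by rewrite mulrAC.
Qed.

(** In dimension zero the conformal factor is bounded. *)
Lemma quasi_invariant : v = 0 -> exists2 C : R, 1 <= C & forall g (A : set bd),
  measurable A -> (mu o (bact g @^-1` A) <= C%:E * mu o A)%E.
Proof.
move=> v0; have [_ equiv [C C1 qc]] := ps; exists C => // g A mA.
rewrite -equiv //; have [dom ae] := qc (act g o) o.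
apply: (conformal_le _ mA ae) => //; first exact: le_trans C1.
by move=> xi _; rewrite v0 oppr0 mul0r expR0 mulr1.
Qed.

Lemma measurable_bd_act_preim g (A : set bd) : measurable A ->
  measurable (bact g @^-1` A).
Proof.
move=> mA; rewrite -[X in measurable X]setTI.
exact: (measurable_bd_act hyp isom).
Qed.

Lemma measurable_bd_phi_preim g (A : set (bd * bd)) : measurable A ->
  measurable (bd_phi act g @^-1` A).
Proof.
move=> mA; rewrite -[X in measurable X]setTI.
exact: (measurable_bd_phi hyp isom).
Qed.

(** Pairs of [K] that [g] returns to [K] have an end in the shadow of [g o]
    ([near_line_shadow]). In positive dimension the measure of that shadow is
    exponentially small in [len g], and only finitely many [g] are short. In
    dimension zero shadows need not be small, and the recurrence of pairs is
    excluded by [recurrent_pairs_elementary]; the two coordinates are swapped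
    when it is the second one that lies in the shadow of [g o]. *)
Lemma bounded_recurrence (K : set (bd * bd)) (r e : R) :
  measurable K -> (forall z, K z -> ~ near_bd z.1 z.2 r) -> 0 < e ->
  finite_set [set g | (e%:E <= (mu o \x mu o)%E (K `&` bd_phi act g @^-1` K))%E].
Proof.
move=> mK Kr e0.
have [[x0 x0P]|noseq] := pselect (exists x, gromov_seq o x); last first.
  rewrite (_ : [set _ | _] = set0) //; apply/seteqP; split => // g /=.
  rewrite (_ : _ `&` _ = set0) ?measure0 ?lee_fin ?leNgt ?e0 //.
  apply/seteqP; split => // z [/Kr + _]; apply => x y xx.
  by case: noseq; exists x; exact: gseqs_gromov xx.
pose k := r + 6 * delta; pose E g := K `&` bd_phi act g @^-1` K.
pose U g : set bd := shadow (act g o) (len g - k).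
have mU g : measurable (U g) by exact: (measurable_shadow hyp).
pose E1 g := E g `&` (U g `*` (bact g^-1%g @^-1` U g^-1%g)).
pose E2 g := E g `&` ((bact g^-1%g @^-1` U g^-1%g) `*` U g).
have mE g : measurable (E g).
  by apply: measurableI => //; exact: measurable_bd_phi_preim.
have mV g : measurable (bact g^-1%g @^-1` U g^-1%g) by exact: measurable_bd_act_preim.
have mE1 g : measurable (E1 g) by apply: measurableI => //; exact: measurableX.
have mE2 g : measurable (E2 g) by apply: measurableI => //; exact: measurableX.
have EE g : E g `<=` E1 g `|` E2 g.
  move=> z Ez; have [/Kr n1 /Kr /= n2] := Ez.
  have d0 := delta_gt0.
  have Unear h xi : near_pt xi (act h o) (len h - (r + 5 * delta)) -> U h xi.
    move=> hh; apply: (near_shadow hyp); apply: near_ptW hh; rewrite /k; lra.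
  have /= [[a b]|[a b]] := near_line_shadow delta_gt0 hyp isom n1 n2.
    left; split => //; split => /=; first exact: Unear.
    by apply: Unear; rewrite (lenV _ isom).
  right; split => //; split => /=; last exact: Unear.
  by apply: Unear; rewrite (lenV _ isom).
pose P := (mu o \x mu o)%E.
have PE g : (P (E g) <= P (E1 g) + P (E2 g))%E.
  apply: (@le_trans _ _ (P (E1 g `|` E2 g))); last exact: measureU2.
  by apply: le_measure; rewrite ?inE //; exact: measurableU.
have := v_ge0; rewrite le_eqVlt => /orP[/eqP/esym v0|v_gt0].
  have [C C1 qi] := quasi_invariant v0.
  pose I1 := [set g | ((e / 2)%:E <= P (E1 g))%E].
  pose I2 := [set g | ((e / 2)%:E <= P (E2 g))%E].
  have e2 : 0 < e / 2 by rewrite divr_gt0.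
  have KS : K `<=` bd_pairs o.
    by move=> z /Kr nz E0; apply: nz; rewrite E0; exact: near_bdxx.
  have fI1 : finite_set I1.
    apply: contrapT => iI; apply: nonelementary.
    apply: (@recurrent_pairs_elementary _ _ _ act o delta delta_gt0 hyp isom fin_len
      measurable_point (mu o) C C1 qi K E1 I1 k (e / 2)) => // g z [[_ Kz] [Uz Vz]].
    split => //; first exact: (shadow_near hyp).
    by have := (shadow_near hyp Vz); rewrite (lenV _ isom).
  have fI2 : finite_set I2.
    apply: contrapT => iI; apply: nonelementary.
    pose sw (A : set (bd * bd)) := [set z | A (z.2, z.1)].
    have msw (A : set (bd * bd)) : measurable A -> measurable (sw A).
      move=> mA; rewrite -[X in measurable X]setTI.
      have : measurable_fun setT (fun z : bd * bd => (z.2, z.1)).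
        by apply: measurable_fun_pair; [exact: measurable_snd|exact: measurable_fst].
      exact.
    apply: (@recurrent_pairs_elementary _ _ _ act o delta delta_gt0 hyp isom fin_len
      measurable_point (mu o) C C1 qi (sw K) (sw \o E2) I2 k (e / 2)) => //.
    - by move=> z /KS; rewrite /bd_pairs /= => ne /esym.
    - by move=> g; exact: msw.
    - move=> g z [[_ Kz] [Uz Vz]]; split => //; first exact: (shadow_near hyp).
      by have := (shadow_near hyp Uz); rewrite (lenV _ isom).
    - by move=> g; rewrite /I2 /= product_measure_swap.
  apply: (@sub_finite_set _ _ (I1 `|` I2)); last by rewrite finite_setU.
  move=> g /= eg; apply: contrapT => /not_orP[/negP h1 /negP h2].
  move: h1 h2; rewrite -!ltNge => h1 h2.
  have := le_lt_trans (le_trans eg (PE g)) (lteD h1 h2).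
  by rewrite -EFinD -splitr ltxx.
have nf : mu o setT \is a fin_num by exact: fin_num_measure.
have [c c0 hc] := shadow_measure_le k x0P.
pose w := fine (mu o setT); have w0 : 0 <= w by rewrite fine_ge0.
have PX (A B : set bd) a : measurable A -> measurable B -> (mu o A <= a%:E)%E ->
    (P (A `*` B) <= (a * w)%:E)%E /\ (P (B `*` A) <= (a * w)%:E)%E.
  move=> mA mB Aa.
  have Bw : (mu o B <= w%:E)%E by rewrite /w fineK //; apply: le_measure; rewrite ?inE.
  rewrite /P !product_measure1E // EFinM; split; first exact: lee_pmul.
  by rewrite [leLHS]muleC; exact: lee_pmul.
have PEg g : (P (E g) <= (2 * c * w * expR (- v * len g))%:E)%E.
  apply: le_trans (PE g) _.
  have [h1 h2] := PX _ _ _ (mU g) (mV g) (hc g).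
  have F1 : (P (E1 g) <= P (U g `*` (bact g^-1%g @^-1` U g^-1%g)))%E.
    apply: le_measure; rewrite ?inE //; last exact: subIsetr.
    exact: measurableX.
  have F2 : (P (E2 g) <= P ((bact g^-1%g @^-1` U g^-1%g) `*` U g))%E.
    apply: le_measure; rewrite ?inE //; last exact: subIsetr.
    exact: measurableX.
  apply: le_trans (leeD (le_trans F1 h1) (le_trans F2 h2)) _.
  by rewrite -EFinD lee_fin; lra.
apply: sub_finite_set (fin_len ((ln e - ln (2 * c * w)) / - v)) => g /= eg.
have := le_trans eg (PEg g); rewrite lee_fin => {}eg.
have cw : 0 < 2 * c * w.
  rewrite lt_neqAle mulr_ge0 ?mulr_ge0 // andbT; apply/eqP => cw0.
  by move: eg; rewrite -cw0 mul0r leNgt e0.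
have : ln e <= ln (2 * c * w) + (- v * len g).
  by rewrite -[X in _ + X]expRK -lnM ?posrE ?expR_gt0 // ler_ln ?posrE // mulr_gt0 // expR_gt0.
rewrite ler_ndivlMr ?oppr_lt0 //; lra.
Qed.

End mixing.

Section bms_mixing.
Context {R : realType} {G : groupType} {X : metricType R}.
Context (act : G -> X -> X) (o : X).
Local Notation gp := (gromov_product (@mdist R X)).
Local Notation bd := (gboundary o).
Local Notation bact := (@bd_act R X o G act).
Local Notation len g := (mdist o (act g o)).
Local Notation v := (critical_exponent act o).
Local Notation S := (bd_pairs o).
Local Notation phi := (@bd_phi R X o G act).
Variables (delta : R) (delta_gt0 : 0 < delta).
Hypothesis hyp : forall o x y z : X,
  Num.min (gp o x y) (gp o y z) - delta <= gp o x z.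
Hypothesis isom : isometric_action act.
Hypothesis fin_len : forall r : R, finite_set [set g | len g <= r].
Variable D : R.
Hypothesis cobounded : forall p, exists g, mdist p (act g o) <= D.
Hypothesis nonelementary : ~ elementary G.
Variable mu : X -> {finite_measure set bd -> \bar R}.
Hypothesis ps : patterson_sullivan act mu.
Variable m : {measure set (bd * bd) -> \bar R}.
Hypothesis bms : bowen_margulis_sullivan act mu m.
Implicit Types (xi eta : bd) (z : bd * bd) (e r t : R).

Lemma pairs_exhaustion : exists (U : nat -> set (bd * bd)) (r : nat -> R),
  [/\ forall n, measurable (U n), {homo U : i j / (i <= j)%N >-> i `<=` j},
      \bigcup_n U n = S & forall n z, U n z -> ~ near_bd z.1 z.2 (r n)].
Proof.
have [A [B [r [mA mB AB sep]]]] := separating_rectangles delta_gt0 hyp fin_len cobounded.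
exists (fun n => \bigcup_(k in `I_n) (A k `*` B k)), (fun n => \sum_(k < n) `|r k|).
split.
- by move=> n; apply: bigcup_measurable => k _; exact: measurableX.
- move=> i j ij z [k /= ki kz]; exists k => //=; exact: leq_trans ij.
- apply/seteqP; split => [z [n _ [k _ [/= Az Bz]]] E|[xi eta] /= ne].
    by apply: (AB _ _ _ Az Bz); rewrite E; exact: near_bdxx.
  by have [k [Ak Bk]] := sep _ _ ne; exists k.+1 => //; exists k => //=.
- move=> n z [k /= kn [Az Bz]] nb; apply: (AB _ _ _ Az Bz); apply: near_bdW nb.
  rewrite (bigD1 (Ordinal kn)) //=; apply: le_trans (ler_norm _) _.
  by rewrite lerDl sumr_ge0.
Qed.

Lemma measurable_pairs : measurable S.
Proof.
have [U [r [mU _ <- _]]] := pairs_exhaustion.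
exact: bigcup_measurable.
Qed.

Lemma bms_setI (A : set (bd * bd)) : measurable A -> m (A `&` S) = m A.
Proof.
move=> mA; have mS := measurable_pairs; have [[mS0 _ _] _ _ _] := bms.
rewrite -[in RHS](setUIDK A S) measureU //; last 3 first.
- exact: measurableI.
- exact: measurableD.
- by rewrite setDE setIACA setICr setI0.
rewrite [X in (_ + X)%E](_ : _ = 0%E) ?adde0 //.
apply/eqP; rewrite eq_le measure_ge0 andbT -mS0; apply: le_measure; rewrite ?inE.
- exact: measurableD.
- exact: measurableC.
- by move=> z [].
Qed.

Lemma bms_invariant g (A : set (bd * bd)) : measurable A -> m (phi g @^-1` A) = m A.
Proof.
move=> mA; have mS := measurable_pairs; have [_ inv _ _] := bms.
have mP : measurable (phi g @^-1` A) by exact: (measurable_bd_phi_preim hyp isom).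
rewrite -bms_setI // -[RHS]bms_setI // -(inv g _ (measurableI _ _ mA mS) (@subIsetr _ _ _)).
congr (m _); apply/seteqP; split => z [h1 h2]; split => //; last by case: h1.
by split => //; apply/(bd_phi_pairs hyp isom).
Qed.

(** Where the Gromov product is bounded, so is the density [exp F]. *)
Lemma bms_le (K : set (bd * bd)) r : (forall z, K z -> ~ near_bd z.1 z.2 r) ->
  exists2 c : R, 0 <= c & forall A : set (bd * bd), measurable A -> A `<=` K ->
    (m A <= c%:E * (mu o \x mu o)%E A)%E.
Proof.
move=> Kr; have [_ _ _ [F [mF [M FM] mE]]] := bms.
have v0 : 0 <= v by apply: critical_exponent_ge0 => /finite_elementary.
exists (expR (2 * v * `|r + 2 * delta| + M)); first exact: expR_ge0.
move=> A mA AK.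
have AS : A `<=` S by move=> z /AK/Kr nz E0; apply: nz; rewrite E0; exact: near_bdxx.
rewrite mE //.
apply: (@le_trans _ _ (\int[(mu o \x mu o)%E]_(z in A)
    (expR (2 * v * `|r + 2 * delta| + M))%:E)%E); last by rewrite integral_cst.
apply: ge0_le_integral => //=.
- apply/measurable_EFinP; apply: measurableT_comp; first exact: measurable_expR.
  exact: (measurable_funS measurable_pairs AS mF).
move=> z Az; rewrite lee_fin ler_expR.
have := FM z (AS z Az); rewrite ler_norml => /andP[_].
suff h : fine (bd_product z.1 z.2) <= `|r + 2 * delta|.
  have v2 : 0 <= 2 * v by rewrite mulr_ge0.
  by have := ler_wpM2l v2 h; lra.
have hr : (bd_product z.1 z.2 <= (r + 2 * delta)%:E)%E.
  rewrite leNgt; apply/negP => /(bd_product_gt hyp).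
  by rewrite (_ : _ - _ - _ = r); [exact: (Kr z (AK z Az))|lra].
case: (bd_product z.1 z.2) hr => //= s; rewrite lee_fin => h.
by apply: le_trans h _; exact: ler_norm.
Qed.

Lemma bms_finite (K : set (bd * bd)) r : measurable K ->
  (forall z, K z -> ~ near_bd z.1 z.2 r) -> (m K < +oo)%E.
Proof.
move=> mK Kr; have [c c0 hc] := bms_le Kr.
apply: le_lt_trans (hc K mK (@subset_refl _ K)) _.
have : ((mu o \x mu o)%E K <= mu o setT * mu o setT)%E.
  rewrite -product_measure1E //; apply: le_measure; rewrite ?inE //.
  exact: measurableX.
move=> h; apply: le_lt_trans (lee_wpmul2l _ h) _; first by rewrite lee_fin.
have nf : mu o setT \is a fin_num by exact: fin_num_measure.
by rewrite -(fineK nf) -!EFinM ltry.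
Qed.

(** Up to a small part, [B] sits in a set [U n] of pairs with bounded Gromov
    product, where [m] is dominated by the product measure and
    [bounded_recurrence] applies; the remainder and its translate have the same
    small mass because [m] is invariant. *)
Lemma bms_mixing (B : set (bd * bd)) e : measurable B -> B `<=` S ->
  (m B < +oo)%E -> 0 < e ->
  finite_set [set g | (e%:E <= m (B `&` phi g @^-1` B))%E].
Proof.
move=> mB BS Boo e0; have [U [r [mU Uhomo US Ur]]] := pairs_exhaustion.
have [n hn] : exists n, (m (B `\` U n) < (e / 3)%:E)%E.
  have : m (B `\` U n) @[n --> \oo] --> m (\bigcap_n (B `\` U n)).
    apply: nonincreasing_cvg_mu => //.
    - apply: le_lt_trans Boo; apply: le_measure; rewrite ?inE //.
      + exact: measurableD.
    - by move=> k; exact: measurableD.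
    - by apply: bigcap_measurable => // k _; exact: measurableD.
    - move=> i j ij; apply/subsetPset => z [Bz Uz]; split => // Uiz.
      by apply: Uz; exact: Uhomo ij _ Uiz.
  rewrite (_ : \bigcap_n _ = set0) ?measure0; last first.
    apply/seteqP; split => // z hz; have [Bz _] := hz 0%N I.
    have : S z by exact: BS.
    by rewrite -US => -[k _ Uk]; have [_] := hz k I.
  move=> cv; apply: contrapT => hn; have : ((e / 3)%:E <= 0)%E.
    rewrite -(cvg_lim _ cv) //; apply: lime_ge; first by apply/cvg_ex; exists 0%E.
    by apply: nearW => n; rewrite leNgt; apply/negP => h; apply: hn; exists n.
  by rewrite lee_fin leNgt divr_gt0.
have [c c0 hc] := bms_le (Ur n).
have c1 : 0 < c + 1 by rewrite ltr_wpDl.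
have e3 : 0 < e / 3 / (c + 1) by rewrite !divr_gt0.
apply: sub_finite_set (bounded_recurrence delta_gt0 hyp isom fin_len cobounded
  nonelementary ps (mU n) (Ur n) e3) => g /= eg.
have mphi A : measurable A -> measurable (phi g @^-1` A).
  exact: (measurable_bd_phi_preim hyp isom).
have mUU : measurable (U n `&` phi g @^-1` U n) by apply: measurableI => //; exact: mphi.
rewrite leNgt; apply/negP => hlt; move: eg; apply/negP; rewrite -ltNge.
have sub : B `&` phi g @^-1` B `<=` (U n `&` phi g @^-1` U n) `|`
    ((B `\` U n) `|` phi g @^-1` (B `\` U n)).
  move=> z [/= Bz Bgz]; have [Uz|Uz] := pselect (U n z); last by right; left.
  by have [Ugz|Ugz] := pselect (U n (phi g z)); [left|right; right].
have mD : measurable (B `\` U n) by exact: measurableD.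
apply: (@le_lt_trans _ _ (m (U n `&` phi g @^-1` U n) + (m (B `\` U n) +
    m (phi g @^-1` (B `\` U n))))%E).
  apply: le_trans (le_measure _ _ _ sub) _; rewrite ?inE.
  - by apply: measurableI => //; exact: mphi.
  - by apply: measurableU => //; apply: measurableU => //; exact: mphi.
  apply: le_trans (measureU2 _ _ _) _ => //.
    by apply: measurableU => //; exact: mphi.
  by apply: leeD => //; apply: measureU2 => //; exact: mphi.
rewrite bms_invariant // (_ : e = e / 3 + (e / 3 + e / 3)); last by lra.
rewrite !EFinD; apply: lteD; last exact: lteD.
apply: le_lt_trans (hc _ mUU _) _; first by move=> z [].
apply: le_lt_trans (_ : ((c + 1)%:E * (mu o \x mu o)%E (U n `&` phi g @^-1` U n) < _)%E).
  by apply: lee_wpmul2r => //; rewrite lee_fin lerDl.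
by rewrite -lte_pdivlMl // -EFinM mulrC.
Qed.

(** The sets may grow in any manner: they become arbitrarily large, while only
    finitely many terms exceed a given level. *)
Lemma cvg_average (a : G -> \bar R) (C : R) (F : nat -> {fset G}) :
  (forall g, 0 <= a g)%E -> (forall g, a g <= C%:E)%E ->
  (forall e, 0 < e -> finite_set [set g | (e%:E <= a g)%E]) ->
  (forall n, (F n `<=` F n.+1)%fset) -> (forall g, exists n, g \in F n) ->
  ((#|` F n|%:R^-1)%:E * \sum_(g <- F n) a g)%E @[n --> \oo] --> 0%E.
Proof.
move=> a0 aC afin Fhomo Fex.
have infG : infinite_set [set: G] by move=> /finite_elementary.
have Fmono i j : (i <= j)%N -> (F i `<=` F j)%fset.
  by move=> /subnK <-; elim: (j - i)%N => // k IH; rewrite addSn; apply: fsubset_trans IH _.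
have Fin (Y : {fset G}) : exists n, (Y `<=` F n)%fset.
  have /choice[N hN] := Fex.
  exists (\max_(g <- Y) N g); apply/fsubsetP => g gY.
  by have /fsubsetP := Fmono _ _ (@leq_bigmax_seq _ (enum_fset Y) xpredT N g gY isT); apply.
have C0 : 0 <= C by rewrite -lee_fin; exact: le_trans (a0 1%g) (aC 1%g).
pose b g := fine (a g).
have ab g : a g = (b g)%:E.
  rewrite /b fineK // ge0_fin_numE //; exact: le_lt_trans (aC g) (ltry _).
have b0 g : 0 <= b g by rewrite -lee_fin -ab.
rewrite (_ : (fun _ => _) = EFin \o (fun n => #|` F n|%:R^-1 * \sum_(g <- F n) b g)); last first.
  apply/funext => n /=; rewrite EFinM -sumEFin; congr (_ * _)%E.
  by apply: eq_bigr => g _; exact: ab.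
apply/cvg_EFin; first by near=> n.
apply/cvgrPdist_le => /= e e0.
have e2 : 0 < e / 2 by rewrite divr_gt0.
pose Z := fset_set [set g | ((e / 2)%:E <= a g)%E].
have [Y _ hY] := infinite_set_fset (Num.bound (#|` Z|%:R * C / (e / 2))).+1 infG.
have [N hN] := Fin Y; exists N => // n /= Nn.
have cF : (Num.bound (#|` Z|%:R * C / (e / 2)) < #|` F n|)%N.
  apply: leq_trans hY _; apply: fsubset_leq_card.
  by apply: fsubset_trans hN _; exact: Fmono.
have cF0 : 0 < (#|` F n|%:R : R) by rewrite ltr0n; exact: leq_ltn_trans cF.
rewrite sub0r normrN ger0_norm; last by rewrite mulr_ge0 ?invr_ge0 ?ler0n // sumr_ge0.
rewrite mulrC ler_pdivrMr //.
have hb g : b g <= e / 2 + C * (g \in Z)%:R.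
  have [gZ|gZ] := boolP (g \in Z).
    rewrite mulr1; apply: ler_wpDl; first exact: ltW.
    by rewrite -lee_fin -ab.
  rewrite mulr0 addr0 leNgt; apply/negP => h; move/negP : gZ; apply.
  by rewrite in_fset_set ?inE /= ?ab ?lee_fin ?ltW //; exact: afin.
apply: le_trans (ler_sum _ (fun g _ => hb g)) _.
rewrite big_split /= -mulr_sumr big_const_seq count_predT iter_addr_0 -mulr_natr.
rewrite -mulr_sumr.
have hZ : \sum_(g <- F n) ((g \in Z)%:R : R) <= #|` Z|%:R.
  rewrite -natr_sum ler_nat (eq_bigr (fun g => if g \in Z then 1%N else 0%N)); last first.
    by move=> g _; case: ifP.
  rewrite -big_mkcond /= sum1_count -size_filter; apply: uniq_leq_size.
    by rewrite filter_uniq ?fset_uniq.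
  by move=> g; rewrite mem_filter => /andP[].
have hF : #|` Z|%:R * C / (e / 2) < #|` F n|%:R.
  apply: lt_trans (archi_boundP _) _; last by rewrite ltr_nat.
  by rewrite divr_ge0 ?mulr_ge0 // ltW.
move: hF; rewrite ltr_pdivrMr // => hF.
have := ler_wpM2l C0 hZ; lra.
Unshelve. all: by end_near.
Qed.

End bms_mixing.

(** * Ergodicity from decorrelation *)

Section bounded_measurable.
Context {d} {T : measurableType d} {R : realType} (L : probability T R).
Implicit Types (f g : T -> R).

Definition bounded_mfun f := measurable_fun setT f /\ exists M, forall x, `|f x| <= M.

Local Notation E f := (\int[L]_x f x)%R.

Lemma bounded_mfun_integrable f : bounded_mfun f -> L.-integrable setT (EFin \o f).
Proof.
move=> [mf [M fM]]; apply: measurable_bounded_integrable => //.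
  by rewrite -ge0_fin_numE // fin_num_measure.
exists M; split; first exact: num_real.
by move=> y My x _; apply: le_trans (fM x) (ltW My).
Qed.

Lemma bounded_mfun_cst c : bounded_mfun (fun=> c).
Proof. by split; [exact: measurable_cst|exists `|c|]. Qed.

Lemma bounded_mfunD f g : bounded_mfun f -> bounded_mfun g ->
  bounded_mfun (fun x => f x + g x).
Proof.
move=> [mf [M fM]] [mg [N gN]]; split; first exact: measurable_funD.
by exists (M + N) => x; apply: le_trans (ler_normD _ _) _; apply: lerD.
Qed.

Lemma bounded_mfunM f g : bounded_mfun f -> bounded_mfun g ->
  bounded_mfun (fun x => f x * g x).
Proof.
move=> [mf [M fM]] [mg [N gN]]; split; first exact: measurable_funM.
by exists (M * N) => x; rewrite normrM; apply: ler_pM.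
Qed.

Lemma bounded_mfunZ c f : bounded_mfun f -> bounded_mfun (fun x => c * f x).
Proof. exact/bounded_mfunM/bounded_mfun_cst. Qed.

Lemma bounded_mfun_indic (A : set T) : measurable A -> bounded_mfun (\1_A : T -> R).
Proof.
move=> mA; split; first exact: measurable_indic.
by exists 1 => x; rewrite indicE; case: (_ \in _); rewrite ?normr1 ?normr0.
Qed.

Lemma bounded_mfun_cos_comp f : measurable_fun setT f -> bounded_mfun (fun x => cos (f x)).
Proof.
move=> mf; split; last by exists 1 => x; exact: cos_max.
apply: measurableT_comp; last exact: mf.
by apply: continuous_measurable_fun; exact: continuous_cos.
Qed.

Lemma expectD f g : bounded_mfun f -> bounded_mfun g -> E (fun x => f x + g x) = E f + E g.
Proof. by move=> hf hg; rewrite RintegralD //; exact: bounded_mfun_integrable. Qed.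

Lemma expectZ c f : bounded_mfun f -> E (fun x => c * f x) = c * E f.
Proof. by move=> hf; rewrite RintegralZl //; exact: bounded_mfun_integrable. Qed.

Lemma expect_cst c : E (fun=> c) = c.
Proof.
rewrite Rintegral_cst //; transitivity (c * fine 1%E); last by rewrite /= mulr1.
by congr (_ * fine _); exact: probability_setT.
Qed.

Lemma expect_le f g : bounded_mfun f -> bounded_mfun g -> (forall x, f x <= g x) -> E f <= E g.
Proof. by move=> hf hg fg; apply: le_Rintegral => //; exact: bounded_mfun_integrable. Qed.

Lemma expect_indic (A : set T) : measurable A -> E (\1_A) = fine (L A).
Proof. by move=> mA; rewrite /Rintegral integral_indic // setIT. Qed.

Lemma expect_cvg (f_ : nat -> T -> R) f M : (forall n, measurable_fun setT (f_ n)) ->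
  (forall n x, `|f_ n x| <= M) -> (forall x, f_ ^~ x @ \oo --> f x) ->
  bounded_mfun f /\ E (f_ n) @[n --> \oo] --> E f.
Proof.
move=> mf fM cf.
have mlim : measurable_fun setT f by exact: (measurable_fun_cvg mf (fun x _ => cf x)).
have fb x : `|f x| <= M.
  have cn : `|f_ n x| @[n --> \oo] --> `|f x| by apply: cvg_norm; exact: cf.
  rewrite -(cvg_lim _ cn) //; apply: limr_le; first by apply/cvg_ex; exists `|f x|.
  by apply: nearW.
split; first by split => //; exists M.
have [|||||_ _ h] := @dominated_convergence _ T R L setT measurableT
  (fun n x => (f_ n x)%:E) (EFin \o f) (cst M%:E).
- by move=> n; apply/measurable_EFinP.
- exact/measurable_EFinP.
- by apply: aeW => x _; apply/cvg_EFin; [exact: nearW|exact: cf].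
- exact: (bounded_mfun_integrable (bounded_mfun_cst M)).
- by apply: aeW => x n _ /=; rewrite lee_fin.
have bf n : bounded_mfun (f_ n) by split => //; exists M.
have fE g : bounded_mfun g -> (\int[L]_x (g x)%:E = (E g)%:E)%E.
  move=> /bounded_mfun_integrable ig; rewrite /Rintegral fineK //.
  exact: integrable_fin_num.
move: h => /=; rewrite fE; last by split => //; exists M.
exact: fine_cvg.
Qed.

End bounded_measurable.

Section decorrelation.
Context {d} {T : measurableType d} {R : realType} (L : probability T R).
Context {G : groupType} (tau : G -> T -> T).
Local Notation E f := (\int[L]_x f x)%R.
Hypothesis infG : infinite_set [set: G].
Hypothesis mtau : forall h, measurable_fun setT (tau h).
Hypothesis tauM : forall h k x, tau h (tau k x) = tau (k * h)%g x.
Hypothesis tauL : forall h (A : set T), measurable A -> L (tau h @^-1` A) = L A.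
Implicit Types (f : T -> R) (h k : G).

Lemma bounded_mfun_comp h f : bounded_mfun f -> bounded_mfun (f \o tau h).
Proof.
by move=> [mf [M fM]]; split; [exact: measurableT_comp|exists M => x; exact: fM].
Qed.

Lemma expect_comp h f : bounded_mfun f -> E (f \o tau h) = E f.
Proof.
move=> bf; rewrite /Rintegral; congr fine.
transitivity (\int[pushforward L (tau h)]_x (f x)%:E)%E.
  rewrite (integral_pushforward (mtau h)) //=; first exact/measurable_EFinP/bf.1.
  exact: (bounded_mfun_integrable L (bounded_mfun_comp h bf)).
by apply: eq_measure_integral => A mA _; exact: tauL.
Qed.

(** The mean ergodic argument: many translates of a function that are pairwise
    almost uncorrelated average out to its mean, while their integrals over an
    invariant set all agree. *)
Lemma invariant_decorrelated (A : set T) f :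
  measurable A -> (forall h, tau h @^-1` A = A) -> bounded_mfun f -> (forall x, `|f x| <= 1) ->
  (forall e, 0 < e -> finite_set [set h | e <= `|E (fun x => f x * f (tau h x)) - E f ^+ 2|]) ->
  E (fun x => \1_A x * f x) = fine (L A) * E f.
Proof.
move=> mA Ainv bf f1 fdec; set c := E f.
have bA : bounded_mfun (\1_A : T -> R) by exact: bounded_mfun_indic.
pose Z h x := f (tau h x) - c.
have bft h : bounded_mfun (fun x => f (tau h x)) by exact: (bounded_mfun_comp h bf).
have bZ h : bounded_mfun (Z h) by apply: bounded_mfunD => //; exact: bounded_mfun_cst.
have c1 : `|c| <= 1.
  rewrite ler_norml; apply/andP; split.
    rewrite -[leLHS](expect_cst L); apply: expect_le => //; first exact: bounded_mfun_cst.
    by move=> x; have := f1 x; rewrite ler_norml => /andP[].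
  rewrite -[leRHS](expect_cst L); apply: expect_le => //; first exact: bounded_mfun_cst.
  by move=> x; have := f1 x; rewrite ler_norml => /andP[].
pose cov k := E (fun x => f x * f (tau k x)) - c ^+ 2.
have ZZ h k : E (fun x => Z h x * Z k x) = cov (h^-1 * k)%g.
  rewrite /cov -(expect_comp h (f := fun x => f x * f (tau (h^-1 * k)%g x))) /=; last first.
    by apply: bounded_mfunM.
  under [in RHS]eq_Rintegral do rewrite tauM mulgA mulgV mul1g.
  have bfh : bounded_mfun (fun x => f (tau h x) * f (tau k x)) by exact: bounded_mfunM.
  transitivity (E (fun x => f (tau h x) * f (tau k x) + (- c * f (tau h x) + (- c * f (tau k x) + c ^+ 2)))).
    by apply: eq_Rintegral => x _; rewrite /Z; lra.
  have bc := bounded_mfun_cst (T := T) (c ^+ 2).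
  have bh := bounded_mfunZ (- c) (bft h); have bk := bounded_mfunZ (- c) (bft k).
  rewrite (expectD L bfh (bounded_mfunD bh (bounded_mfunD bk bc))).
  rewrite (expectD L bh (bounded_mfunD bk bc)) (expectD L bk bc).
  rewrite (expectZ L _ (bft h)) (expectZ L _ (bft k)) expect_cst.
  rewrite (expect_comp h bf) (expect_comp k bf) -/c; lra.
pose q := E (fun x => \1_A x * f x) - fine (L A) * c.
have AZ h : E (fun x => \1_A x * Z h x) = q.
  have -> : q = E (fun x => \1_A x * (f x - c)).
    transitivity (E (fun x => \1_A x * f x + - c * \1_A x)); last first.
      by apply: eq_Rintegral => x _; lra.
    rewrite expectD ?expectZ ?expect_indic //; [by rewrite /q; lra|..].
      exact: bounded_mfunM.
    exact: bounded_mfunZ.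
  rewrite -(expect_comp h (f := fun x => \1_A x * (f x - c))); last first.
    by apply: bounded_mfunM => //; apply: bounded_mfunD => //; exact: bounded_mfun_cst.
  apply: eq_Rintegral => x _ /=; rewrite /Z; congr (_ * _).
  rewrite !indicE; suff -> : (x \in A) = (tau h x \in A) by [].
  apply/idP/idP; rewrite !inE => Ax; last by rewrite -(Ainv h).
  by have : (tau h @^-1` A) x by rewrite Ainv.
(* Choosing the translates one by one, each almost uncorrelated with the previous
   ones, keeps the variance of the sum linear up to [e * n^2]. *)
have step e : 0 < e -> forall n, exists s : seq G, size s = n /\
    E (fun x => (\sum_(k <- s) Z k x) ^+ 2) <= 4 * n%:R + e * n%:R ^+ 2.
  move=> e0; elim=> [|n [s [sn hs]]].
    exists [::]; split => //; under eq_Rintegral do rewrite big_nil expr2 mulr0.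
    by rewrite expect_cst; lra.
  have [h hh] : exists h, forall k, k \in s -> cov (k^-1 * h)%g < e.
    have fin : finite_set (\bigcup_(k in [set` s]) ((fun b => (k * b)%g) @` [set h | e <= `|cov h|])).
      apply: bigcup_finite; first exact: finite_seq.
      by move=> k _; apply: finite_image; exact: fdec.
    apply: contrapT => hn; apply: infG; apply: sub_finite_set fin => h _.
    apply: contrapT => hb; apply: hn; exists h => k ks; rewrite ltNge; apply/negP => ek.
    apply: hb; exists k => //; exists (k^-1 * h)%g; last by rewrite mulgA mulgV mul1g.
    by apply: le_trans ek _; exact: ler_norm.
  have bS : forall s' : seq G, bounded_mfun (fun x => \sum_(k <- s') Z k x).
    elim=> [|k s' IH]; first by under eq_fun do rewrite big_nil; exact: bounded_mfun_cst.
    by under eq_fun do rewrite big_cons; exact: bounded_mfunD.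
  have cross : E (fun x => Z h x * \sum_(k <- s) Z k x) <= e * n%:R.
    rewrite -sn; move: hh; clear sn hs; elim: s => [|k s IH] hh.
      under eq_Rintegral do rewrite big_nil mulr0.
      by rewrite expect_cst mulr0.
    under eq_Rintegral do rewrite big_cons mulrDr.
    rewrite expectD; [|exact: bounded_mfunM|exact: bounded_mfunM].
    have h1 : E (fun x => Z h x * Z k x) <= e.
      under eq_Rintegral do rewrite mulrC.
      by rewrite ZZ; apply/ltW/hh; rewrite mem_head.
    have h2 := IH (fun k' k's => hh k' (mem_behead (s := k :: s) k's)).
    by rewrite /= -natr1; lra.
  exists (h :: s); split; first by rewrite /= sn.
  have E2 : E (fun x => (\sum_(k <- h :: s) Z k x) ^+ 2) =
      E (fun x => Z h x * Z h x + (2 * (Z h x * \sum_(k <- s) Z k x) +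
        (\sum_(k <- s) Z k x) * (\sum_(k <- s) Z k x))).
    by apply: eq_Rintegral => x _; rewrite big_cons; lra.
  have b1 : bounded_mfun (fun x => Z h x * Z h x) by exact: bounded_mfunM.
  have b2 : bounded_mfun (fun x => Z h x * \sum_(k <- s) Z k x) by exact: bounded_mfunM.
  have b3 : bounded_mfun (fun x => (\sum_(k <- s) Z k x) * \sum_(k <- s) Z k x).
    exact: bounded_mfunM.
  have b2' := bounded_mfunZ 2 b2.
  rewrite E2 expectD // ?expectD ?expectZ //; last exact: bounded_mfunD.
  have h4 : E (fun x => Z h x * Z h x) <= 4.
    rewrite -[leRHS](expect_cst L); apply: expect_le => //; first exact: bounded_mfun_cst.
    move=> x; have : `|Z h x| <= 2.
      by apply: le_trans (ler_normB _ _) _; have := f1 (tau h x); lra.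
    by rewrite ler_norml => /andP[h1 h2]; nra.
  move: hs; under eq_Rintegral do rewrite expr2.
  move=> hs; rewrite -natr1; have := ler0n R n; nra.
(* Cauchy--Schwarz for the indicator of [A] and this sum, written as the
   positivity of a square. *)
have key e n : 0 < e -> (0 < n)%N -> q ^+ 2 <= 4 / n%:R + e.
  move=> e0 n0; have [s [sn hs]] := step e e0 n.
  have n0' : 0 < (n%:R : R) by rewrite ltr0n.
  pose W x := \sum_(k <- s) Z k x.
  have bS : forall s' : seq G, bounded_mfun (fun x => \sum_(k <- s') Z k x).
    elim=> [|k s' IH]; first by under eq_fun do rewrite big_nil; exact: bounded_mfun_cst.
    by under eq_fun do rewrite big_cons; exact: bounded_mfunD.
  have bW : bounded_mfun W by exact: bS.
  have AW : E (fun x => \1_A x * W x) = n%:R * q.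
    rewrite /W -sn; clear - AZ bS bA bZ; elim: s => [|k s IH] /=.
      under eq_Rintegral do rewrite big_nil mulr0.
      by rewrite expect_cst mul0r.
    under eq_Rintegral do rewrite big_cons mulrDr.
    rewrite expectD; [|exact: bounded_mfunM|exact: bounded_mfunM].
    by rewrite AZ IH -natr1; lra.
  have AA : E (fun x => \1_A x * \1_A x) <= 1.
    rewrite -[leRHS](expect_cst L); apply: expect_le; first exact: bounded_mfunM.
      exact: bounded_mfun_cst.
    by move=> x; rewrite indicE; case: (_ \in _); rewrite ?mulr1 ?mulr0.
  have pos : 0 <= E (fun x => (W x - n%:R * q * \1_A x) ^+ 2).
    by apply: Rintegral_ge0 => x _; exact: sqr_ge0.
  have b1 : bounded_mfun (fun x => W x * W x) by exact: bounded_mfunM.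
  have b2 : bounded_mfun (fun x => \1_A x * W x) by exact: bounded_mfunM.
  have b3 : bounded_mfun (fun x => \1_A x * \1_A x : R) by exact: bounded_mfunM.
  have b2' := bounded_mfunZ (- 2 * (n%:R * q)) b2.
  have b3' := bounded_mfunZ ((n%:R * q) ^+ 2) b3.
  have E2 : E (fun x => (W x - n%:R * q * \1_A x) ^+ 2) = E (fun x => W x * W x +
      (- 2 * (n%:R * q) * (\1_A x * W x) + (n%:R * q) ^+ 2 * (\1_A x * \1_A x))).
    by apply: eq_Rintegral => x _; lra.
  move: pos; rewrite E2 expectD // ?expectD ?expectZ //; last exact: bounded_mfunD.
  rewrite AW; move: hs; rewrite -/(W _); under eq_Rintegral do rewrite expr2.
  rewrite -/(W _) => hs pos.
  have : n%:R ^+ 2 * q ^+ 2 <= 4 * n%:R + e * n%:R ^+ 2.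
    have : (n%:R * q) ^+ 2 * E (fun x => \1_A x * \1_A x) <= (n%:R * q) ^+ 2 * 1.
      by apply: ler_wpM2l => //; exact: sqr_ge0.
    by rewrite /W in pos *; lra.
  move=> h; rewrite -(ler_pM2l (exprn_gt0 2 n0')); apply: le_trans h _.
  rewrite mulrDr [_ * e]mulrC lerD2r mulrA [_ * 4]mulrC -mulrA expr2 -mulrA mulfV ?gt_eqF //.
  by rewrite mulr1.
have q0 : q = 0.
  apply/eqP; rewrite -sqrf_eq0 eq_le sqr_ge0 andbT; apply/ler_addgt0Pr => e e0.
  rewrite add0r; have e2 : 0 < e / 2 by rewrite divr_gt0.
  pose n := (Num.bound (4 / (e / 2))).+1.
  apply: le_trans (key (e / 2) n e2 isT) _.
  suff : 4 / n%:R <= e / 2 by lra.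
  rewrite ler_pdivrMr ?ltr0n // mulrC -ler_pdivrMr //.
  apply: le_trans (ltW (archi_boundP _)) _; first by rewrite divr_ge0 // ltW.
  by rewrite ler_nat.
by move/eqP: q0; rewrite /q subr_eq0 => /eqP.
Qed.

End decorrelation.

Section smoothstep.
Context {R : realType}.
Implicit Types p : R.

(** A cubic fixing [0], [1/2] and [1]: its iterates sharpen a function with
    values in the unit interval into a step, by polynomials. *)
Definition smoothstep p : R := p * p * (3 - 2 * p).

Definition unit_step p : R := if 1 / 2 < p then 1 else if p == 1 / 2 then 1 / 2 else 0.

Lemma unit_step1 p : 1 / 2 < p -> unit_step p = 1.
Proof. by rewrite /unit_step => ->. Qed.

Lemma unit_step0 p : p < 1 / 2 -> unit_step p = 0.
Proof. by rewrite /unit_step; case: ltrgtP. Qed.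

Lemma unit_step_half : unit_step (1 / 2) = 1 / 2.
Proof. by rewrite /unit_step ltxx eqxx. Qed.

Lemma smoothstep_itv p : 0 <= p <= 1 -> 0 <= smoothstep p <= 1.
Proof.
move=> /andP[p0 p1]; rewrite /smoothstep; apply/andP; split.
  by rewrite !mulr_ge0 //; lra.
by have := mulr_ge0 (sqr_ge0 (1 - p)) (_ : 0 <= 1 + 2 * p); lra.
Qed.

Lemma iter_smoothstep_itv p n : 0 <= p <= 1 -> 0 <= iter n smoothstep p <= 1.
Proof. by move=> hp; elim: n => //= n /smoothstep_itv. Qed.

(** Below [1/2] the iterates decrease at least geometrically to [0]; the symmetry
    [p -> 1 - p] gives the other half. *)
Lemma iter_smoothstep_cvg p : 0 <= p <= 1 ->
  iter n smoothstep p @[n --> \oo] --> unit_step p.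
Proof.
have low q : 0 <= q -> q < 1 / 2 -> iter n smoothstep q @[n --> \oo] --> (0 : R).
  move=> q0 q2; pose r := q * (3 - 2 * q).
  have r0 : 0 <= r by rewrite mulr_ge0 //; lra.
  have r1 : r < 1 by rewrite /r; nra.
  have hn n : 0 <= iter n smoothstep q <= r ^+ n * q.
    elim: n => [|n /andP[h0 h1]] /=; first by rewrite expr0 mul1r q0 lexx.
    set u := iter n smoothstep q in h0 h1 *.
    have uq : u <= q.
      apply: le_trans h1 _; rewrite -[leRHS]mul1r; apply: ler_wpM2r => //.
      by apply: exprn_ile1 => //; exact: ltW.
    have ur : u * (3 - 2 * u) <= r by rewrite /r; nra.
    apply/andP; split; first by rewrite /smoothstep !mulr_ge0 //; lra.
    rewrite /smoothstep -mulrA exprS -mulrA mulrC.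
    by apply: ler_pM => //; rewrite mulr_ge0 //; lra.
  apply: (@squeeze_cvgr _ _ _ _ (fun=> 0) (fun n => r ^+ n * q)).
  - by apply: nearW.
  - exact: cvg_cst.
  - rewrite -(mul0r q); apply: cvgM; last exact: cvg_cst.
    by apply: cvg_expr; rewrite ger0_norm.
move=> /andP[p0 p1].
have [ph|ph|->] := ltrgtP p (1 / 2).
- by rewrite unit_step0 //; exact: low.
- rewrite unit_step1 //.
  have E n : iter n smoothstep p = 1 - iter n smoothstep (1 - p).
    elim: n => [|n /= ->]; first by rewrite subKr.
    by rewrite /smoothstep; lra.
  under eq_fun do rewrite E.
  suff : (1 - iter n smoothstep (1 - p)) @[n --> \oo] --> (1 - 0 : R) by rewrite subr0.
  apply: cvgB; first exact: cvg_cst.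
  by apply: low; lra.
rewrite unit_step_half; have E n : iter n smoothstep (1 / 2) = 1 / 2.
  by elim: n => // n /= ->; rewrite /smoothstep; lra.
by under eq_fun do rewrite E; exact: cvg_cst.
Qed.

Lemma unit_step_gt0 (x : R) :
  let u := unit_step ((1 + Num.sg x) / 2) in u * (2 * u - 1) = (if 0 < x then 1 else 0).
Proof.
have [x0|x0|<-] := ltrgtP 0 x.
- by rewrite /= gtr0_sg // unit_step1; lra.
- by rewrite /= ltr0_sg // unit_step0; lra.
- by rewrite /= sgr0 addr0 unit_step_half; lra.
Qed.

(** The sign of [x] read off from [sin (x / N)] once [N] is large. *)
Lemma unit_step_sin (x : R) :
  unit_step ((1 + sin (x / n.+1%:R)) / 2) @[n --> \oo] --> unit_step ((1 + Num.sg x) / 2).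
Proof.
have pos (y : R) n : 0 < y -> (Num.bound `|y| <= n)%N -> 0 < sin (y / n.+1%:R).
  move=> y0 yn; have n0 : 0 < (n.+1%:R : R) by rewrite ltr0n.
  apply: sin_gt0_pi; rewrite divr_gt0 //= ltr_pdivrMr //.
  apply: le_lt_trans (ler_norm _) _; apply: lt_le_trans (archi_boundP (normr_ge0 y)) _.
  apply: (@le_trans _ _ n.+1%:R); first by rewrite ler_nat leqW.
  rewrite ler_peMl ?ler0n //; apply: le_trans _ (pi_ge2 R).
  by rewrite ler1n.
apply: cvg_near_cst; exists (Num.bound `|x|) => // n /= xn.
have [x0|x0|<-] := ltrgtP 0 x; last by rewrite mul0r sin0 sgr0.
- by have := pos _ _ x0 xn; rewrite gtr0_sg // => h; rewrite !unit_step1 //; lra.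
- have := pos (- x) n; rewrite normrN oppr_gt0 => /(_ x0 xn).
  by rewrite mulNr sinN ltr0_sg // => h; rewrite !unit_step0 //; lra.
Qed.

End smoothstep.

Section multipliers.
Context {d} {T : measurableType d} {R : realType} (L : probability T R).
Context {G : Type} (coord : G -> T -> R).
Local Notation E f := (\int[L]_x f x)%R.
Hypothesis mcoord : forall g, measurable_fun setT (coord g).
Variable chi : T -> R.
Hypothesis bchi : bounded_mfun chi.
Implicit Types (U V s Z : T -> R).

Definition linear_stat U := exists n (a : 'I_n -> R) (t : 'I_n -> G),
  U = fun x => \sum_(j < n) a j * coord (t j) x.

Lemma linear_stat_add U V : linear_stat U -> linear_stat V ->
  linear_stat (fun x => U x + V x).
Proof.
move=> [n [a [t ->]]] [k [b [u ->]]].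
exists (n + k)%N, (fun j => match fintype.split j with inl i => a i | inr i => b i end),
  (fun j => match fintype.split j with inl i => t i | inr i => u i end).
apply/funext => x; rewrite big_split_ord /=; congr (_ + _); apply: eq_bigr => i _.
  by rewrite (unsplitK (inl i : 'I_n + 'I_k)).
by rewrite (unsplitK (inr i : 'I_n + 'I_k)).
Qed.

Lemma linear_statZ c U : linear_stat U -> linear_stat (fun x => c * U x).
Proof.
move=> [n [a [t ->]]]; exists n, (fun j => c * a j), t; apply/funext => x.
by rewrite mulr_sumr; apply: eq_bigr => j _; rewrite mulrA.
Qed.

Lemma linear_stat_sub U V : linear_stat U -> linear_stat V ->
  linear_stat (fun x => U x - V x).
Proof.
move=> hU hV; have := linear_stat_add hU (linear_statZ (-1) hV).
by congr linear_stat; apply/funext => x; rewrite mulN1r.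
Qed.

Lemma linear_stat_coord g : linear_stat (coord g).
Proof.
exists 1%N, (fun=> 1), (fun=> g); apply/funext => x.
by rewrite big_ord_recl big_ord0 addr0 mul1r.
Qed.

Lemma measurable_linear_stat U : linear_stat U -> measurable_fun setT U.
Proof.
move=> [n [a [t ->]]]; apply: measurable_sum => j.
by apply: measurable_funM; [exact: measurable_cst|exact: mcoord].
Qed.

Lemma bounded_mfun_cos U : linear_stat U -> bounded_mfun (fun x => cos (U x)).
Proof. by move=> /measurable_linear_stat; exact: bounded_mfun_cos_comp. Qed.

Lemma bounded_mfun_sin U : linear_stat U -> bounded_mfun (fun x => sin (U x)).
Proof.
move=> hU; split; last by exists 1 => x; exact: sin_max.
apply: measurableT_comp; last exact: measurable_linear_stat.
by apply: continuous_measurable_fun; exact: continuous_sin.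
Qed.

(** The signed measure of density [chi * Z] has zero Fourier transform. *)
Definition trig_orthogonal Z := bounded_mfun Z /\ forall U, linear_stat U ->
  E (fun x => chi x * Z x * cos (U x)) = 0 /\ E (fun x => chi x * Z x * sin (U x)) = 0.

(** Multipliers form an algebra closed under bounded pointwise limits; it
    contains all characters, hence all indicators of events generated by the
    coordinates. Applied to [Z = 1], this is the uniqueness theorem for Fourier
    transforms, obtained without inversion and in any number of coordinates. *)
Definition multiplier s := bounded_mfun s /\
  forall Z, trig_orthogonal Z -> trig_orthogonal (fun x => Z x * s x).

Lemma trig_orthogonalD Z1 Z2 : trig_orthogonal Z1 -> trig_orthogonal Z2 ->
  trig_orthogonal (fun x => Z1 x + Z2 x).
Proof.
move=> [b1 h1] [b2 h2]; split; first exact: bounded_mfunD.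
move=> U hU; have [c1 s1] := h1 U hU; have [c2 s2] := h2 U hU.
have bc := bounded_mfun_cos hU; have bs := bounded_mfun_sin hU.
have key (w : T -> R) : bounded_mfun w -> E (fun x => chi x * (Z1 x + Z2 x) * w x) =
    E (fun x => chi x * Z1 x * w x) + E (fun x => chi x * Z2 x * w x).
  move=> bw; rewrite -expectD; [|by do 2 apply: bounded_mfunM => //..].
  by apply: eq_Rintegral => x _; lra.
by split; rewrite key // ?c1 ?c2 ?s1 ?s2 addr0.
Qed.

Lemma trig_orthogonalZ c Z : trig_orthogonal Z -> trig_orthogonal (fun x => c * Z x).
Proof.
move=> [b1 h1]; split; first exact: bounded_mfunZ.
move=> U hU; have [c1 s1] := h1 U hU.
have bc := bounded_mfun_cos hU; have bs := bounded_mfun_sin hU.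
have key (w : T -> R) : bounded_mfun w -> E (fun x => chi x * (c * Z x) * w x) =
    c * E (fun x => chi x * Z x * w x).
  move=> bw; rewrite -expectZ; last by do 2 apply: bounded_mfunM => //.
  by apply: eq_Rintegral => x _; lra.
by split; rewrite key // ?c1 ?s1 mulr0.
Qed.

Lemma trig_orthogonal_eq Z1 Z2 : (forall x, Z1 x = Z2 x) ->
  trig_orthogonal Z1 -> trig_orthogonal Z2.
Proof. by move=> /funext ->. Qed.

Lemma multiplier_eq s1 s2 : (forall x, s1 x = s2 x) -> multiplier s1 -> multiplier s2.
Proof. by move=> /funext ->. Qed.

Lemma multiplier_cst c : multiplier (fun=> c).
Proof.
split; first exact: bounded_mfun_cst.
by move=> Z /(trig_orthogonalZ c); apply: trig_orthogonal_eq => x; rewrite mulrC.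
Qed.

Lemma multiplierD s1 s2 : multiplier s1 -> multiplier s2 ->
  multiplier (fun x => s1 x + s2 x).
Proof.
move=> [b1 h1] [b2 h2]; split; first exact: bounded_mfunD.
move=> Z hZ; have := trig_orthogonalD (h1 Z hZ) (h2 Z hZ).
by apply: trig_orthogonal_eq => x; rewrite mulrDr.
Qed.

Lemma multiplierM s1 s2 : multiplier s1 -> multiplier s2 ->
  multiplier (fun x => s1 x * s2 x).
Proof.
move=> [b1 h1] [b2 h2]; split; first exact: bounded_mfunM.
by move=> Z /h1/h2; apply: trig_orthogonal_eq => x; rewrite mulrA.
Qed.

Lemma multiplierZ c s : multiplier s -> multiplier (fun x => c * s x).
Proof. exact/multiplierM/multiplier_cst. Qed.

Lemma multiplierB s1 s2 : multiplier s1 -> multiplier s2 ->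
  multiplier (fun x => s1 x - s2 x).
Proof.
move=> h1 h2; have := multiplierD h1 (multiplierZ (-1) h2).
by apply: multiplier_eq => x; rewrite mulN1r.
Qed.

Lemma multiplier_cvg (s_ : nat -> T -> R) s M : (forall n, multiplier (s_ n)) ->
  (forall n x, `|s_ n x| <= M) -> (forall x, s_ ^~ x @ \oo --> s x) -> multiplier s.
Proof.
move=> hs sM cs.
have [bs _] : bounded_mfun s /\ E (s_ n) @[n --> \oo] --> E s.
  by apply: (@expect_cvg _ _ _ L s_ s M) => // n; exact: (hs n).1.1.
split => // Z hZ; split; first exact: bounded_mfunM hZ.1 bs.
have key (w : T -> R) : bounded_mfun w ->
    (forall n, E (fun x => chi x * (Z x * s_ n x) * w x) = 0) ->
    E (fun x => chi x * (Z x * s x) * w x) = 0.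
  move=> bw hn; have bchiZw : bounded_mfun (fun x => chi x * Z x * w x).
    by do 2 apply: bounded_mfunM => //; exact: hZ.1.
  have [_ [N hN]] := bchiZw.
  have [|||_ h] := @expect_cvg _ _ _ L (fun n x => chi x * Z x * w x * s_ n x)
      (fun x => chi x * Z x * w x * s x) (N * M).
  - move=> n; apply: measurable_funM; [exact: bchiZw.1|exact: (hs n).1.1].
  - by move=> n x; rewrite normrM; apply: ler_pM.
  - by move=> x; apply: cvgM; [exact: cvg_cst|exact: cs].
  transitivity (E (fun x => chi x * Z x * w x * s x)).
    by apply: eq_Rintegral => x _; lra.
  have E0 n : E (fun x => chi x * Z x * w x * s_ n x) = 0.
    by rewrite -(hn n); apply: eq_Rintegral => x _; lra.
  move: h; under eq_fun do rewrite E0; move=> h.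
  by rewrite -(cvg_lim _ h) ?lim_cst.
move=> U hU; split; apply: key.
- exact: bounded_mfun_cos.
- by move=> n; have [] := ((hs n).2 Z hZ).2 U hU.
- exact: bounded_mfun_sin.
- by move=> n; have [] := ((hs n).2 Z hZ).2 U hU.
Qed.

(** By the addition formulas, products with a character only shift the
    frequencies. *)
Lemma multiplier_trig V : linear_stat V ->
  multiplier (fun x => cos (V x)) /\ multiplier (fun x => sin (V x)).
Proof.
move=> hV; have bVc := bounded_mfun_cos hV; have bVs := bounded_mfun_sin hV.
have half (f g : T -> R) Z : bounded_mfun Z -> bounded_mfun f -> bounded_mfun g ->
    forall a b : R, E (fun x => chi x * Z x * f x) = 0 -> E (fun x => chi x * Z x * g x) = 0 ->
    E (fun x => chi x * Z x * (a * f x + b * g x)) = 0.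
  move=> bZ bf bg a b hf hg.
  transitivity (E (fun x => a * (chi x * Z x * f x) + b * (chi x * Z x * g x))).
    by apply: eq_Rintegral => x _; lra.
  have b1 : bounded_mfun (fun x => chi x * Z x * f x) by do 2 apply: bounded_mfunM => //.
  have b2 : bounded_mfun (fun x => chi x * Z x * g x) by do 2 apply: bounded_mfunM => //.
  rewrite (expectD L (bounded_mfunZ a b1) (bounded_mfunZ b b2)).
  by rewrite (expectZ L _ b1) (expectZ L _ b2) hf hg !mulr0 addr0.
have trans (f g : T -> R) : (forall x, f x = g x) -> E f = 0 -> E g = 0.
  by move=> /funext ->.
split; split=> // Z [bZ hZ]; split; try exact: bounded_mfunM.
- move=> U hU; have [c1 s1] := hZ _ (linear_stat_add hU hV).
  have [c2 s2] := hZ _ (linear_stat_sub hU hV).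
  have bc1 := bounded_mfun_cos (linear_stat_add hU hV).
  have bs1 := bounded_mfun_sin (linear_stat_add hU hV).
  have bc2 := bounded_mfun_cos (linear_stat_sub hU hV).
  have bs2 := bounded_mfun_sin (linear_stat_sub hU hV).
  split.
    apply: trans (half _ _ _ bZ bc1 bc2 (1/2) (1/2) c1 c2) => x.
    by rewrite cosD cosB; lra.
  apply: trans (half _ _ _ bZ bs1 bs2 (1/2) (1/2) s1 s2) => x.
  by rewrite sinD sinB; lra.
- move=> U hU; have [c1 s1] := hZ _ (linear_stat_add hU hV).
  have [c2 s2] := hZ _ (linear_stat_sub hU hV).
  have bc1 := bounded_mfun_cos (linear_stat_add hU hV).
  have bs1 := bounded_mfun_sin (linear_stat_add hU hV).
  have bc2 := bounded_mfun_cos (linear_stat_sub hU hV).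
  have bs2 := bounded_mfun_sin (linear_stat_sub hU hV).
  split.
    apply: trans (half _ _ _ bZ bs1 bs2 (1/2) (-1/2) s1 s2) => x.
    by rewrite sinD sinB; lra.
  apply: trans (half _ _ _ bZ bc2 bc1 (1/2) (-1/2) c2 c1) => x.
  by rewrite cosB cosD; lra.
Qed.

(** [sin ((coord - t) / N)] has the sign of [coord - t] once [N] is large; the
    iterates of [smoothstep], being polynomials, turn it into an indicator without
    leaving the algebra. *)
Lemma multiplier_ray g (t : R) : multiplier (fun x => if t < coord g x then 1 else 0).
Proof.
pose p n x := (1 + sin ((coord g x - t) / n.+1%:R)) / 2.
have p01 n x : 0 <= p n x <= 1.
  have := sin_geN1 ((coord g x - t) / n.+1%:R).
  have := sin_le1 ((coord g x - t) / n.+1%:R); rewrite /p; lra.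
have mp n : multiplier (p n).
  have [hc hs] := multiplier_trig (linear_statZ n.+1%:R^-1 (linear_stat_coord g)).
  have h := multiplierB (multiplierZ (cos (t / n.+1%:R)) hs) (multiplierZ (sin (t / n.+1%:R)) hc).
  have := multiplierZ (1 / 2) (multiplierD (multiplier_cst 1) h).
  apply: multiplier_eq => x; rewrite /p mulrBl sinB [coord g x / _]mulrC; lra.
have miter n k : multiplier (fun x => iter k smoothstep (p n x)).
  elim: k => [|k IH]; first exact: mp.
  have := multiplierM (multiplierM IH IH) (multiplierB (multiplier_cst 3) (multiplierZ 2 IH)).
  exact: multiplier_eq.
have iter1 n k x : `|iter k smoothstep (p n x)| <= 1.
  by have /andP[h0 h1] := iter_smoothstep_itv k (p01 n x); rewrite ger0_norm.
have mstep n : multiplier (fun x => unit_step (p n x)).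
  apply: (multiplier_cvg (miter n) (iter1 n)) => x.
  exact: iter_smoothstep_cvg.
have step1 y : `|unit_step y| <= 1 :> R.
  by rewrite /unit_step; do 2?case: ifP => _; rewrite ger0_norm //; lra.
have mu : multiplier (fun x => unit_step ((1 + Num.sg (coord g x - t)) / 2)).
  apply: (multiplier_cvg mstep (M := 1)) => [n x|x]; first exact: step1.
  exact: unit_step_sin.
have := multiplierM mu (multiplierB (multiplierZ 2 mu) (multiplier_cst 1)).
by apply: multiplier_eq => x; rewrite unit_step_gt0 subr_gt0.
Qed.

(** Events whose indicator is a multiplier form a sigma-algebra. *)
Lemma multiplier_generated (A : set T) :
  <<s [set A | exists (g : G) (B : set R), measurable B /\ A = coord g @^-1` B] >> A ->
  measurable A /\ multiplier (\1_A).
Proof.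
pose good (A : set T) := measurable A /\ multiplier (\1_A).
have good0 : good set0.
  split => //; apply: multiplier_eq (multiplier_cst 0) => x.
  by rewrite indic0.
have goodC (B : set T) : good B -> good (~` B).
  move=> [mB hB]; split; first exact: measurableC.
  apply: multiplier_eq (multiplierB (multiplier_cst 1) hB) => x.
  by rewrite !indicE in_setC; case: (_ \in _); rewrite /= ?subr0 ?subrr.
have goodI (B C : set T) : good B -> good C -> good (B `&` C).
  move=> [mB hB] [mC hC]; split; first exact: measurableI.
  apply: multiplier_eq (multiplierM hB hC) => x.
  by rewrite !indicE in_setI; do 2 case: (_ \in _); rewrite /= ?mulr1 ?mulr0.
have goodU (F : nat -> set T) : (forall n, good (F n)) -> good (\bigcup_n F n).
  move=> hF; pose H n := ~` \bigcap_(k in `I_n) ~` F k.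
  have HE n : H n = \bigcup_(k in `I_n) F k 
    by rewrite /H setC_bigcap; apply: eq_bigcupr => k _; rewrite setCK.
  have gI n : good (\bigcap_(k in `I_n) ~` F k).
    elim: n => [|n IH].
      by rewrite II0 bigcap_set0 -setC0; exact: goodC.
    by rewrite IIS bigcap_setU bigcap_set1; apply: goodI => //; exact: goodC.
  have gH n : good (H n) by exact: goodC.
  split; first by apply: bigcup_measurable => n _; exact: (hF n).1.
  apply: (@multiplier_cvg (fun n => \1_(H n)) _ 1) => [n|n x|x].
  - exact: (gH n).2.
  - by rewrite indicE; case: (_ \in _); rewrite ?normr1 ?normr0.
  - apply: cvg_near_cst; rewrite /=.
  have [[k _ Fk]|nF] := pselect ((\bigcup_n F n) x).
    exists k.+1 => // n /= kn; rewrite !indicE !mem_set //; first by exists k.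
    by rewrite HE; exists k.
  exists 0%N => // n _ /=; rewrite !indicE !memNset // HE => -[k _ Fk].
  by apply: nF; exists k.
move: A; apply: (@smallest_sub _ _ _ good); first split => //.
- by move=> B hB; rewrite setTD; exact: goodC.
move=> _ [g [B [mB ->]]].
suff : (@measurable _ R) `<=` [set B | good (coord g @^-1` B)] by apply.
have -> : @measurable _ R = <<s @RGenOInfty.G R >> by exact: RGenOInfty.measurableE.
apply: smallest_sub; first split => /=.
- by rewrite preimage_set0.
- by move=> C hC; rewrite setTD preimage_setC; exact: goodC.
- by move=> F hF; rewrite preimage_bigcup; exact: goodU.
move=> _ [t ->] /=; split.
  rewrite -[X in measurable X]setTI; apply: mcoord => //.
apply: multiplier_eq (multiplier_ray g t) => x.
rewrite indicE; case: ifPn => h; first by rewrite mem_set //= in_itv /= h.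
by rewrite memNset //= in_itv /= andbT; apply/negP.
Qed.

End multipliers.

Section path_space.
Context {R : realType} {G : groupType}.
Context {d : measure_display} {Omega : measurableType d}.
Context (P : probability Omega R) (Y : G -> {RV P >-> R}).
Local Notation E f := (\int[P]_w f w)%R.

Definition cylinders : set (set (G -> R)) :=
  [set A | exists (g : G) (B : set R), measurable B /\ A = (fun y => y g) @^-1` B].

Local Notation path := (g_sigma_algebraType cylinders).

Definition sample (w : Omega) : path := fun g => Y g w.

Lemma measurable_coord (g : G) : measurable_fun setT (fun y : path => y g : R).
Proof.
move=> _ B mB; rewrite setTI; apply: sub_sigma_algebra; exists g, B; split => //.
Qed.

Lemma measurable_to_path d' (T : measurableType d') (F : T -> path) :
  (forall g, measurable_fun setT (fun x => F x g : R)) -> measurable_fun setT F.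
Proof.
move=> mF; apply: (@measurability _ _ _ _ _ F cylinders) => // _ [_ [g [B [mB ->]]] <-].
exact: mF.
Qed.

Lemma measurable_sample : measurable_fun setT sample.
Proof. by apply: measurable_to_path => g; exact: measurable_funP. Qed.

HB.instance Definition _ := isMeasurableFun.Build _ _ _ _ sample measurable_sample.

Lemma expect_sample (f : path -> R) : bounded_mfun f ->
  (\int[distribution P sample]_y f y)%R = E (fun w => f (sample w)).
Proof.
move=> [mf [M fM]]; rewrite /Rintegral; congr fine; rewrite /distribution.
rewrite (integral_pushforward measurable_sample) //=.
  by apply/measurable_EFinP.
apply: (@bounded_mfun_integrable _ _ _ P (fun w => f (sample w))); split.
  exact: measurableT_comp mf measurable_sample.
by exists M => x; exact: fM.
Qed.

(** By [invariant_decorrelated] the indicator of an invariant event is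
    uncorrelated with all characters, hence by [multiplier_generated] with all
    events generated by the coordinates, itself included. *)
Lemma decorrelated_ergodic : infinite_set [set: G] -> stationary_field Y ->
  (forall (trig : R -> R), trig = cos \/ trig = sin ->
   forall (n : nat) (a : 'I_n -> R) (t : 'I_n -> G) (e : R), 0 < e ->
   finite_set [set h | e <= `|E (fun w => trig (\sum_(j < n) a j * Y (t j) w) *
       trig (\sum_(j < n) a j * Y (h * t j)%g w)) -
     E (fun w => trig (\sum_(j < n) a j * Y (t j) w)) ^+ 2|]) ->
  ergodic_field Y.
Proof.
move=> infG stat dec A cA Ainv.
pose L : probability path R := distribution P sample.
have LE (B : set path) : L B = field_law Y B by [].
pose tau (h : G) (y : path) : path := left_shift h y.
have mA : measurable (A : set path) by [].
have mtau h : measurable_fun setT (tau h).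
  by apply: measurable_to_path => g; exact: measurable_coord.
have tauM h k x : tau h (tau k x) = tau (k * h)%g x.
  by apply/funext => g; rewrite /tau /left_shift mulgA.
have tauL h (B : set path) : measurable B -> L (tau h @^-1` B) = L B.
  by move=> mB; rewrite !LE; exact: stat.
pose c := fine (L A).
pose chi (y : path) : R := \1_A y - c.
have bA : bounded_mfun (\1_A : path -> R) by exact: bounded_mfun_indic.
have bchi : bounded_mfun chi by apply: bounded_mfunD => //; exact: bounded_mfun_cst.
pose coord g (y : path) : R := y g.
have key (trig : R -> R) : trig = cos \/ trig = sin -> forall U, linear_stat coord U ->
    \int[L]_y (chi y * 1 * trig (U y)) = 0.
  move=> htrig U hU.
  have bU : bounded_mfun (fun y => trig (U y)).
    by case: htrig => ->; [apply: bounded_mfun_cos hU|apply: bounded_mfun_sin hU] => g;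
       exact: measurable_coord.
  have U1 y : `|trig (U y)| <= 1 by case: htrig => ->; [exact: cos_max|exact: sin_max].
  transitivity (\int[L]_y (\1_A y * trig (U y) + - c * trig (U y))).
    by apply: eq_Rintegral => y _; rewrite /chi; lra.
  rewrite (expectD L (bounded_mfunM bA bU) (bounded_mfunZ (- c) bU)) (expectZ L _ bU).
  rewrite (@invariant_decorrelated _ path R L G tau infG mtau tauM tauL A) //.
    by rewrite -/c; lra.
  move=> e e0; have [n [a [t UE]]] := hU.
  apply: sub_finite_set (dec _ htrig n a t e e0) => h /=.
  rewrite !expect_sample //; last exact: bounded_mfunM bU (bounded_mfun_comp mtau h bU).
  by rewrite UE.
have ort1 : trig_orthogonal L coord chi (fun=> 1).
  split; first exact: bounded_mfun_cst.
  by move=> U hU; split; apply: key => //; [left|right].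
have mcoord g : measurable_fun setT (coord g) by exact: measurable_coord.
have [_ [_ mul]] := @multiplier_generated _ path R L G coord mcoord chi bchi A cA.
(* The zero frequency: the integral of [chi] against the indicator of [A] is
   [c - c^2]. *)
have [_ /(_ (fun=> 0))[]] := mul _ ort1.
  by exists 0%N, (fun=> 0), (fun=> 1%g); apply/funext => y; rewrite big_ord0.
have E1 : \int[L]_y (chi y * (1 * \1_A y) * cos 0) = c - c ^+ 2.
  transitivity (\int[L]_y ((1 - c) * \1_A y)).
    apply: eq_Rintegral => y _; rewrite /chi cos0 indicE.
    by case: (_ \in _) => /=; lra.
  by rewrite (expectZ L _ bA) expect_indic // -/c; lra.
rewrite E1 => hc _.
have : c * (1 - c) = 0 by move: hc; lra.
have LA : L A = c%:E by rewrite /c fineK // fin_num_measure.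
move/eqP; rewrite mulf_eq0 subr_eq0 => /orP[/eqP c0|/eqP c1]; [left|right];
  by rewrite -LE LA ?c0 -?c1.
Qed.

End path_space.

(** * Asymptotic additivity of the scale parameter *)

Section powR_additivity.
Context {R : realType}.
Variable alpha : R.
Hypothesis alpha_gt0 : 0 < alpha.
Implicit Types a b e : R.

Lemma ler_powRl a b : 0 <= a -> a <= b -> a `^ alpha <= b `^ alpha.
Proof.
move=> a0 ab; apply: ge0_ler_powR; rewrite ?nnegrE //; first exact: ltW.
exact: le_trans ab.
Qed.

(** If [|b| <= eta |a|] the two powers differ by a factor close to [1]; otherwise
    both are at most a multiple of [|b|^alpha]. *)
Lemma powR_perturb e : 0 < e -> exists2 K : R, 0 <= K & forall a b,
  `| `|a + b| `^ alpha - `|a| `^ alpha| <= e * `|a| `^ alpha + K * `|b| `^ alpha.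
Proof.
move=> e0; have ainv : 0 < alpha^-1 by rewrite invr_gt0.
have mono a b : 0 <= a -> a < b -> a `^ alpha^-1 < b `^ alpha^-1.
  move=> a0 ab; apply: gt0_ltr_powR => //; rewrite nnegrE //.
  exact: le_trans a0 (ltW ab).
have rootK a : 0 <= a -> (a `^ alpha^-1) `^ alpha = a.
  by move=> a0; rewrite -powRrM mulVf ?gt_eqF // powRr1.
have [e' [e'0 e'e e'h]] : exists e', [/\ 0 < e', e' <= e & e' < 1].
  exists (Num.min e (1 / 2)); split; first by rewrite lt_min e0; lra.
    by rewrite ge_min lexx.
  by rewrite gt_min; apply/orP; right; lra.
(* [up] and [lo] are the ratios [|a + b| / |a|] allowed by the error [e']. *)
have [up upK up1] : exists2 up : R, up `^ alpha = 1 + e' & 1 < up.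
  exists ((1 + e') `^ alpha^-1); first by apply: rootK; lra.
  by rewrite -[ltLHS](congr1 (@^~ alpha^-1) (powR1 R)); apply: mono; lra.
have [lo [loK lo0 lo1]] : exists lo : R, [/\ lo `^ alpha = 1 - e', 0 <= lo & lo < 1].
  exists ((1 - e') `^ alpha^-1); split; [by apply: rootK; lra|exact: powR_ge0|].
  by rewrite -[ltRHS](congr1 (@^~ alpha^-1) (powR1 R)); apply: mono; lra.
have [eta [eta0 etau etal]] : exists eta, [/\ 0 < eta, eta <= up - 1 & eta <= 1 - lo].
  exists (Num.min (up - 1) (1 - lo)); rewrite lt_min !ge_min !lexx orbT; split => //.
  by apply/andP; split; lra.
have [k k0 kE] : exists2 k, 0 <= k & k = 1 + eta^-1.
  by exists (1 + eta^-1) => //; rewrite addr_ge0 // invr_ge0 ltW.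
exists (k `^ alpha); first exact: powR_ge0.
move=> a b; have a0 := normr_ge0 a; have b0 := normr_ge0 b.
have tri1 := ler_normD a b.
have tri2 : `|a| <= `|a + b| + `|b|.
  by have := ler_normB (a + b) b; rewrite addrK.
have pa := powR_ge0 `|a| alpha; have pb := powR_ge0 `|b| alpha.
have [ba|ba] := lerP `|b| (eta * `|a|).
  have hu : `|a + b| <= up * `|a|.
    have h : 0 <= (up - 1 - eta) * `|a| by rewrite mulr_ge0 //; lra.
    by lra.
  have hl : lo * `|a| <= `|a + b|.
    have h : 0 <= (1 - lo - eta) * `|a| by rewrite mulr_ge0 //; lra.
    by lra.
  have := ler_powRl (normr_ge0 _) hu; rewrite powRM // ?upK; last lra.
  have := ler_powRl (mulr_ge0 lo0 a0) hl; rewrite powRM // ?loK => h1 h2.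
  have pk := mulr_ge0 (powR_ge0 k alpha) pb.
  have h : 0 <= (e - e') * `|a| `^ alpha by rewrite mulr_ge0 //; lra.
  by rewrite ler_norml; apply/andP; split; lra.
have ha : `|a| <= eta^-1 * `|b| by rewrite -ler_pdivrMl ?invr_gt0 // invrK ltW.
have hk : `|a| <= k * `|b| by rewrite kE; lra.
have hk' : `|a + b| <= k * `|b| by rewrite kE; lra.
have := ler_powRl a0 hk; have := ler_powRl (normr_ge0 _) hk'.
rewrite powRM // => h1 h2; have pab := powR_ge0 `|a + b| alpha.
have pe := mulr_ge0 (ltW e0) pa.
by rewrite ler_norml; apply/andP; split; lra.
Qed.

(** The symmetric form of the previous estimate: apply it to the larger of the
    two terms. *)
Lemma powR_almost_additive e : 0 < e -> exists2 K : R, 0 <= K & forall a b,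
  `| `|a + b| `^ alpha - (`|a| `^ alpha + `|b| `^ alpha)| <=
    e * (`|a| `^ alpha + `|b| `^ alpha) + K * Num.min (`|a| `^ alpha) (`|b| `^ alpha).
Proof.
move=> e0; have [K K0 hK] := powR_perturb e0.
exists (K + 1); first by rewrite addr_ge0.
suff wl a b : `|b| `^ alpha <= `|a| `^ alpha ->
    `| `|a + b| `^ alpha - (`|a| `^ alpha + `|b| `^ alpha)| <=
    e * (`|a| `^ alpha + `|b| `^ alpha) + (K + 1) * `|b| `^ alpha.
  move=> a b; rewrite minEle; case: ifP => [ab|/negbT]; last first.
    by rewrite -ltNge => /ltW; exact: wl.
  by have := wl b a ab; rewrite (addrC b a) (addrC (`|b| `^ alpha)).
move=> ba; have := hK a b; have pb := powR_ge0 `|b| alpha.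
have pe := mulr_ge0 (ltW e0) pb; rewrite !ler_norml => /andP[h1 h2].
by apply/andP; split; lra.
Qed.

End powR_additivity.

Lemma window_le1 (R : realType) (e I : R) : 0 <= e -> 0 <= I ->
  e / (4 * (I + 1)) * (2 * I) <= e / 2.
Proof.
move=> e0 I0; have I1 : 0 < I + 1 by lra.
rewrite mulrAC ler_pdivrMr ?mulr_gt0 //.
by have := mulr_ge0 e0 I0; lra.
Qed.

Lemma window_le2 (R : realType) (e K : R) : 0 <= e -> 0 <= K ->
  K * (e / (4 * (K + 1))) <= e / 4.
Proof.
move=> e0 K0; have K1 : 0 < K + 1 by lra.
rewrite mulrA ler_pdivrMr ?mulr_gt0 //.
by have := mulr_ge0 e0 K0; lra.
Qed.

Section asymptotic_additivity.
Context {d} {T : measurableType d} {R : realType} (m : {measure set T -> \bar R}).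
Context {G : Type} (phi : G -> T -> T).
Hypothesis mphi : forall h, measurable_fun setT (phi h).
Hypothesis phi_inv : forall h (A : set T), measurable A -> m (phi h @^-1` A) = m A.
Hypothesis mixing : forall (B : set T) (e : R), measurable B -> (m B < +oo)%E -> 0 < e ->
  finite_set [set h | (e%:E <= m (B `&` phi h @^-1` B))%E].
Implicit Types (H : T -> R) (h : G).

Lemma ge0_integral_phi h (k : T -> \bar R) : measurable_fun setT k ->
  (forall z, 0 <= k z)%E -> (\int[m]_z k (phi h z) = \int[m]_z k z)%E.
Proof.
move=> mk k0; transitivity (\int[pushforward m (phi h)]_z k z)%E.
  by rewrite (ge0_integral_pushforward (mphi h)) // => z _; exact: k0.
by apply: eq_measure_integral => A mA _; exact: phi_inv.
Qed.

(** Mixing for functions: [H] is, up to a small integral, bounded and supported on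
    a set [B n] of finite measure, and the minimum is then at most a constant on
    the intersection of [B n] with its translate. *)
Lemma integral_min_vanish H e : measurable_fun setT H -> (forall z, 0 <= H z) ->
  (\int[m]_z (H z)%:E < +oo)%E -> 0 < e ->
  finite_set [set h | (e%:E <= \int[m]_z (Num.min (H z) (H (phi h z)))%:E)%E].
Proof.
move=> mH H0 Hoo e0.
have iH : m.-integrable setT (EFin \o H).
  apply/integrableP; split; first exact/measurable_EFinP.
  by under eq_integral do rewrite /= ger0_norm //.
pose B (n : nat) : set T := [set z | n.+1%:R^-1 <= H z <= n.+1%:R].
have mB n : measurable (B n).
  rewrite (_ : B n = H @^-1` `[n.+1%:R^-1, n.+1%:R]%classic); last first.
    by apply/seteqP; split => z /=; rewrite in_itv.
  by rewrite -[X in measurable X]setTI; exact: mH.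
have mBC n : measurable (~` B n) by exact: measurableC.
pose Q n z : R := H z * \1_(~` B n) z.
have mQ n : measurable_fun setT (Q n).
  by apply: measurable_funM => //; exact: measurable_indic.
have Q0 n z : 0 <= Q n z by rewrite mulr_ge0 // indicE.
have [n hn] : exists n, (\int[m]_z (Q n z)%:E < (e / 4)%:E)%E.
  have [|||||_ _ cv] := @dominated_convergence _ T R m setT measurableT
    (fun n z => (Q n z)%:E) (fun=> 0%E) (EFin \o H).
  - by move=> n; exact/measurable_EFinP.
  - exact: measurable_cst.
  - apply: aeW => z _; apply: cvg_near_cst.
    have [Hz|Hz] := leP (H z) 0.
      by apply: nearW => n; rewrite /Q (_ : H z = 0) ?mul0r //; apply/eqP; rewrite eq_le Hz H0.
    exists (maxn (Num.bound (H z)) (Num.bound (H z)^-1)) => // n /=.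
    rewrite geq_max => /andP[n1 n2]; rewrite /Q indicE memNset ?mulr0 // => nB; apply: nB.
    apply/andP; split; last first.
      by apply: le_trans (ltW (archi_boundP (ltW Hz))) _; rewrite ler_nat leqW.
    rewrite -[leRHS]invrK lef_pV2 ?posrE ?invr_gt0 ?ltr0n //.
    apply: le_trans (ltW (archi_boundP _)) _; first by rewrite invr_ge0 ltW.
    by rewrite ler_nat leqW.
  - exact: iH.
  - apply: aeW => z n _ /=; rewrite lee_fin ger0_norm // /Q indicE.
    by case: (_ \in _); rewrite ?mulr1 ?mulr0.
  apply: contrapT => hn; have : ((e / 4)%:E <= 0)%E.
    rewrite integral0 in cv; rewrite -(cvg_lim _ cv) //; apply: lime_ge.
      by apply/cvg_ex; exists 0%E.
    by apply: nearW => n; rewrite leNgt; apply/negP => h; apply: hn; exists n.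
  by rewrite lee_fin leNgt divr_gt0.
have N0 : 0 < (n.+1%:R : R) by rewrite ltr0n.
have mBoo : (m (B n) < +oo)%E.
  have : (n.+1%:R^-1%:E * m (B n) <= \int[m]_z (H z)%:E)%E.
    rewrite -(setIT (B n)) -integral_indic // -ge0_integralZl //=; last first.
      by apply/measurable_EFinP; exact: measurable_indic.
    apply: ge0_le_integral => //=.
    - apply: measurable_funeM; apply/measurable_EFinP; exact: measurable_indic.
    - exact/measurable_EFinP.
    - move=> z _; rewrite -EFinM lee_fin indicE; case: (boolP (z \in B n)) => [|_].
        by rewrite inE /= mulr1 => /andP[].
      by rewrite mulr0.
  move=> h; have := le_lt_trans h Hoo.
  by rewrite lte_pdivrMl // => /lt_le_trans; apply; rewrite leey.
pose e1 := e / (4 * n.+1%:R); have e1_gt0 : 0 < e1 by rewrite divr_gt0 // mulr_gt0.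
apply: sub_finite_set (mixing (mB n) mBoo e1_gt0) => h /= eh.
rewrite leNgt; apply/negP => hlt; move: eh; apply/negP; rewrite -ltNge.
have mBh : measurable (B n `&` phi h @^-1` B n).
  apply: measurableI => //; rewrite -[X in measurable X]setTI; exact: mphi.
have mQe : measurable_fun setT (fun z => (Q n z)%:E) by exact/measurable_EFinP.
have mQphi : measurable_fun setT (fun z => (Q n (phi h z))%:E).
  exact: (measurableT_comp mQe (mphi h)).
apply: (@le_lt_trans _ _ (\int[m]_z (n.+1%:R%:E * (\1_(B n `&` phi h @^-1` B n) z)%:E +
    ((Q n z)%:E + (Q n (phi h z))%:E)))%E).
  apply: ge0_le_integral => //=.
  - by move=> z _; rewrite lee_fin le_min !H0.
  - apply/measurable_EFinP; apply: measurable_minr => //.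
    exact: (measurableT_comp mH (mphi h)).
  - apply: emeasurable_funD; last exact: emeasurable_funD.
    by apply: measurable_funeM; apply/measurable_EFinP; exact: measurable_indic.
  - move=> z _; rewrite -EFinM -!EFinD lee_fin /Q !indicE in_setI !in_setC.
    have -> : (z \in phi h @^-1` B n) = (phi h z \in B n).
      by apply/idP/idP; rewrite !inE.
    have := H0 z; have := H0 (phi h z).
    case: (boolP (z \in B n)) => [|_]; last first.
      by rewrite /= !mulr0 !mulr1 add0r ge_min => a b; apply/orP; left; case: (_ \in _) => /=; lra.
    rewrite inE /B /= => /andP[_ Hn]; case: (boolP (phi h z \in _)) => _ /= a b;
      rewrite ge_min; apply/orP; [left|right]; lra.
have pos1 z : (0 <= n.+1%:R%:E * (\1_(B n `&` phi h @^-1` B n) z)%:E :> \bar R)%E.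
  by rewrite mule_ge0 // lee_fin // indicE.
rewrite ge0_integralD //=; last 3 first.
- apply: measurable_funeM; apply/measurable_EFinP; exact: measurable_indic.
- by move=> z _; rewrite adde_ge0 ?lee_fin.
- exact: emeasurable_funD.
rewrite (ge0_integralD _ _ _ mQe) //=; try by move=> z _; rewrite lee_fin.
have -> : (\int[m]_z (Q n (phi h z))%:E = \int[m]_z (Q n z)%:E)%E.
  by apply: (ge0_integral_phi h mQe) => z; rewrite lee_fin.
rewrite ge0_integralZl //=; last first.
  by apply/measurable_EFinP; exact: measurable_indic.
rewrite integral_indic // setIT.
apply: (@lt_trans _ _ ((e / 4)%:E + ((e / 4)%:E + (e / 4)%:E))%E); last first.
  by rewrite -!EFinD lte_fin; lra.
apply: lteD; last exact: lteD.
rewrite -lte_pdivlMl // -EFinM; move: hlt; rewrite /e1; congr (_ < _%:E)%E.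
by rewrite invfM mulrA [RHS]mulrC.
Qed.

(** [g h] has the absolute value of a translate of [F], so the integrals of the two
    [alpha]-th powers agree; the defect of additivity is controlled by the
    integral of their minimum, which vanishes at infinity. *)
Lemma scale_additive (alpha : R) (F : T -> R) (g : G -> T -> R) e : 0 < alpha ->
  measurable_fun setT F -> (\int[m]_z (`|F z| `^ alpha)%:E < +oo)%E ->
  (forall h, measurable_fun setT (g h)) ->
  (forall h, {ae m, forall z, `|g h z| = `|F (phi h z)|}) -> 0 < e ->
  finite_set [set h | e <= `|\int[m]_z (`|F z + g h z| `^ alpha) -
                             2 * \int[m]_z (`|F z| `^ alpha)|].
Proof.
move=> alpha0 mF Foo mg gF e0; pose H z := `|F z| `^ alpha.
have mpow (k : T -> R) : measurable_fun setT k -> measurable_fun setT (fun z => `|k z| `^ alpha).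
  move=> mk; apply: (measurableT_comp (measurable_powR alpha)).
  exact: measurableT_comp.
have mH : measurable_fun setT H by exact: mpow.
have H0 z : 0 <= H z by exact: powR_ge0.
have intble (k : T -> R) : measurable_fun setT k -> (forall z, 0 <= k z) ->
    (\int[m]_z (k z)%:E < +oo)%E -> m.-integrable setT (EFin \o k).
  move=> mk k0 koo; apply/integrableP; split; first exact/measurable_EFinP.
  by under eq_integral do rewrite /= ger0_norm //.
have iH := intble _ mH H0 Foo.
pose I := \int[m]_z H z; have I0 : 0 <= I by exact: Rintegral_ge0.
have e1_gt0 : 0 < e / (4 * (I + 1)) by rewrite divr_gt0 // mulr_gt0 //; lra.
have [K K0 hK] := powR_almost_additive alpha0 e1_gt0.
have e2_gt0 : 0 < e / (4 * (K + 1)) by rewrite divr_gt0 // mulr_gt0 //; lra.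
apply: sub_finite_set (integral_min_vanish mH H0 Foo e2_gt0) => h /= eh.
rewrite leNgt; apply/negP => hlt; move: eh; apply/negP; rewrite -ltNge.
pose V z := `|g h z| `^ alpha.
have mV : measurable_fun setT V by exact: mpow.
have V0 z : 0 <= V z by exact: powR_ge0.
have mHphi : measurable_fun setT (fun z => H (phi h z)) by exact: measurableT_comp.
have VH : {ae m, forall z, V z = H (phi h z)}.
  by apply: filterS (gF h) => z; rewrite /V /H => ->.
have VI : (\int[m]_z (V z)%:E = \int[m]_z (H z)%:E)%E.
  rewrite -(ge0_integral_phi h (k := EFin \o H)) //=; last first.
    exact/measurable_EFinP.
  apply: ge0_ae_eq_integral => //=.
  - exact/measurable_EFinP.
  - exact/measurable_EFinP.
  - by move=> z _; rewrite lee_fin V0.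
  - by move=> z _; rewrite lee_fin H0.
  - by apply: filterS VH => z E _ /=; rewrite E.
have iV : m.-integrable setT (EFin \o V) by apply: intble => //; rewrite VI.
pose M z := Num.min (H z) (V z).
have mM : measurable_fun setT M by exact: measurable_minr.
have M0 z : 0 <= M z by rewrite le_min H0 V0.
have Mlt : (\int[m]_z (M z)%:E < (e / (4 * (K + 1)))%:E)%E.
  apply: le_lt_trans hlt; rewrite le_eqVlt; apply/orP; left; apply/eqP.
  apply: ge0_ae_eq_integral => //=.
  - exact/measurable_EFinP.
  - by apply/measurable_EFinP; exact: measurable_minr.
  - by move=> z _; rewrite lee_fin M0.
  - by move=> z _; rewrite lee_fin le_min !H0.
  - by apply: filterS VH => z E _ /=; rewrite /M E.
have iM : m.-integrable setT (EFin \o M).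
  by apply: intble => //; apply: lt_trans Mlt _; exact: ltry.
pose W z := `|F z + g h z| `^ alpha.
have mW : measurable_fun setT W by apply: mpow; exact: measurable_funD.
have iHV : m.-integrable setT (EFin \o (fun z => H z + V z)).
  by have := integrableD measurableT iH iV; apply.
pose c := e / (4 * (I + 1)).
pose bound z := c * (H z + V z) + K * M z.
have iKM : m.-integrable setT (EFin \o (fun z => K * M z)).
  by have := integrableZl measurableT K iM; apply.
have icHV : m.-integrable setT (EFin \o (fun z => c * (H z + V z))).
  by have := integrableZl measurableT c iHV; apply.
have ibound : m.-integrable setT (EFin \o bound).
  by have := integrableD measurableT icHV iKM; apply.
pose Dz z := W z - (H z + V z).
have Dbound z : `|Dz z| <= bound z by exact: hK.
have iD : m.-integrable setT (EFin \o Dz).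
  apply: (le_integrable measurableT _ _ ibound).
    apply/measurable_EFinP; apply: measurable_funB => //; exact: measurable_funD.
  move=> z _ /=; rewrite lee_fin; apply: le_trans (Dbound z) _; exact: ler_norm.
have WE : \int[m]_z W z = \int[m]_z Dz z + \int[m]_z (H z + V z).
  rewrite -(RintegralD measurableT iD iHV); apply: eq_Rintegral => z _.
  by rewrite /Dz subrK.
have HVE : \int[m]_z (H z + V z) = 2 * I.
  rewrite (RintegralD measurableT iH iV) mulr_natl mulr2n; congr (_ + _).
  by rewrite /I /Rintegral VI.
have -> : \int[m]_z W z - 2 * \int[m]_z H z = \int[m]_z Dz z by rewrite WE HVE addrK.
apply: le_lt_trans (le_normr_Rintegral measurableT iD) _.
apply: (@le_lt_trans _ _ (\int[m]_z bound z)).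
  apply: le_Rintegral => //.
  apply: (le_integrable measurableT _ _ ibound).
    apply/measurable_EFinP; apply: measurableT_comp => //.
    by apply/measurable_EFinP; exact: measurable_int iD.
  move=> z _ /=; rewrite lee_fin normr_id.
  apply: le_trans (Dbound z) _; exact: ler_norm.
have -> : \int[m]_z bound z = c * (2 * I) + K * \int[m]_z M z.
  by rewrite (RintegralD measurableT icHV iKM) (RintegralZl c measurableT iHV) (RintegralZl K measurableT iM) HVE.
have hM : \int[m]_z M z < e / (4 * (K + 1)).
  by rewrite -lte_fin /Rintegral fineK //; exact: integrable_fin_num.
apply: le_lt_trans (lerD (window_le1 (ltW e0) I0) (_ : _ <= e / 4)) _.
  exact: le_trans (ler_wpM2l K0 (ltW hM)) (window_le2 (ltW e0) K0).
by rewrite [ltRHS](splitr e) ltrD2l (ltr_pM2l e0) ltf_pV2 ?posrE // ltr_nat.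
Qed.

End asymptotic_additivity.

(** * Characters of stable fields over a mixing action *)

Section powR_finite.
Context {d} {T : measurableType d} {R : realType} (m : {measure set T -> \bar R}).
Variable alpha : R.
Hypothesis alpha_gt0 : 0 < alpha.
Implicit Types F : T -> R.

(** Membership in the space L^alpha, spelled out because for [alpha < 1] there is
    no norm to refer to. *)
Definition finite_powR F := measurable_fun setT F /\
  (\int[m]_z (`|F z| `^ alpha)%:E < +oo)%E.

Lemma measurable_powR_norm F : measurable_fun setT F ->
  measurable_fun setT (fun z => (`|F z| `^ alpha)%:E).
Proof.
move=> mF; apply/measurable_EFinP; apply: (measurableT_comp (measurable_powR alpha)).
exact: measurableT_comp.
Qed.

Lemma finite_powRZ c F : finite_powR F -> finite_powR (fun z => c * F z).
Proof.
move=> [mF Foo]; split; first by apply: measurable_funM => //; exact: measurable_cst.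
under eq_integral do rewrite normrM powRM // EFinM.
rewrite ge0_integralZl //; last exact: measurable_powR_norm.
by rewrite lte_mul_pinfty // lee_fin powR_ge0.
Qed.

Lemma finite_powRD F1 F2 : finite_powR F1 -> finite_powR F2 ->
  finite_powR (fun z => F1 z + F2 z).
Proof.
move=> [m1 oo1] [m2 oo2]; have mD : measurable_fun setT (fun z => F1 z + F2 z).
  exact: measurable_funD.
split; first exact: mD.
have [K K0 hK] := powR_perturb alpha_gt0 (@ltr01 R).
have p1 := measurable_powR_norm m1; have p2 := measurable_powR_norm m2.
apply: (@le_lt_trans _ _ (\int[m]_z (2%:E * (`|F1 z| `^ alpha)%:E + K%:E * (`|F2 z| `^ alpha)%:E))%E).
  apply: ge0_le_integral => //=.
  - exact: measurable_powR_norm.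
  - by apply: emeasurable_funD; exact: measurable_funeM.
  - move=> z _; rewrite -!EFinM -EFinD lee_fin.
    have := hK (F1 z) (F2 z); rewrite ler_norml => /andP[_]; lra.
rewrite ge0_integralD //; try exact: measurable_funeM; last first.
  by move=> z _; rewrite mule_ge0 // lee_fin.
rewrite !ge0_integralZl //.
apply: lte_add_pinfty; apply: lte_mul_pinfty; rewrite ?lee_fin ?ler0n //; exact: ltW.
Qed.

Lemma finite_powR_sum n (F : 'I_n -> T -> R) : (forall j, finite_powR (F j)) ->
  finite_powR (fun z => \sum_(j < n) F j z).
Proof.
move=> hF; elim: n F hF => [|n IH] F hF.
  split; first by under eq_fun do rewrite big_ord0; exact: measurable_cst.
  under eq_integral do rewrite big_ord0 normr0 powR0 ?gt_eqF //.
  by rewrite integral0 ltry.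
under eq_fun do rewrite big_ord_recr /=.
by apply: finite_powRD; [exact: IH|exact: hF].
Qed.

End powR_finite.

Lemma expRN_lipschitz (R : realType) (x y : R) : 0 <= x -> 0 <= y ->
  `|expR (- x) - expR (- y)| <= `|x - y|.
Proof.
suff wl (a b : R) : 0 <= a -> a <= b -> expR (- a) - expR (- b) <= b - a.
  move=> x0 y0; have [xy|yx] := lerP x y.
    rewrite ger0_norm; last by rewrite subr_ge0 ler_expR lerN2.
    exact: wl.
  rewrite distrC ger0_norm; last by rewrite subr_ge0 ler_expR lerN2 ltW.
  by apply: wl => //; exact: ltW.
move=> a0 ab; have := expR_ge1Dx (a - b).
have -> : expR (- b) = expR (- a) * expR (a - b).
  by rewrite -expRD; congr expR; lra.
have a1 : expR (- a) <= 1 by rewrite -expR0 ler_expR oppr_le0.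
have ea := expR_ge0 (- a); move: (expR (- a)) (expR (a - b)) a1 ea => p q p1 p0 hq.
have h1 := mulr_ge0 p0 (_ : 0 <= q - (1 + (a - b))).
have h2 : 0 <= (1 - p) * (b - a) by rewrite mulr_ge0 // subr_ge0.
by have := h1 _; lra.
Qed.

Lemma le_half_sum (R : realType) (e x y : R) : e <= (x + y) / 2 -> e <= x \/ e <= y.
Proof.
move=> h; have [ex|xe] := leP e x.
  - by left.
  - by right; move: h; rewrite ler_pdivlMr // => h; lra.
Qed.

Lemma cosM (R : realType) (p q : R) :
  cos p * cos q = 1 / 2 * cos (p + 1 * q) + 1 / 2 * cos (p + -1 * q).
Proof. by rewrite (mul1r q) mulN1r cosB cosD; lra. Qed.

Lemma sinM (R : realType) (p q : R) :
  sin p * sin q = - (1 / 2) * cos (p + 1 * q) + 1 / 2 * cos (p + -1 * q).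
Proof. by rewrite (mul1r q) mulN1r cosB cosD; lra. Qed.

Section characters.
Context {d} {Omega : measurableType d} {R : realType} (P : probability Omega R).
Local Notation E f := (\int[P]_w f w)%R.

(** Products of sines and cosines are averages of the characters of [U + V] and
    [U - V], and [exp] is Lipschitz on negative exponents. *)
Lemma character_correlation (U V : Omega -> R) (I J1 J2 : R) (trig : R -> R) :
  measurable_fun setT U -> measurable_fun setT V -> 0 <= I -> 0 <= J1 -> 0 <= J2 ->
  E (fun x => cos (U x)) = expR (- I) -> E (fun x => sin (U x)) = 0 ->
  E (fun x => cos (U x + 1 * V x)) = expR (- J1) ->
  E (fun x => cos (U x + -1 * V x)) = expR (- J2) ->
  trig = cos \/ trig = sin ->
  `|E (fun x => trig (U x) * trig (V x)) - E (fun x => trig (U x)) ^+ 2| <=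
    (`|J1 - 2 * I| + `|J2 - 2 * I|) / 2.
Proof.
move=> mU mV I0 J10 J20 EU0 EU1 E1 E2 htrig.
have bcos s : bounded_mfun (fun x => cos (U x + s * V x)).
  apply: bounded_mfun_cos_comp; apply: measurable_funD => //.
  by apply: measurable_funM => //; exact: measurable_cst.
have expN2 : expR (- I) ^+ 2 = expR (- (2 * I)).
  by rewrite expr2 -expRD; congr expR; lra.
have lin (p q : R) : E (fun x => p * cos (U x + 1 * V x) + q * cos (U x + -1 * V x)) =
    p * expR (- J1) + q * expR (- J2).
  rewrite (expectD P (bounded_mfunZ p (bcos 1)) (bounded_mfunZ q (bcos (-1)))).
  by rewrite (expectZ P _ (bcos 1)) (expectZ P _ (bcos (-1))) E1 E2.
have I20 : 0 <= 2 * I by rewrite mulr_ge0.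
have l1 := expRN_lipschitz J10 I20; have l2 := expRN_lipschitz J20 I20.
have half (x y : R) : `|(x + y) / 2| <= (`|x| + `|y|) / 2.
  by rewrite normrM [X in _ * X]ger0_norm ?invr_ge0 // ler_pM2r ?invr_gt0 // ler_normD.
case: htrig => ->.
  rewrite EU0 expN2.
  have -> : E (fun x => cos (U x) * cos (V x)) = 1 / 2 * expR (- J1) + 1 / 2 * expR (- J2).
    by rewrite -lin; apply: eq_Rintegral => x _; exact: cosM.
  have -> : 1 / 2 * expR (- J1) + 1 / 2 * expR (- J2) - expR (- (2 * I)) =
    ((expR (- J1) - expR (- (2 * I))) + (expR (- J2) - expR (- (2 * I)))) / 2 by lra.
  apply: le_trans (half _ _) _; rewrite ler_pM2r ?invr_gt0 //; exact: lerD.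
rewrite EU1 expr2 mul0r subr0.
have -> : E (fun x => sin (U x) * sin (V x)) = - (1 / 2) * expR (- J1) + 1 / 2 * expR (- J2).
  by rewrite -lin; apply: eq_Rintegral => x _; exact: sinM.
have -> : - (1 / 2) * expR (- J1) + 1 / 2 * expR (- J2) =
  (- (expR (- J1) - expR (- (2 * I))) + (expR (- J2) - expR (- (2 * I)))) / 2 by lra.
apply: le_trans (half _ _) _; rewrite normrN ler_pM2r ?invr_gt0 //; exact: lerD.
Qed.

End characters.

Section stable_characters.
Context {d} {T : measurableType d} {R : realType} (m : {measure set T -> \bar R}).
Context {G : groupType} (phi : G -> T -> T).
Hypothesis mphi : forall h, measurable_fun setT (phi h).
Hypothesis phi_inv : forall h (A : set T), measurable A -> m (phi h @^-1` A) = m A.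
Hypothesis mixing : forall (B : set T) (e : R), measurable B -> (m B < +oo)%E -> 0 < e ->
  finite_set [set h | (e%:E <= m (B `&` phi h @^-1` B))%E].
Variable alpha : R.
Hypothesis alpha_gt0 : 0 < alpha.

Lemma finite_powR_phi h (f g : T -> R) : finite_powR m alpha f -> measurable_fun setT g ->
  {ae m, forall z, `|g z| = `|f (phi h z)|} -> finite_powR m alpha g.
Proof.
move=> [mf foo] mg gf; split => //; have mpf := measurable_powR_norm alpha mf.
rewrite -(ge0_integral_phi mphi phi_inv h mpf) in foo; last first.
  by move=> z; rewrite lee_fin powR_ge0.
apply: le_lt_trans foo; rewrite le_eqVlt; apply/orP; left; apply/eqP.
apply: ge0_ae_eq_integral => //.
- exact: measurable_powR_norm.
- exact: (measurableT_comp mpf (mphi h)).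
- by apply: filterS gf => z E _; rewrite E.
Qed.

Variables (f : G -> T -> R) (c : G -> T -> R).
Hypothesis ffin : forall g, finite_powR m alpha (f g).
Hypothesis c1 : forall h z, `|c h z| = 1.
Hypothesis fc : forall h g, {ae m, forall z, f (h * g)%g z = c h z * f g (phi h z)}.

Context {d' : measure_display} {Omega : measurableType d'}.
Context (P : probability Omega R) (Y : G -> {RV P >-> R}).
Local Notation E f := (\int[P]_w f w)%R.
Hypothesis char_cos : forall k (b : 'I_k -> R) (u : 'I_k -> G),
  E (fun x => cos (\sum_(j < k) b j * Y (u j) x)) =
    expR (- \int[m]_z (`|\sum_(j < k) b j * f (u j) z| `^ alpha)).
Hypothesis char_sin : forall k (b : 'I_k -> R) (u : 'I_k -> G),
  E (fun x => sin (\sum_(j < k) b j * Y (u j) x)) = 0.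

(** By [character_correlation] it suffices that the scale of the sum, and of the
    difference, of a linear statistic and a far translate of it is almost the
    sum of their scales; this is [scale_additive]. The multiplier [c] has modulus
    one and disappears from the scales. *)
Lemma stable_decorrelated (trig : R -> R) : trig = cos \/ trig = sin ->
  forall (n : nat) (a : 'I_n -> R) (t : 'I_n -> G) (e : R), 0 < e ->
  finite_set [set h | e <= `|E (fun w => trig (\sum_(j < n) a j * Y (t j) w) *
       trig (\sum_(j < n) a j * Y (h * t j)%g w)) -
     E (fun w => trig (\sum_(j < n) a j * Y (t j) w)) ^+ 2|].
Proof.
move=> htrig n a t e e0.
pose F z := \sum_(j < n) a j * f (t j) z.
pose W h z := \sum_(j < n) a j * f (h * t j)%g z.
have Foo : finite_powR m alpha F.
  by apply: finite_powR_sum => // j; exact: finite_powRZ.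
have mW h : measurable_fun setT (W h).
  apply: measurable_sum => j; apply: measurable_funM; first exact: measurable_cst.
  exact: (ffin _).1.
have WF h : {ae m, forall z, `|W h z| = `|F (phi h z)|}.
  have : {ae m, forall z, forall j : 'I_n, f (h * t j)%g z = c h z * f (t j) (phi h z)}.
    by apply: filter_forall => j; exact: fc.
  apply: filterS => z hz; rewrite -[RHS]mul1r -(c1 h z) -normrM; congr (`|_|).
  rewrite /W /F mulr_sumr; apply: eq_bigr => j _.
  by rewrite hz mulrCA.
pose I := \int[m]_z (`|F z| `^ alpha).
pose J s h := \int[m]_z (`|F z + s * W h z| `^ alpha).
have I0 : 0 <= I by apply: Rintegral_ge0 => z _; exact: powR_ge0.
have J0 s h : 0 <= J s h by apply: Rintegral_ge0 => z _; exact: powR_ge0.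
have bad s : `|s| = 1 -> finite_set [set h | e <= `|J s h - 2 * I|].
  move=> s1; apply: (scale_additive mphi phi_inv mixing alpha_gt0 Foo.1 Foo.2) => //.
    by move=> h; apply: measurable_funM => //; exact: measurable_cst.
  by move=> h; apply: filterS (WF h) => z; rewrite normrM s1 mul1r.
pose U x := \sum_(j < n) a j * Y (t j) x.
pose V h x := \sum_(j < n) a j * Y (h * t j)%g x.
have comb s h : E (fun x => cos (U x + s * V h x)) = expR (- J s h).
  pose b (j : 'I_(n + n)) := match fintype.split j with inl i => a i | inr i => s * a i end.
  pose u (j : 'I_(n + n)) := match fintype.split j with inl i => t i | inr i => (h * t i)%g end.
  have split_sum (Z : G -> R) : \sum_(j < n + n) b j * Z (u j) =
      \sum_(j < n) a j * Z (t j) + s * \sum_(j < n) a j * Z (h * t j)%g.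
    rewrite big_split_ord mulr_sumr /=; congr (_ + _); apply: eq_bigr => i _; rewrite /b /u.
      by rewrite (unsplitK (inl i : 'I_n + 'I_n)).
    by rewrite (unsplitK (inr i : 'I_n + 'I_n)) mulrA.
  transitivity (E (fun x => cos (\sum_(j < n + n) b j * Y (u j) x))).
    by apply: eq_Rintegral => x _; rewrite (split_sum (fun g => Y g x)).
  rewrite (char_cos b u); congr (expR (- _)); apply: eq_Rintegral => z _.
  by rewrite (split_sum (fun g => f g z)).
have mlin (u : 'I_n -> G) : measurable_fun setT (fun x => \sum_(j < n) a j * Y (u j) x).
  apply: measurable_sum => j; apply: measurable_funM; first exact: measurable_cst.
  exact: measurable_funP.
apply: (@sub_finite_set _ _ ([set h | e <= `|J 1 h - 2 * I|] `|` [set h | e <= `|J (-1) h - 2 * I|])).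
  move=> h /= eh; apply: le_half_sum; apply: le_trans eh _.
  exact: (character_correlation (mlin t) (mlin (fun j => h * t j)%g) I0 (J0 1 h) (J0 (-1) h)
    (char_cos a t) (char_sin a t) (comb 1 h) (comb (-1) h) htrig).
by rewrite finite_setU; split; apply: bad; rewrite ?normrN1 ?normr1.
Qed.

End stable_characters.

(** * Stable fields over the Bowen--Margulis--Sullivan measure *)

Section stable_field.
Context {R : realType} {G : groupType} {X : metricType R}.
Context (act : G -> X -> X) (o : X).
Local Notation gp := (gromov_product (@mdist R X)).
Local Notation bd := (gboundary o).
Local Notation len g := (mdist o (act g o)).
Local Notation S := (bd_pairs o).
Local Notation phi := (@bd_phi R X o G act).
Variables (delta : R) (delta_gt0 : 0 < delta).
Hypothesis hyp : forall o x y z : X,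
  Num.min (gp o x y) (gp o y z) - delta <= gp o x z.
Hypothesis isom : isometric_action act.
Hypothesis fin_len : forall r : R, finite_set [set g | len g <= r].
Variable D : R.
Hypothesis cobounded : forall p, exists g, mdist p (act g o) <= D.
Hypothesis nonelementary : ~ elementary G.
Variable mu : X -> {finite_measure set bd -> \bar R}.
Hypothesis ps : patterson_sullivan act mu.
Variable m : {measure set (bd * bd) -> \bar R}.
Hypothesis bms : bowen_margulis_sullivan act mu m.
Variable alpha : R.
Hypothesis alpha_gt0 : 0 < alpha.

Let mS : measurable S.
Proof. exact: (measurable_pairs delta_gt0 hyp fin_len cobounded). Qed.

Let inv g A : measurable A -> m (phi g @^-1` A) = m A.
Proof. exact: (bms_invariant delta_gt0 hyp isom fin_len cobounded bms). Qed.

Let mphi g : measurable_fun setT (phi g).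
Proof. exact: (measurable_bd_phi hyp isom). Qed.

Let mixing (B : set (bd * bd)) (e : R) : measurable B -> (m B < +oo)%E -> 0 < e ->
  finite_set [set h | (e%:E <= m (B `&` phi h @^-1` B))%E].
Proof.
move=> mB Boo e0.
have mBS : measurable (B `&` S) by exact: measurableI.
have BSoo : (m (B `&` S) < +oo)%E.
  by apply: le_lt_trans Boo; apply: le_measure; rewrite ?inE //; exact: subIsetl.
apply: sub_finite_set (bms_mixing delta_gt0 hyp isom fin_len cobounded nonelementary
  ps bms mBS (@subIsetr _ _ _) BSoo e0) => h /=.
rewrite -(bms_setI delta_gt0 hyp fin_len cobounded bms (A := B `&` phi h @^-1` B)).
  congr (_ <= m _)%E; apply/seteqP; split => z /= [[Bz h1] h2].
    by split => //; split => //; apply/(bd_phi_pairs hyp isom).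
  by case: h2.
by apply: measurableI => //; rewrite -[X in measurable X]setTI; exact: mphi.
Qed.

(** On the sets of finite measure of an exhaustion, the invariance of [m] says that
    [w] and the constant [1] have the same integrals. *)
Lemma rn_derivative1 g w : rn_derivative act m g w -> {ae m, forall z, S z -> w z = 1}.
Proof.
move=> [mw w0 wE].
have [U [r [mU Uhomo US Ur]]] := pairs_exhaustion delta_gt0 hyp fin_len cobounded.
have UnS n : U n `<=` S by rewrite -US; exact: bigcup_sup.
have Uae n : ae_eq m (U n) (EFin \o cst 1) (EFin \o w).
  apply: integral_ae_eq => //.
  - apply/integrableP; split; first by apply/measurable_EFinP; exact: measurable_cst.
    under eq_integral do rewrite /= normr1.
    rewrite integral_cst // mul1e.
    exact: (bms_finite delta_gt0 hyp fin_len cobounded nonelementary bms (mU n) (Ur n)).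
  - apply/measurable_EFinP; exact: measurable_funS (UnS n) mw.
  move=> A AU mA; transitivity (\int[m]_(z in A) 1)%E; first by [].
  rewrite integral_cst // mul1e -wE //; last exact: subset_trans (UnS n).
  by rewrite (bd_phi_image hyp isom) inv.
have := ae_foralln Uae; apply: filterS => z hz Sz.
by have : S z by []; rewrite -US => -[n _ Uz]; have [] := hz n Uz.
Qed.

Section field.
Context {d : measure_display} {Omega : measurableType d}.
Context (P : probability Omega R) (Y : G -> {RV P >-> R}).
Local Notation E f := (\int[P]_w f w)%R.
Hypothesis sas : sas_field Y act m alpha.

(** The kernel is extended by zero, and the sign cocycle by one, to the diagonal,
    in order to apply [stable_decorrelated] on the whole square. *)
Lemma sas_decorrelated (trig : R -> R) : trig = cos \/ trig = sin ->
  forall (n : nat) (a : 'I_n -> R) (t : 'I_n -> G) (e : R), 0 < e ->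
  finite_set [set h | e <= `|E (fun w => trig (\sum_(j < n) a j * Y (t j) w) *
       trig (\sum_(j < n) a j * Y (h * t j)%g w)) -
     E (fun w => trig (\sum_(j < n) a j * Y (t j) w)) ^+ 2|].
Proof.
move: trig; have [_ [c [w [f [[mc c1 cM] wrn [mf foo] _ chf]]]]] := sas.
set f_ := fun g z => c g z * (w g z `^ alpha^-1) * f (phi g z) in chf.
pose ff g := (f_ g) \_ S.
have Sphi g z : S (phi g z) <-> S z by exact: (bd_phi_pairs hyp isom).
have mff g : measurable_fun setT (ff g).
  apply/(measurable_restrictT _ mS); apply: measurable_funM.
    apply: measurable_funM; first exact: mc.
    apply: (measurableT_comp (measurable_powR _)); by have [] := wrn g.
  apply: (measurable_comp mS _ mf); last exact: measurable_funTS.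
  by move=> _ [z Sz <-]; apply/Sphi.
have w1 g := rn_derivative1 (wrn g).
pose f0 := f \_ S.
have mf0 : measurable_fun setT f0 by exact/(measurable_restrictT _ mS).
have f0oo : finite_powR m alpha f0.
  split => //; rewrite integral_mkcond in foo; congr (_ < _)%E : foo; apply: eq_integral => z _.
  by rewrite /f0 /restrict /patch; case: ifP => _ //; rewrite normr0 powR0 // gt_eqF.
pose c' h z : R := if z \in S then c h z else 1.
have ae_f h g : {ae m, forall z, ff (h * g)%g z = c' h z * ff g (phi h z)}.
  have wphi : {ae m, forall z, S z -> w g (phi h z) = 1}.
    have [N [mN N0 NP]] := w1 g; exists (phi h @^-1` N); split.
    - by rewrite -[X in measurable X]setTI; exact: mphi.
    - by rewrite inv.
    - by move=> z /= hz; apply: NP => /= hphi; apply: hz => Sz; apply: hphi; exact/Sphi.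
  apply: filterS3 (cM h g) (w1 (h * g)%g) wphi => z h1 h2 h3.
  rewrite /ff /c' /restrict /patch; have [Sz|Sz] := pselect (S z); last first.
    by rewrite !memNset ?mulr0 //; apply: contra_not Sz => /Sphi.
  rewrite !mem_set //; last exact/Sphi.
  by rewrite /f_ (h1 Sz) (h2 Sz) (h3 Sz) powR1 (bd_phiM hyp isom) !mulr1 mulrA.
have ffoo g : finite_powR m alpha (ff g).
  apply: (finite_powR_phi mphi inv f0oo (mff g) (h := g)).
  apply: filterS (w1 g) => z wz; rewrite /f0 /ff /restrict /patch.
  have [Sz|Sz] := pselect (S z); last first.
    by rewrite !memNset //; apply: contra_not Sz => /Sphi.
  rewrite !mem_set //; last exact/Sphi.
  rewrite /f_ wz // powR1 mulr1 normrM.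
  by have [->|->] := c1 g z Sz; rewrite ?normrN normr1 mul1r.
have toT k (b : 'I_k -> R) (u : 'I_k -> G) :
    \int[m]_(z in S) (`|\sum_(j < k) b j * f_ (u j) z| `^ alpha) =
    \int[m]_z (`|\sum_(j < k) b j * ff (u j) z| `^ alpha).
  rewrite Rintegral_mkcond; apply: eq_Rintegral => z _; rewrite /ff /restrict /patch.
  case: ifPn => Sz //; rewrite big1 ?normr0 ?powR0 ?gt_eqF // => j _.
  by rewrite mulr0.
apply: (stable_decorrelated mphi inv mixing alpha_gt0 ffoo (c := c')) => //.
- move=> h z; rewrite /c'; case: ifPn => [|_]; last exact: normr1.
  by rewrite inE => Sz; have [->|->] := c1 h z Sz; rewrite ?normrN normr1.
- move=> k b u; have [hc _] := chf k b u; rewrite -toT.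
  by move: hc; rewrite /Rintegral unlock => ->.
- move=> k b u; have [_ hs] := chf k b u.
  by move: hs; rewrite /Rintegral unlock => ->.
Qed.

Lemma sas_ergodic : ergodic_field Y.
Proof.
apply: (decorrelated_ergodic (P := P)); last exact: sas_decorrelated.
  by move=> /finite_elementary.
by have [] := sas.
Qed.

End field.
End stable_field.

Theorem proposition5p8 (R : realType) (alpha : R) (G : groupType)
    (X : metricType R) (act : G -> X -> X) (o : X)
    (mu : X -> {finite_measure set (gboundary o) -> \bar R})
    (m : {measure set (gboundary o * gboundary o) -> \bar R}) :
  0 < alpha < 2 ->
  hyperbolic_group R G -> ~ elementary G ->
  proper_space X -> geodesic_space X -> gromov_hyperbolic (@mdist R X) ->
  isometric_action act -> properly_discontinuous act -> cocompact act ->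
  patterson_sullivan act mu ->
  bowen_margulis_sullivan act mu m ->
  (forall (B : set (gboundary o * gboundary o)) (F : nat -> {fset G}),
     measurable B -> B `<=` bd_pairs o -> (m B < +oo)%E ->
     (forall n, (F n `<=` F n.+1)%fset) -> (forall g, exists n, g \in F n) ->
     ((#|` F n|%:R^-1)%:E * \sum_(g <- F n) m (B `&` bd_phi act g @` B))%E
       @[n --> \oo] --> 0%E)
  /\
  (forall (d : measure_display) (Omega : measurableType d)
     (P : probability Omega R) (Y : G -> {RV P >-> R}),
     sas_field Y act m alpha -> ergodic_field Y).
Proof.
move=> /andP[alpha_gt0 _] _ nonelementary pX _ hX isom pd cc ps bms.
have [delta delta_gt0 hyp] := gromov_hyperbolic_gt0 hX.
have fin_len r := proper_finite_len o r pX pd.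
have [D cobounded] := cocompact_bounded o isom cc.
split=> [B F mB BS Boo Fincr Fexh|d Omega P Y]; last first.
  exact: (sas_ergodic delta_gt0 hyp isom fin_len cobounded nonelementary ps bms alpha_gt0).
have mBfin : m B \is a fin_num by rewrite ge0_fin_numE.
(* The image by [g] is the preimage by [g^-1], so exceptional sets are inverted. *)
have mix e : 0 < e -> finite_set [set g | (e%:E <= m (B `&` bd_phi act g @` B))%E].
  move=> e0.
  have fin := bms_mixing delta_gt0 hyp isom fin_len cobounded nonelementary ps bms mB BS Boo e0.
  apply: sub_finite_set (finite_image (fun g => g^-1%g) fin) => g /= hg.
  by exists g^-1%g; rewrite ?invgK // -(bd_phi_image hyp isom).
have mBg g : measurable (B `&` bd_phi act g @` B).
  apply: measurableI => //; rewrite (bd_phi_image hyp isom).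
  exact: (measurable_bd_phi_preim hyp isom).
apply: (cvg_average nonelementary (C := fine (m B))) => // g.
by rewrite fineK //; apply: le_measure; rewrite ?inE //; exact: subIsetl.
Qed.
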